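(* Let $\Lambda$ be a local family of arcs of a Catalan state $C\in\mathrm{Cat}(m,n)$ which vertically factorizes $C$. Then $$C(A)=C_{T(\Lambda)}(A)\cdot C_{\Lambda}(A).$$ In particular, $C$ is realizable if and only if $C_\Lambda$ is realizable.
   Context: Catalan states. $\mathrm{Cat}(m,n)$ is the set of Catalan states: non-crossing perfect matchings, by arcs embedded in a rectangle, of $2(m+n)$ boundary points: $x_1,\dots,x_n$ on the top side (left to right), $x'_1,\dots,x'_n$ on the bottom side (left to right), $y_1,\dots,y_m$ on the left side and $y'_1,\dots,y'_m$ on the right side (both top to bottom). Extended labels: $x_i=y_{1-i}=y'_{i-n}$ and $x'_i=y_{m+i}=y'_{m+(n-i)+1}$ for $1\le i\le n$. Coefficients. The $m\times n$ lattice crossing $L(m,n)$ is the grid of $m$ horizontal lines (joining $y_j$ to $y'_j$) and $n$ vertical lines (joining $x_i$ to $x'_i$). A Kauffman state $s$ assigns a marker $\pm1$ to each of the $mn$ crossings. A marker $+1$ smooths the crossing by joining its top half-edge to its right one and its left half-edge to its bottom one; a marker $-1$ joins top to left and bottom to right. Let $|D_s|$ be the number of closed components of the resulting diagram, and $C_s\in\mathrm{Cat}(m,n)$ the Catalan state obtained by discarding them. The coefficient of $C$ (its coefficient when $L(m,n)$ is expanded in the basis $\mathrm{Cat}(m,n)$ of the relative Kauffman bracket skein module) is $$C(A)=\sum_{s:\,C_s=C}A^{\#\{+1\text{ in }s\}-\#\{-1\text{ in }s\}}(-A^2-A^{-2})^{|D_s|}\in\mathbb{Z}[A^{\pm1}].$$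 $C$ is realizable if $C=C_s$ for some $s$. Local families. A non-empty set $\Lambda$ of arcs of $C$, with $\lambda=|\Lambda|$, is a local family of arcs if the set $E_\Lambda$ of ends of arcs of $\Lambda$ consists of consecutive boundary points of $C$ along the boundary of the rectangle. It is assumed that $E_\Lambda$ is not the set of all boundary points (automatic under condition (i) below when $m\ge1$). List $E_\Lambda$ in clockwise order (up the left side, left to right along the top, down the right side, right to left along the bottom) as consecutive points $p_1,\dots,p_{2\lambda}$. - $C_\Lambda\in\mathrm{Cat}(m,n)$ is obtained from $C$ by replacing the arcs of $\Lambda$ by the family of parallel arcs with the same set of ends, i.e. joining $p_i$ to $p_{2\lambda+1-i}$ for $1\le i\le\lambda$. - $T(\Lambda)$ is the plane rooted tree dual to the arcs of $\Lambda$: its vertices are the regions into which the arcs of $\Lambda$ cut the rectangle, its edges are the arcs of $\Lambda$, and its root is the region adjacent to the part of the boundary from $p_{2\lambda}$ clockwise to $p_1$. - $C_{T(\Lambda)}\in\mathrm{Cat}(\lambda,2\lambda)$ is the unique Catalan state with dual tree $T(\Lambda)$ all of whose bottom points are joined to left or right points; explicitly, $x_i$ is joined to $x_j$ iff $p_i$ is joined to $p_j$ by an arc of $\Lambda$, and $y_i$ is joined to $x'_{\lambda+1-i}$, $y'_i$ to $x'_{\lambda+i}$ for $1\le i\le\lambda$. Vertical factorization. $\Lambda$ vertically factorizes $C$ if (i) $E_\Lambda\cap\{y_1,\dots,y_m\}=\emptyset$ or $E_\Lambda\cap\{y'_1,\dots,y'_m\}=\emptyset$; and (ii) there are integers $0\le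 j_1\le j_2\le m$ such that for every arc $c$ of $C$ with ends $y_j,y_{j+1}$ or $y'_j,y'_{j+1}$ (extended labels): if $c\in\Lambda$ then $j_1\le j\le j_2$, otherwise $j\le j_1$ or $j\ge j_2$. *)

(* Defs.v *)
From HB Require Import structures.
From mathcomp Require Import all_boot all_order all_algebra.
From mathcomp Require Import zify.

Set Implicit Arguments.
Unset Strict Implicit.
Unset Printing Implicit Defensive.

Import Order.TTheory GRing.Theory Num.Theory.

(* Boundary points.  Ordinals start at 0: [Top i], [Bot i], [Lft j], [Rgt j]
   are x_{i+1}, x'_{i+1}, y_{j+1}, y'_{j+1}. *)

Inductive bpoint (m n : nat) :=
  Top of 'I_n | Bot of 'I_n | Lft of 'I_m | Rgt of 'I_m.
Arguments Top {m n} _.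
Arguments Bot {m n} _.
Arguments Lft {m n} _.
Arguments Rgt {m n} _.

Section BPointFinType.
Variables m n : nat.

Definition bpoint_code (p : bpoint m n) : ('I_n + 'I_n) + ('I_m + 'I_m) :=
  match p with
  | Top i => inl (inl i) | Bot i => inl (inr i)
  | Lft j => inr (inl j) | Rgt j => inr (inr j)
  end.

Definition bpoint_decode (u : ('I_n + 'I_n) + ('I_m + 'I_m)) : bpoint m n :=
  match u with
  | inl (inl i) => Top i | inl (inr i) => Bot i
  | inr (inl j) => Lft j | inr (inr j) => Rgt j
  end.

Lemma bpoint_codeK : cancel bpoint_code bpoint_decode.
Proof. by case. Qed.

HB.instance Definition _ := Finite.copy (bpoint m n) (can_type bpoint_codeK).

End BPointFinType.

Definition clockwise (m n : nat) : seq (bpoint m n) :=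
  rev [seq Lft j | j <- enum 'I_m] ++ [seq Top i | i <- enum 'I_n] ++
  [seq Rgt j | j <- enum 'I_m] ++ rev [seq Bot i | i <- enum 'I_n].

Definition cw (m n : nat) (p : bpoint m n) : nat := index p (clockwise m n).

(* Catalan states, up to isotopy: non-crossing perfect matchings of the
   boundary points, encoded by the involution exchanging the two ends of each
   arc. *)

Definition catalan (m n : nat) (f : bpoint m n -> bpoint m n) : bool :=
  [&& [forall p, f (f p) == p],
      [forall p, f p != p] &
      [forall p, forall q,
         ~~ [&& cw p < cw q, cw q < cw (f p) & cw (f p) < cw (f q)]]].

Record catState (m n : nat) := Cat {
  mate :> {ffun bpoint m n -> bpoint m n};
  mateP : catalan mate }.

HB.instance Definition _ (m n : nat) := [isSub for @mate m n].
HB.instance Definition _ (m n : nat) := [Finite of catState m n by <:].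

Definition arcs (m n : nat) (C : catState m n) : {set {set bpoint m n}} :=
  [set [set p; C p] | p : bpoint m n].

(* The lattice crossing L(m,n).  Its crossings cut it into segments: [inl (i, r)]
   is the part of the i-th vertical line between the r-th and the (r+1)-st
   horizontal line (r = 0 and r = m being the outermost parts), and
   [inr (j, c)] is the analogous part of the j-th horizontal line.  The crossing
   of row j and column i is (j, i). *)

Definition segment (m n : nat) : finType :=
  (('I_n * 'I_m.+1) + ('I_m * 'I_n.+1))%type.

Definition bsegment (m n : nat) (p : bpoint m n) : segment m n :=
  match p with
  | Top i => inl (i, ord0)
  | Bot i => inl (i, ord_max)
  | Lft j => inr (j, ord0)
  | Rgt j => inr (j, ord_max)
  end.

Section HalfEdges.
Variables (m n : nat) (c : 'I_m * 'I_n).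
Definition top_half : segment m n := inl (c.2, widen_ord (leqnSn m) c.1).
Definition bottom_half : segment m n := inl (c.2, lift ord0 c.1).
Definition left_half : segment m n := inr (c.1, widen_ord (leqnSn n) c.2).
Definition right_half : segment m n := inr (c.1, lift ord0 c.2).
End HalfEdges.

(* [true] is the marker +1, [false] the marker -1. *)
Definition kauffman (m n : nat) : finType := {ffun 'I_m * 'I_n -> bool}.

Definition smoothing (m n : nat) (s : kauffman m n) (c : 'I_m * 'I_n) :
    {set {set segment m n}} :=
  if s c then [set [set top_half c; right_half c];
                   [set left_half c; bottom_half c]]
  else [set [set top_half c; left_half c];
            [set bottom_half c; right_half c]].

Definition joined (m n : nat) (s : kauffman m n) : rel (segment m n) :=
  connect (fun u v => [exists c, [set u; v] \in smoothing s c]).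

(* |D_s|: the number of components of D_s that do not reach the boundary. *)
Definition nclosed (m n : nat) (s : kauffman m n) : nat :=
  #|[set K in equivalence_partition (joined s) [set: segment m n]
      | [forall p : bpoint m n, bsegment p \notin K]]|.

(* C_s = C *)
Definition resolves (m n : nat) (s : kauffman m n) (C : catState m n) : bool :=
  [forall p, forall q,
     (C p == q) == ((p != q) && joined s (bsegment p) (bsegment q))].

Definition realizable (m n : nat) (C : catState m n) : Prop :=
  exists s : kauffman m n, resolves s C.

(* Z[A, A^-1] is taken inside its fraction field, that of Z[A]. *)
Definition laurent_frac : fieldType := {fraction {poly int}}.

Definition varA : laurent_frac := tofrac ('X : {poly int}).

Definition coefficient (m n : nat) (C : catState m n) : laurent_frac :=
  (\sum_(s : kauffman m n | resolves s C)
     varA ^ (#|[set c | s c]|%:Z - #|[set c | ~~ s c]|%:Z) *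
     (- varA ^+ 2 - varA ^- 2) ^+ nclosed s)%R.

(* Local families of arcs.  L is the family Lambda, #|L| is lambda, and
   p_1, ..., p_(2 lambda) are the ends of its arcs, listed clockwise. *)

Definition ends (m n : nat) (L : {set {set bpoint m n}}) : {set bpoint m n} :=
  cover L.

(* The l consecutive boundary points that begin, clockwise, with the point of
   index k. *)
Definition run (m n k l : nat) : seq (bpoint m n) :=
  take l (rot k (clockwise m n)).

Definition local_family (m n : nat) (C : catState m n)
    (L : {set {set bpoint m n}}) : bool :=
  [&& L != set0, L \subset arcs C, ends L != [set: bpoint m n] &
      has (fun k => ends L == [set p in run m n k (#|L| + #|L|)])
          (iota 0 (size (clockwise m n)))].

(* [:: p_1; ...; p_(2 lambda)]; since not all boundary points are ends, the
   starting index is unique when the family is local. *)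
Definition ends_cw (m n : nat) (L : {set {set bpoint m n}}) :
    seq (bpoint m n) :=
  let k := find (fun k => ends L == [set p in run m n k (#|L| + #|L|)])
                (iota 0 (size (clockwise m n))) in
  run m n k (#|L| + #|L|).

Definition parallel_mate (m n : nat) (C : catState m n)
    (L : {set {set bpoint m n}}) : {ffun bpoint m n -> bpoint m n} :=
  [ffun p => let ps := ends_cw L in
     if p \in ps then nth p (rev ps) (index p ps) else C p].

(* The state with dual tree T(Lambda) all of whose bottom points are joined to
   left or right points: its top points reproduce the arcs of L.  [rev_ord a] is lambda - 1 - a, so
   (0-based) y_a is joined to x'_{lambda-1-a} and y'_a to x'_{lambda+a}.  The
   default value of [insubd] is not reached for a local family. *)
Definition tree_mate (m n : nat) (C : catState m n) (L : {set {set bpoint m n}})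
    (p : bpoint #|L| (#|L| + #|L|)) : bpoint #|L| (#|L| + #|L|) :=
  match p with
  | Top i => let ps := ends_cw L in
             Top (insubd i (nth 0 [seq index (C q) ps | q <- ps] i))
  | Lft a => Bot (lshift #|L| (rev_ord a))
  | Rgt a => Bot (rshift #|L| a)
  | Bot k => match split k with
             | inl a => Lft (rev_ord a)
             | inr a => Rgt a
             end
  end.

Arguments tree_mate {m n} C L p.

Section Boundary.
Variables m n : nat.
Implicit Types p q : bpoint m n.

Lemma mem_clockwise p : p \in clockwise m n.
Proof.
by rewrite !mem_cat !mem_rev; case: p => i; rewrite map_f ?mem_enum ?orbT.
Qed.

Lemma clockwise_uniq : uniq (clockwise m n).
Proof.
have u k (f : 'I_k -> bpoint m n) : injective f -> uniq [seq f i | i <- enum 'I_k].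
  by move=> /map_inj_uniq ->; apply: enum_uniq.
rewrite !cat_uniq !rev_uniq !u ?andbT; try by move=> ? ? [].
rewrite /=; apply/and3P; split; apply/hasPn => p;
  rewrite ?mem_cat ?mem_rev => pin; apply/negP;
  rewrite /= ?mem_rev => /mapP [j _ Ep]; move: pin; rewrite Ep;
  repeat case/orP; by case/mapP.
Qed.

Lemma size_clockwise : size (clockwise m n) = (m + n).*2.
Proof.
have sz k (T : Type) (f : 'I_k -> T) : size [seq f i | i <- enum 'I_k] = k.
  by rewrite size_map size_enum_ord.
by rewrite !size_cat !size_rev !sz; lia.
Qed.

Lemma cwE p : cw p = match p with
  | Lft j => m - j.+1
  | Top i => m + i
  | Rgt j => m + n + j
  | Bot i => m + n + m + (n - i.+1) end.
Proof.
have sz k (T : Type) (f : 'I_k -> T) : size [seq f i | i <- enum 'I_k] = k.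
  by rewrite size_map size_enum_ord.
have s1 : size (rev [seq @Lft m n j | j <- enum 'I_m]) = m
  by rewrite size_rev sz.
have s2 : size [seq @Top m n i | i <- enum 'I_n] = n
  by rewrite size_map size_enum_ord.
have s3 : size [seq @Rgt m n j | j <- enum 'I_m] = m
  by rewrite sz.
have s4 : size (rev [seq @Bot m n i | i <- enum 'I_n]) = n
  by rewrite size_rev sz.
have key k : k < size (clockwise m n) -> nth p (clockwise m n) k = p ->
    cw p = k.
  by move=> lt_k E; rewrite -[RHS](index_uniq p lt_k clockwise_uniq) E.
case: p key => i key; apply: key; rewrite ?size_clockwise; try by have := ltn_ord i; lia.
- rewrite nth_cat s1 ifF; last lia.
  rewrite nth_cat s2 addKn ltn_ord (nth_map i) ?size_enum_ord //.
  by rewrite nth_ord_enum.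
- have := ltn_ord i => lti.
  rewrite nth_cat s1 ifF; last lia.
  rewrite nth_cat s2 ifF; last lia.
  rewrite nth_cat s3 ifF; last lia.
  rewrite nth_rev sz; last lia.
  rewrite (nth_map i) ?size_enum_ord; last lia.
  congr Bot; apply: val_inj; rewrite /= nth_enum_ord; lia.
- have := ltn_ord i => lti.
  rewrite !nth_cat s1 ifT; last lia.
  rewrite nth_rev sz; last lia.
  rewrite (nth_map i) ?size_enum_ord; last lia.
  congr Lft; apply: val_inj; rewrite /= nth_enum_ord; lia.
- have := ltn_ord i => lti.
  rewrite nth_cat s1 ifF; last lia.
  rewrite nth_cat s2 ifF; last lia.
  rewrite nth_cat s3 ifT; last lia.
  rewrite (nth_map i) ?size_enum_ord; last lia.
  congr Rgt; apply: val_inj; rewrite /= nth_enum_ord; lia.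
Qed.

Lemma cw_lt p : cw p < (m + n).*2.
Proof. by rewrite -size_clockwise index_mem mem_clockwise. Qed.

Lemma index_rot k p : k <= (m + n).*2 ->
  index p (rot k (clockwise m n)) =
  if cw p < k then cw p + ((m + n).*2 - k) else cw p - k.
Proof.
move=> le_k; have sz := size_clockwise; have un := clockwise_uniq.
have lt_p := cw_lt p.
have key i : i < (m + n).*2 -> nth p (rot k (clockwise m n)) i = p ->
    index p (rot k (clockwise m n)) = i.
  move=> lt_i E; rewrite -[RHS](@index_uniq _ p i (rot k (clockwise m n))) ?E //.
    by rewrite size_rot sz.
  by rewrite rot_uniq.
have nth_cw : nth p (clockwise m n) (cw p) = p
  by rewrite nth_index ?mem_clockwise.
case: ltnP => lt_k; apply: key; try lia.
- rewrite /rot nth_cat size_drop sz ifF; last lia.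
  by rewrite addnC addKn nth_take.
- rewrite /rot nth_cat size_drop sz ifT; last lia.
  by rewrite nth_drop subnKC.
Qed.

Lemma catalanP (f : bpoint m n -> bpoint m n) :
  reflect [/\ involutive f, forall p, f p != p &
    forall p q, ~ (cw p < cw q /\ cw q < cw (f p) /\ cw (f p) < cw (f q))]
    (catalan f).
Proof.
apply: (iffP and3P) => [[/forallP fK /forallP fN /forallP fC]|[fK fN fC]].
  split=> // [p|p q [a [b c]]]; first exact/eqP.
  by have /forallP/(_ q) := fC p; rewrite a b c.
split; apply/forallP => p; first by rewrite fK.
  exact: fN.
by apply/forallP => q; apply/negP => /and3P [a b c]; apply: (fC p q).
Qed.

Lemma eq_catalan (f g : bpoint m n -> bpoint m n) :
  f =1 g -> catalan f = catalan g.
Proof.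
move=> fg; rewrite /catalan.
congr [&& _, _ & _]; apply: eq_forallb => p; rewrite ?fg //.
by apply: eq_forallb => q; rewrite !fg.
Qed.

(* Being non-crossing does not depend on where the boundary is cut. *)
Lemma noncrossing_rot (f : bpoint m n -> bpoint m n) k :
  involutive f -> k <= (m + n).*2 ->
  let pos p := index p (rot k (clockwise m n)) in
  (forall p q, ~ (cw p < cw q /\ cw q < cw (f p) /\ cw (f p) < cw (f q))) <->
  (forall p q, ~ (pos p < pos q /\ pos q < pos (f p) /\ pos (f p) < pos (f q))).
Proof.
move=> fK le_k /=; split=> H p q;
  have := H p q; have := H q (f p); have := H (f p) (f q); have := H (f q) p;
  rewrite !fK !index_rot //;
  move: (cw_lt p) (cw_lt q) (cw_lt (f p)) (cw_lt (f q)) => ? ? ? ?;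
  case: (ltnP (cw p) k); case: (ltnP (cw q) k); case: (ltnP (cw (f p)) k);
  case: (ltnP (cw (f q)) k); lia.
Qed.

End Boundary.

Section LocalFamily.
Variables (m n : nat) (C : catState m n) (L : {set {set bpoint m n}}).
Hypothesis hL : local_family C L.
Implicit Types p q : bpoint m n.

Lemma mateK : involutive C.
Proof. by case/catalanP: (mateP C). Qed.

Lemma mate_neq p : C p != p.
Proof. by case/catalanP: (mateP C). Qed.

Lemma local_arc c : c \in L -> exists p, c = [set p; C p].
Proof.
by case/and4P: hL => _ /subsetP sub _ _ /sub/imsetP [p _ ->]; exists p.
Qed.

Lemma ends_mate p : p \in ends L -> C p \in ends L.
Proof.
case/bigcupP => c cL pc; apply/bigcupP; exists c => //.
have [q eq_c] := local_arc cL; move: pc; rewrite eq_c !inE.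
by case/orP => /eqP ->; rewrite ?mateK eqxx ?orbT.
Qed.

Lemma ends_mateE p : (C p \in ends L) = (p \in ends L).
Proof. by apply/idP/idP => /ends_mate; rewrite ?mateK. Qed.

Lemma card_ends : #|ends L| = #|L| + #|L|.
Proof.
have /leqifP : #|cover L| <= \sum_(A in L) #|A| ?= iff trivIset L
  by exact: leq_card_cover.
have -> : trivIset L.
  apply/trivIsetP => A B AL BL; apply: contraR.
  have [p ->] := local_arc AL; have [q ->] := local_arc BL.
  case/pred0Pn => r; rewrite /= !inE => /andP [].
  case/orP => /eqP ->; case/orP => /eqP E.
  - by rewrite E.
  - by rewrite E mateK setUC.
  - by rewrite -E mateK setUC.
  - by rewrite (can_inj mateK E).
move/eqP=> ->; rewrite (eq_bigr (fun=> 2)) ?sum_nat_const; first by lia.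
by move=> A /local_arc [p ->]; rewrite cards2 eq_sym mate_neq.
Qed.

Lemma ends_cwP : exists2 k, k <= (m + n).*2 &
  ends_cw L = run m n k (#|L| + #|L|) /\ ends L = [set p in ends_cw L].
Proof.
case/and4P: hL => _ _ _ hk; set a := (fun k => _) in hk.
exists (find a (iota 0 (size (clockwise m n)))).
  by rewrite -size_clockwise -[leqRHS](size_iota 0); apply: find_size.
split=> //; have := nth_find 0 hk; rewrite nth_iota ?add0n; last first.
  by move: hk; rewrite has_find size_iota.
by move/eqP.
Qed.

Lemma mem_ends_cw p : (p \in ends_cw L) = (p \in ends L).
Proof. by have [k _ [_ ->]] := ends_cwP; rewrite inE. Qed.

Lemma ends_cw_uniq : uniq (ends_cw L).
Proof.
have [k _ [-> _]] := ends_cwP.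
by rewrite take_uniq // rot_uniq clockwise_uniq.
Qed.

Lemma size_ends_cw : size (ends_cw L) = #|L| + #|L|.
Proof.
rewrite -card_ends; have [k _ [_ ->]] := ends_cwP.
by rewrite cardsE (card_uniqP ends_cw_uniq).
Qed.

(* A common frame: indices of boundary points counted from p_1. *)
Lemma local_frame : exists pos : bpoint m n -> nat,
  [/\ forall p, (p \in ends L) = (pos p < #|L| + #|L|),
      {in ends L, forall p, index p (ends_cw L) = pos p},
      injective pos &
      forall f : bpoint m n -> bpoint m n, involutive f ->
      (forall p q, ~ (cw p < cw q /\ cw q < cw (f p) /\ cw (f p) < cw (f q)))
      <-> (forall p q,
          ~ (pos p < pos q /\ pos q < pos (f p) /\ pos (f p) < pos (f q)))].
Proof.
have [k le_k [E _]] := ends_cwP.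
have mem p : p \in rot k (clockwise m n) by rewrite mem_rot mem_clockwise.
exists (fun p => index p (rot k (clockwise m n))); split.
- by move=> p; rewrite -mem_ends_cw E in_take.
- move=> p; rewrite -mem_ends_cw => pL.
  rewrite -[rot _ _](cat_take_drop (#|L| + #|L|)) index_cat -/(run _ _ _ _).
  by rewrite -E pL.
- by move=> p q /index_inj; apply.
- by move=> f fK; apply: noncrossing_rot.
Qed.

Lemma parallel_catalan : catalan (parallel_mate C L).
Proof.
have [pos [memE idx inj nc]] := local_frame.
set f := parallel_mate C L.
have out p : p \notin ends L -> f p = C p.
  by rewrite /f ffunE /= mem_ends_cw => /negbTE ->.
have ins p : p \in ends L ->
    f p \in ends L /\ pos (f p) = #|L| + #|L| - (pos p).+1.
  move=> pL; rewrite /f ffunE /= mem_ends_cw pL.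
  have lt_p : pos p < size (ends_cw L) by rewrite size_ends_cw -memE.
  rewrite idx // nth_rev // size_ends_cw; move: lt_p; rewrite size_ends_cw => lt_p.
  have lt_q : #|L| + #|L| - (pos p).+1 < size (ends_cw L)
    by rewrite size_ends_cw; lia.
  have qL := mem_nth p lt_q; rewrite mem_ends_cw in qL.
  by split=> //; rewrite -idx // index_uniq // ends_cw_uniq.
have fE p : (f p \in ends L) = (p \in ends L).
  by have [pL|pL] := boolP (p \in ends L); [case: (ins p pL) => -> |
     rewrite out // ends_mateE (negbTE pL)].
have fK : involutive f.
  move=> p; have [pL|pL] := boolP (p \in ends L); last first.
    by rewrite (out (f p)) ?fE // out // mateK.
  have [qL Eq] := ins _ pL; have [rL Er] := ins _ qL.
  by apply: inj; move: pL; rewrite Er Eq memE; lia.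
apply/catalanP; split=> //.
  move=> p; have [pL|pL] := boolP (p \in ends L); last by rewrite out ?mate_neq.
  apply/eqP => /(congr1 pos); have [_ ->] := ins _ pL.
  by move: pL; rewrite memE; lia.
apply/(nc f fK) => p q [lt1 [lt2 lt3]].
have [pL|pL] := boolP (p \in ends L).
  have [fpL Ep] := ins _ pL.
  have qL : q \in ends L by move: fpL; rewrite !memE; lia.
  by have [_ Eq] := ins _ qL; move: lt1 lt2 lt3; rewrite Ep Eq; lia.
have qL : q \notin ends L by move: pL; rewrite !memE; lia.
case/catalanP: (mateP C) => CK _ /(nc C CK) /(_ p q) [].
by rewrite -(out p) // -(out q).
Qed.

Lemma tree_catalan : catalan [ffun p => tree_mate C L p].
Proof.
have [pos [memE idx inj nc]] := local_frame.
set l := #|L|; rewrite (eq_catalan (ffunE _)).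
pose f : bpoint l (l + l) -> bpoint l (l + l) := tree_mate C L.
change (catalan f).
pose x (i : 'I_(l + l)) (p : bpoint m n) := p \in ends L /\ pos p = i.
have xex i : exists p, x i p.
  have lt_i : i < size (ends_cw L) by rewrite size_ends_cw.
  case E: (ends_cw L) lt_i => [//|p0 s]; rewrite -E => lt_i.
  have pL := mem_nth p0 lt_i; rewrite mem_ends_cw in pL.
  exists (nth p0 (ends_cw L) i); split=> //.
  by rewrite -idx // index_uniq // ends_cw_uniq.
have xf i p : x i p -> exists2 j, f (Top i) = Top j & x j (C p).
  move=> [pL Ep]; have CpL : C p \in ends L by rewrite ends_mateE.
  have lt_j : pos (C p) < l + l by rewrite -memE.
  exists (Ordinal lt_j) => //; congr Top; apply: val_inj.
  rewrite /= (nth_map p) ?size_ends_cw // -Ep -idx // nth_index ?mem_ends_cw //.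
  by rewrite (idx (C p)) // val_insubd lt_j.
have top i : exists j, [/\ f (Top i) = Top j, f (Top j) = Top i & i != j].
  have [p xp] := xex i; have [j Ej xj] := xf _ _ xp; have [i' Ei xi] := xf _ _ xj.
  exists j; split=> //.
    rewrite Ei; congr Top; apply: val_inj.
    by case: xi xp => _; rewrite mateK => E1 [_ E2]; exact: etrans (esym E1) E2.
  apply/eqP => ij; case: xj xp => _ E1 [_ E2].
  by have /inj/eqP : pos (C p) = pos p; rewrite ?(negbTE (mate_neq _)) // E1 E2 ij.
have botE (k : 'I_(l + l)) :
  (exists2 a : 'I_l, f (Bot k) = Lft (rev_ord a) & k = a :> nat) \/
  (exists2 a : 'I_l, f (Bot k) = Rgt a & k = l + a :> nat).
  by rewrite /f /=; case: splitP => a Ea; [left|right]; exists a.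
have nt i : exists2 j, f (Top i) = Top j &
    forall i' j', f (Top i') = Top j' -> ~ (i < i' /\ i' < j /\ j < j').
  have [p xp] := xex i; have [j Ej xj] := xf _ _ xp; exists j => // i' j'.
  have [p' xp'] := xex i'; have [j'' -> xj'] := xf _ _ xp' => -[<-].
  case/catalanP: (mateP C) => CK _ /(nc C CK) /(_ p p').
  by case: xp xj xp' xj' => _ -> [_ ->] [_ ->] [_ ->].
have ft (a : 'I_l) : f (Lft a) = @Bot l (l + l) (lshift l (rev_ord a)) by [].
have fr (a : 'I_l) : f (Rgt a) = @Bot l (l + l) (rshift l a) by [].
clearbody f; clear xf xex x; clearbody l; clear -top botE nt ft fr.
apply/catalanP; split.
- case=> i; have lti := ltn_ord i.
  + by have [j [-> ->]] := top i.
  + case: (botE i) => -[a -> Ea]; rewrite ?ft ?fr; congr Bot;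
      apply: val_inj => /=; have lta := ltn_ord a; lia.
  + rewrite ft; case: (botE (lshift l (rev_ord i))) => -[a -> /= Ea].
      congr Lft; apply: val_inj => /=; lia.
    lia.
  + rewrite fr; case: (botE (rshift l i)) => -[a -> /= Ea].
      by have := ltn_ord a; lia.
    by congr Rgt; apply: val_inj => /=; lia.
- case=> i; rewrite ?ft ?fr //; last by case: (botE i) => -[a ->].
  by have [j [-> _ ij]] := top i; apply: contraNneq ij => -[->].
- case=> i q; have lti := ltn_ord i.
  + have [j Ej H] := nt i; have ltj := ltn_ord j.
    case: q => k; have ltk := ltn_ord k; last 3 first.
    * by rewrite Ej !cwE; lia.
    * by rewrite Ej !cwE; lia.
    * by rewrite Ej !cwE; lia.
    have [k' Ek _] := nt k; rewrite Ej Ek !cwE => K.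
    by apply: (H _ _ Ek); lia.
  + by case: (botE i) => -[a -> Ea]; have lta := ltn_ord a; rewrite !cwE; lia.
  + rewrite ft; case: q => k; have ltk := ltn_ord k.
    * by have [j -> _] := nt k; have ltj := ltn_ord j; rewrite !cwE /=; lia.
    * by case: (botE k) => -[a -> Ea]; have lta := ltn_ord a; rewrite !cwE /=; lia.
    * by rewrite ft !cwE /=; lia.
    * by rewrite fr !cwE /=; lia.
  + rewrite fr; case: q => k; have ltk := ltn_ord k.
    * by have [j -> _] := nt k; have ltj := ltn_ord j; rewrite !cwE /=; lia.
    * by case: (botE k) => -[a -> Ea]; have lta := ltn_ord a; rewrite !cwE /=; lia.
    * by rewrite ft !cwE /=; lia.
    * by rewrite fr !cwE /=; lia.
Qed.

(* C_Lambda *)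
Definition parallel_state : catState m n := Cat parallel_catalan.

(* C_{T(Lambda)} *)
Definition tree_state : catState #|L| (#|L| + #|L|) := Cat tree_catalan.

End LocalFamily.

(* Extended labels: the j such that a boundary point is y_j, resp. y'_j. *)

Definition ylabel (m n : nat) (p : bpoint m n) : option int :=
  (match p with
   | Top i => Some (1 - (i.+1)%:Z)
   | Lft j => Some (j.+1)%:Z
   | Bot i => Some (m%:Z + (i.+1)%:Z)
   | Rgt _ => None
   end)%R.

Definition y'label (m n : nat) (p : bpoint m n) : option int :=
  (match p with
   | Top i => Some ((i.+1)%:Z - n%:Z)
   | Rgt j => Some (j.+1)%:Z
   | Bot i => Some (m%:Z + (n%:Z - (i.+1)%:Z) + 1)
   | Lft _ => None
   end)%R.

Definition ends_at (m n : nat) (label : bpoint m n -> option int)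
    (c : {set bpoint m n}) (j : int) : Prop :=
  exists p q, [/\ c = [set p; q], label p = Some j & label q = Some (j + 1)%R].

Definition vertically_factorizes (m n : nat) (C : catState m n)
    (L : {set {set bpoint m n}}) : Prop :=
  ((forall j, Lft j \notin ends L) \/ (forall j, Rgt j \notin ends L)) /\
  exists j1 j2 : int,
    [/\ (0 <= j1)%R, (j1 <= j2)%R, (j2 <= m%:Z)%R &
     forall (c : {set bpoint m n}) (j : int), c \in arcs C ->
       ends_at (@ylabel m n) c j \/ ends_at (@y'label m n) c j ->
       if c \in L then (j1 <= j <= j2)%R else (j <= j1)%R || (j2 <= j)%R].

(* Main.v *)
(* Draw L(m,n) crossing by crossing.  Only the matching of the boundary points
   matters at each stage, so C(A) is an iterated sum of smoothings acting on
   matchings, and by the second Reidemeister move an arc joining two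
   neighbouring lines may be pulled off the lines still to be drawn.

   Rows 1 to j_1 and, seen from below, rows j_2 + 1 to m contribute the same
   to C and C_Lambda, since no arc of Lambda has both ends above j_1 or both
   below j_2.  In the middle rows no arc outside Lambda joins neighbouring
   points of the left side.  Drawing these column by column, each vertical
   line plucks a pair of equal neighbours off the word formed by the arcs met
   along the boundary, and C(A) counts with weights the ways of emptying that
   word.  The arcs of Lambda form a subword whose pairs of neighbours may all
   be plucked at any time: its own plucking polynomial factors out and a
   parallel family of arcs remains in its place.  For the tree state the same
   expansion gives the plucking polynomial of Lambda alone, up to reversal of
   the word, which does not change the polynomial.

   At A = 1 the coefficient of C is nonzero if and only if C is realizable,
   and plucking polynomials are positive, whence the last claim. *)

Require Import Defs.
From mathcomp Require Import all_boot all_order all_algebra.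
From mathcomp Require Import all_fingroup zify ring.

Set Implicit Arguments.
Unset Strict Implicit.
Unset Printing Implicit Defensive.

Import Order.TTheory GRing.Theory Num.Theory.
Local Open Scope ring_scope.

(** The weights [al], [be], [de] live in any commutative ring with [al * be = 1] and
    [de = - al ^+ 2 - be ^+ 2], so that one factorization serves both A and A = 1. At A = 1 a closed
    component counts -2 and terms of both signs occur, so a realizing state does not at once make
    the sum nonzero. Pulling arcs off the lines still to be drawn gives an expansion without closed
    components, hence without cancellation; the work lies in following a realizing state through
    these moves.

    Smoothing a crossing of two strands has the same effect on the matching at either pair of their
    ends. Hence the diagram may be drawn from the opposite corner, which puts the bottom rows on the
    same footing as the top rows and reduces a family avoiding the right side to one avoiding the
    left side.

    The outer rows can be removed because every arc completed while drawing them has both ends above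
    j_1 or both below j_2. This needs that no arc of Lambda, and also none of its parallel
    replacement, is of this kind; for the latter the reason is a count of ends. *)

Ltac decide_eqs := intros; cbv zeta; repeat
  (match goal with |- context [@eq_op ?T ?x ?y] =>
     (* A test whose side is still a conditional waits until that conditional has been decided. *)
     lazymatch x with context [if _ then _ else _] => fail | _ => idtac end;
     lazymatch y with context [if _ then _ else _] => fail | _ => idtac end;
     case: (@eqP T x y) => ?; try (exfalso; congruence)
   end); congruence.

(** * State sums over matchings *)

Section Smoothings.
Variable P : finType.
Implicit Types (f g : {ffun P -> P}) (h v w p q : P).

Definition matching f := involutive f /\ forall p, f p != p.

(* The part of the diagram drawn so far enters only through the matching [f]
   of its ports, a line keeping the name of its port while it is drawn.
   [swp h v f] and [cup h v f] are the matchings after smoothing the crossing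
   of the lines [h] (horizontal) and [v] (vertical) with marker +1 and -1. *)
Definition swp h v f : {ffun P -> P} :=
  [ffun p => tperm h v (f (tperm h v p))].

Definition cup h v f : {ffun P -> P} :=
  [ffun p => if p == h then v else if p == v then h else
             if p == f h then f v else if p == f v then f h else f p].

Lemma swp_matching h v f : matching f -> matching (swp h v f).
Proof.
move=> [fK fN]; split=> p; first by rewrite !ffunE tpermK fK tpermK.
by rewrite ffunE -(inj_eq (@perm_inj _ (tperm h v))) tpermK fN.
Qed.

Lemma cup_matching h v f : h != v -> matching f -> matching (cup h v f).
Proof.
move=> /eqP hv [fK fN]; split=> p; rewrite !ffunE.
  have := fK p; have := fK h; have := fK v.
  have /eqP := fN p; have /eqP := fN h; have /eqP := fN v.
  by decide_eqs.
apply/eqP; have := fK p; have := fK h; have := fK v.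
have /eqP := fN p; have /eqP := fN h; have /eqP := fN v.
by decide_eqs.
Qed.

Lemma swpC h v f : swp h v f = swp v h f.
Proof. by rewrite /swp tpermC. Qed.

Lemma cupC h v f : h != v -> matching f -> cup h v f = cup v h f.
Proof.
move=> /eqP hv [fK fN]; apply/ffunP => p; rewrite !ffunE.
have := fK p; have := fK h; have := fK v.
by decide_eqs.
Qed.

Lemma swp_id h v f : matching f -> f h = v -> swp h v f = f.
Proof.
move=> [fK fN] E; apply/ffunP => p; rewrite !ffunE.
have := fK p; have := fK h.
by case: (tpermP h v p) => [->|->|] *; case: tpermP; congruence.
Qed.

Lemma cup_id h v f : matching f -> f h = v -> cup h v f = f.
Proof.
move=> [fK fN] E; apply/ffunP => p; rewrite !ffunE.
have := fK p; have := fK h.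
by decide_eqs.
Qed.

(** Both sides turn the strands {h, f h} and {v, f v} into {h, f v} and {v, f h}. With the analogue
    for [cup] this is what allows a diagram to be drawn from either end. *)
Lemma swp_out h v f : matching f -> swp (f h) (f v) f = swp h v f.
Proof.
move=> [fK fN]; apply/ffunP => p; rewrite !ffunE.
have := fK p; have := fK h; have := fK v.
have /eqP := fN p; have /eqP := fN h; have /eqP := fN v.
move=> ? ? ? ? ? ?.
case: (tpermP h v p) => *; case: (tpermP (f h) (f v) p) => *;
by do 2!case: tpermP; congruence.
Qed.

Lemma cup_out h v f : h != v -> matching f -> cup (f h) (f v) f = cup h v f.
Proof.
move=> /eqP hv [fK fN]; apply/ffunP => p; rewrite !ffunE !fK.
have := fK p; have := fK h; have := fK v.
have /eqP := fN p; have /eqP := fN h; have /eqP := fN v.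
by decide_eqs.
Qed.

Lemma swp_swp a b c d f : swp a b (swp c d f) =
  swp (tperm a b c) (tperm a b d) (swp a b f).
Proof.
apply/ffunP => p; rewrite -(tpermK a b p); move: (tperm a b p) => {}p.
by rewrite !ffunE -!(inj_tperm _ _ _ (@perm_inj _ (tperm a b))) !tpermK.
Qed.

Lemma swp_cup a b c d f :
  swp a b (cup c d f) = cup (tperm a b c) (tperm a b d) (swp a b f).
Proof.
apply/ffunP => p; rewrite -(tpermK a b p); move: (tperm a b p) => {}p.
rewrite !ffunE !tpermK !(inj_eq (@perm_inj _ (tperm a b))).
by do !case: ifP => //.
Qed.

Lemma cup_cup a b c d f : a != b -> c != d -> a != c -> a != d -> b != c ->
  b != d -> matching f -> cup a b (cup c d f) = cup c d (cup a b f).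
Proof.
move=> /eqP ab /eqP cd /eqP ac /eqP ad /eqP bc /eqP bd [fK fN].
have := fK a; have := fK b; have := fK c; have := fK d.
have /eqP := fN a; have /eqP := fN b; have /eqP := fN c; have /eqP := fN d.
move=> ? ? ? ? ? ? ? ?.
apply/ffunP => p; have := fK p; have /eqP := fN p; rewrite !ffunE => ? ?.
decide_eqs.
Qed.

End Smoothings.

(** * Grids of crossings and a line passing over an arc *)

Section Cells.
Variable P : finType.
Implicit Types (f g : {ffun P -> P}) (h v w p q u : P) (c : P * P).
Implicit Types (us ds pre suf : seq P) (cs : seq (P * P)).

Definition apart c c' :=
  [&& c.1 != c'.1, c.1 != c'.2, c.2 != c'.1 & c.2 != c'.2].

Definition line u ds : seq (P * P) := [seq (u, v) | v <- ds].

Definition cells us ds : seq (P * P) := [seq (u, v) | u <- us, v <- ds].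

Lemma cells_cons u us ds : cells (u :: us) ds = line u ds ++ cells us ds.
Proof. by []. Qed.

Lemma cells_cat us us' ds : cells (us ++ us') ds = cells us ds ++ cells us' ds.
Proof. exact: allpairs_cat. Qed.

Lemma line_cat u ds ds' : line u (ds ++ ds') = line u ds ++ line u ds'.
Proof. exact: map_cat. Qed.

Lemma mem_line c u ds : c \in line u ds -> c.1 = u /\ c.2 \in ds.
Proof. by case/mapP => v vds ->. Qed.

Lemma mem_cells c us ds : c \in cells us ds -> c.1 \in us /\ c.2 \in ds.
Proof. by case/allpairsP => -[u v] /= [? ? ->]. Qed.

Lemma swp_apart (a b c d : P) f : apart (a, b) (c, d) ->
  swp a b (swp c d f) = swp c d (swp a b f).
Proof. by case/and4P => /= ac ad bc bd; rewrite swp_swp !tpermD. Qed.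

Lemma swp_cup_apart (a b c d : P) f : apart (a, b) (c, d) ->
  swp a b (cup c d f) = cup c d (swp a b f).
Proof. by case/and4P => /= ac ad bc bd; rewrite swp_cup !tpermD. Qed.

Lemma apartC c c' : apart c c' = apart c' c.
Proof.
by rewrite /apart !(eq_sym c'.1) !(eq_sym c'.2); do 4!case: (_ == _).
Qed.

Lemma swp_off h v f p : p != h -> p != v -> f p != h -> f p != v ->
  swp h v f p = f p.
Proof. by move=> ph pv fh fv; rewrite ffunE !tpermD // eq_sym. Qed.

Lemma swp_l h v f : matching f -> f h != v -> swp h v f v = f h.
Proof.
by case=> _ fN fhv; rewrite ffunE tpermR tpermD // eq_sym.
Qed.

Lemma swp_r h v f : matching f -> f h != v -> swp h v f h = f v.
Proof.
case=> fK fN fhv; rewrite ffunE tpermL tpermD //; last by rewrite eq_sym fN.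
by apply: contraNneq fhv => ->; rewrite fK.
Qed.

Lemma cup_off h v f p : matching f -> p != h -> p != v -> f p != h ->
  f p != v -> cup h v f p = f p.
Proof.
move=> [fK fN] ph pv fh fv; rewrite ffunE (negbTE ph) (negbTE pv).
rewrite ifN; last by apply: contraNneq fh => ->; rewrite fK.
by rewrite ifN //; apply: contraNneq fv => ->; rewrite fK.
Qed.

Lemma cup_l h v f : cup h v f h = v.
Proof. by rewrite ffunE eqxx. Qed.

Lemma cup_r h v f : h != v -> cup h v f v = h.
Proof. by move=> hv; rewrite ffunE eqxx eq_sym (negbTE hv). Qed.

(* In the next lemmas [v] and [w] are joined, so that [h] can be pulled over
   the arc between them. *)

Lemma swp_swp_arc h v w f : matching f -> f v = w -> h != v -> h != w ->
  swp h w (swp h v f) = swp h v f.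
Proof.
move=> fm fv hv hw; apply: swp_id; first exact: swp_matching.
by rewrite ffunE tpermL fv tpermD // -fv eq_sym; case: fm.
Qed.

Lemma cup_swp_arc h v w f : matching f -> f v = w -> h != v -> h != w ->
  cup h w (swp h v f) = swp h v f.
Proof.
move=> fm fv hv hw; apply: cup_id; first exact: swp_matching.
by rewrite ffunE tpermL fv tpermD // -fv eq_sym; case: fm.
Qed.

Lemma swp_cup_arc h v w f : matching f -> f v = w -> h != v -> h != w ->
  swp h w (cup h v f) = f.
Proof.
move=> [fK fN] fv /eqP hv /eqP hw; apply/ffunP => p; rewrite !ffunE.
have := fK p; have := fK h; have := fK v; have := fK w.
have /eqP := fN p; have /eqP := fN h; have /eqP := fN v; have /eqP := fN w.
by case: (tpermP h w p) => ?; rewrite /tperm ?permE /=; decide_eqs.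
Qed.

Lemma cup_cup_arc h v w f : matching f -> f v = w -> h != v -> h != w ->
  cup h w (cup h v f) = swp h v f.
Proof.
move=> [fK fN] fv /eqP hv /eqP hw; apply/ffunP => p; rewrite !ffunE.
have := fK p; have := fK h; have := fK v; have := fK w.
have /eqP := fN p; have /eqP := fN h; have /eqP := fN v; have /eqP := fN w.
by case: (tpermP h v p) => ?; rewrite /tperm ?permE /=; decide_eqs.
Qed.

(** Serves to follow a single state: the Reidemeister move only preserves the sum over states, but
    capping off [v] and [w] forgets that [h] has passed them with markers +1 and -1. *)
Lemma cup_swp_cup h v w f : matching f -> v != w -> h != v -> h != w ->
  cup v w (cup h w (swp h v f)) = cup v w f.
Proof.
move=> fm vw hv hw.
have mY := cup_matching vw fm.
have wh : w != h by rewrite eq_sym.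
have mS := swp_matching h v mY.
have -> : cup h w (swp h v f) = swp h v (cup v w f).
  by rewrite swp_cup tpermR tpermD // eq_sym.
move: (cup v w f) mY (cup_l v w f) => Y mY Yv.
have [mK mN] := mY.
apply/ffunP => p; rewrite !ffunE.
have := mK p; have := mK h; have := mK v; have := mK w.
have /eqP := mN p; have /eqP := mN h; have /eqP := mN v; have /eqP := mN w.
move/eqP: vw => vw; move/eqP: hv => hv; move/eqP: hw => hw.
by rewrite /tperm !permE /=; decide_eqs.
Qed.

Lemma rev_cells us ds : rev (cells us ds) = cells (rev us) (rev ds).
Proof.
elim: us => [|u us IH]; first by rewrite /rev.
rewrite cells_cons rev_cat IH rev_cons -cats1 cells_cat; congr (_ ++ _).
by rewrite cells_cons cats0 /line map_rev.
Qed.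

End Cells.

(** * State sums and the order of the crossings *)

Section StateSum.
Variables (P : finType) (R : comNzRingType) (al be de : R).
Implicit Types (f g : {ffun P -> P}) (h v w p q u : P) (c : P * P).
Implicit Types (us ds pre suf : seq P) (cs : seq (P * P)).
Implicit Types (phi psi : {ffun P -> P} -> R).

Definition loop h v f : R := if f h == v then de else 1.

Definition crossing c phi f : R :=
  al * phi (swp c.1 c.2 f) + be * loop c.1 c.2 f * phi (cup c.1 c.2 f).

Definition ssum cs phi : {ffun P -> P} -> R := foldr crossing phi cs.

Lemma ssum_cat cs cs' phi : ssum (cs ++ cs') phi = ssum cs (ssum cs' phi).
Proof. exact: foldr_cat. Qed.

(** An invariant of both smoothings holds at the end of every state. The factor [k] is 0 in
    vanishing arguments and 1 when two final functions are compared. *)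
Lemma ssum_inv (I : {ffun P -> P} -> Prop) cs phi psi k f :
  (forall c f, c \in cs -> I f -> I (swp c.1 c.2 f) /\ I (cup c.1 c.2 f)) ->
  (forall f, I f -> phi f = k * psi f) -> I f ->
  ssum cs phi f = k * ssum cs psi f.
Proof.
elim: cs f => [|c cs IH] f Ics Iphi If; first exact: Iphi.
have [I1 I2] := Ics c f (mem_head _ _) If.
rewrite /= /crossing !IH // => [|c' f' c'cs|c' f' c'cs]; first by ring.
  by apply: Ics; rewrite inE c'cs orbT.
by apply: Ics; rewrite inE c'cs orbT.
Qed.

Definition loopless cs := all (fun c => c.1 != c.2) cs.

Lemma ssum_ext cs phi psi f : loopless cs ->
  (forall f, matching f -> phi f = psi f) -> matching f ->
  ssum cs phi f = ssum cs psi f.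
Proof.
move=> /allP pcs E fm; rewrite -[RHS]mul1r; apply: (ssum_inv _ _ fm).
  move=> c f' /pcs cc f'm; split; first exact: swp_matching.
  exact: cup_matching.
by move=> f' /E ->; rewrite mul1r.
Qed.

Lemma loop_swp_apart (a b c d : P) f : apart (a, b) (c, d) ->
  loop c d (swp a b f) = loop c d f.
Proof.
case/and4P => /= ac ad bc bd; rewrite /loop ffunE (tpermD ac bc).
have -> : (tperm a b (f c) == d) = (f c == d) => //.
by rewrite -{1}(tpermD ad bd) (inj_eq perm_inj).
Qed.

(** Two markers -1 close the same number of components in either order, although which of the two
    closes one can depend on the order. *)
Lemma loop_cup_apart (a b c d : P) f : a != b -> c != d ->
  apart (a, b) (c, d) -> matching f ->
  loop a b f * loop c d (cup a b f) = loop c d f * loop a b (cup c d f).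
Proof.
move=> ab cd ap fm; have [fK fN] := fm; rewrite /loop.
have ap' : apart (c, d) (a, b) by rewrite apartC.
case: (eqVneq (f a) b) => [E|Nab].
  rewrite cup_id //.
  have [Ec|Nc] := eqVneq (f c) d; first by rewrite cup_id // E eqxx.
  case/and4P: ap' => /= ca cb da db.
  rewrite cup_off ?E 1?eq_sym // ?eqxx ?mul1r ?mulr1 // eq_sym //.
case: (eqVneq (f c) d) => [E|Ncd].
  rewrite [cup c d f]cup_id // (negbTE Nab) mulr1 mul1r.
  case/and4P: ap => /= ac ad bc bd.
  rewrite cup_off ?E 1?eq_sym // ?eqxx // eq_sym //.
rewrite !mul1r; congr (if _ then _ else _).
case/and4P: ap => /= /eqP ac /eqP ad /eqP bc /eqP bd.
move/eqP: ab => ab; move/eqP: cd => cd; move/eqP: Nab => Nab.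
move/eqP: Ncd => Ncd; rewrite !ffunE.
have := fK a; have := fK b; have := fK c; have := fK d.
have /eqP := fN a; have /eqP := fN b; have /eqP := fN c; have /eqP := fN d.
by decide_eqs.
Qed.

Lemma crossingC c c' phi f : c.1 != c.2 -> c'.1 != c'.2 -> apart c c' ->
  matching f -> crossing c (crossing c' phi) f = crossing c' (crossing c phi) f.
Proof.
case: c c' => [a b] [c d] /= ab cd ap fm; rewrite /crossing /=.
have ap' : apart (c, d) (a, b) by rewrite apartC.
rewrite !loop_swp_apart // (swp_apart f ap) (swp_cup_apart f ap).
rewrite (swp_cup_apart f ap').
case/and4P: (ap) => /= ac ad bc bd; rewrite (cup_cup ab cd) //.
have := loop_cup_apart ab cd ap fm.
set x := loop a b f; set x' := loop c d (cup a b f).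
set y := loop c d f; set y' := loop a b (cup c d f) => E.
set u1 := phi _; set u2 := phi _; set u3 := phi _; set u4 := phi _.
have E' : be * be * (x * x') * u4 = be * be * (y * y') * u4 by rewrite E.
rewrite !mulrDr; ring: E'.
Qed.

Lemma ssum_crossing_comm c cs phi f : c.1 != c.2 -> loopless cs -> all (apart c) cs ->
  matching f -> crossing c (ssum cs phi) f = ssum cs (crossing c phi) f.
Proof.
move=> pc; elim: cs f => //= c' cs IH f /andP [pc' pcs] /andP [a as_] fm.
rewrite crossingC // ![crossing c' _ f]/crossing !IH //; first exact: cup_matching.
exact: swp_matching.
Qed.

Lemma ssum_comm cs cs' phi f : loopless cs -> loopless cs' ->
  all (fun c => all (apart c) cs') cs -> matching f ->
  ssum (cs ++ cs') phi f = ssum (cs' ++ cs) phi f.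
Proof.
elim: cs f => [|c cs IH] f; first by rewrite cats0.
move=> /= /andP [pc pcs] pcs' /andP [ac acs] fm.
transitivity (crossing c (ssum (cs' ++ cs) phi) f).
  by rewrite /= /crossing !IH //; [exact: cup_matching|exact: swp_matching].
by rewrite ssum_cat ssum_crossing_comm // ssum_cat.
Qed.

Lemma crossing_sym h v phi f : h != v -> matching f ->
  crossing (h, v) phi f = crossing (v, h) phi f.
Proof.
move=> hv fm; rewrite /crossing /= swpC cupC // /loop.
have -> : (f h == v) = (f v == h) => //.
by case: fm => fK _; apply/eqP/eqP => <-; rewrite fK.
Qed.

Lemma crossing_out h v phi f : h != v -> matching f ->
  crossing (h, v) phi f = crossing (f h, f v) phi f.
Proof.
move=> hv fm; rewrite /crossing /= swp_out // cup_out // /loop.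
by case: fm => fK _; rewrite (inj_eq (can_inj fK)).
Qed.

Lemma loop_cup_arc h v w f : matching f -> f v = w -> h != v -> h != w ->
  loop h v f = 1 /\ loop h w (cup h v f) = 1.
Proof.
move=> [fK fN] fv hv hw; rewrite /loop cup_l; split.
  by rewrite ifN //; apply: contraNneq hw => E; rewrite -fv -E fK.
by rewrite ifN // -fv eq_sym.
Qed.

End StateSum.

(** * Transposing, turning and simplifying a grid *)

Section Grid.
Variables (P : finType) (R : comNzRingType) (al be de : R).
Implicit Types (f g : {ffun P -> P}) (h v w p q u : P) (c : P * P).
Implicit Types (us ds pre suf : seq P) (cs : seq (P * P)).
Implicit Types (phi psi : {ffun P -> P} -> R).
Local Notation crossing := (crossing al be de).
Local Notation ssum := (ssum al be de).

Lemma loopless_cells us ds : uniq (us ++ ds) -> loopless (cells us ds).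
Proof.
rewrite cat_uniq => /and3P [_ /hasPn H _]; apply/allP => c /mem_cells [cu cd].
by apply: contraNneq (H _ cd) => <-.
Qed.

Lemma loopless_line u ds : u \notin ds -> loopless (line u ds).
Proof.
move=> H; apply/allP => c /mem_line [-> cd].
by apply: contraNneq H => ->.
Qed.

(** Crossings without a common line commute, and a smoothing is symmetric in its two lines; so rows
    and columns may be interchanged. *)
Lemma ssum_transpose us ds phi f : matching f -> uniq (us ++ ds) ->
  ssum (cells ds us) phi f = ssum (cells us ds) phi f.
Proof.
move=> fm; elim: us phi f fm => [|u us IH] phi f fm un.
  by elim: ds {un} => //= v ds IH; rewrite cells_cons.
have un' : uniq (us ++ ds) by case/andP: un.
have und : u \notin ds by move: un; rewrite /= mem_cat negb_or -andbA => /and3P [].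
have unu : u \notin us by move: un; rewrite /= mem_cat negb_or -andbA => /and3P [].
have unE : uniq (ds ++ us) by rewrite uniq_catC.
(* The crossings with [u] are moved to the front, each passing only crossings that share no line
   with it. *)
have col : ssum (cells ds (u :: us)) phi f =
    ssum ([seq (v, u) | v <- ds] ++ cells ds us) phi f.
  elim: {IH un un'} ds f fm und unE => [|v ds IHd] f fm //=.
  rewrite inE negb_or => /andP [uv und] /andP [vn unE].
  have vu : v != u by rewrite eq_sym.
  move: vn; rewrite mem_cat negb_or => /andP [vnd vnu].
  have usds x : x \in us -> x \notin ds.
    move: unE; rewrite cat_uniq => /and3P [_ /hasPn H _] /H //.
  have pr : loopless (line v us) by apply: loopless_line.
  transitivity (crossing (v, u) (ssum (line v us ++
      ([seq (v, u) | v <- ds] ++ cells ds us)) phi) f).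
    rewrite -/(cells ds (u :: us)) /= /crossing /=.
    have ext f' : matching f' -> ssum (line v us ++ cells ds (u :: us)) phi f' =
        ssum (line v us ++ ([seq (v, u) | v <- ds] ++ cells ds us)) phi f'.
      by move=> m'; rewrite !ssum_cat; apply: ssum_ext => // f'' m''; rewrite -ssum_cat IHd.
    by rewrite !ext //; [exact: cup_matching|exact: swp_matching].
  have pr2 : loopless [seq (v0, u) | v0 <- ds].
    apply/allP => c /mapP [x xd ->] /=; by apply: contraNneq und => <-.
  have ap : all (fun c => all (apart c) [seq (v0, u) | v0 <- ds]) (line v us).
    apply/allP => c /mem_line [c1 c2]; apply/allP => c' /mapP [x xd ->].
    rewrite /apart c1 /=; apply/and4P; split=> //.
    + by apply: contraNneq vnd => ->.
    + by apply: contraTneq c2 => ->; apply: contraL xd; apply: usds.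
    + by apply: contraNneq unu => <-.
  have ext f' : matching f' ->
    ssum (line v us ++ ([seq (v, u) | v <- ds] ++ cells ds us)) phi f' =
    ssum ([seq (v, u) | v <- ds] ++ (line v us ++ cells ds us)) phi f'.
    by move=> m'; rewrite !catA ssum_cat ssum_comm // -ssum_cat.
  rewrite /crossing /= !ext //; first exact: cup_matching.
  exact: swp_matching.
rewrite col ssum_cat cells_cons ssum_cat.
have pc : loopless [seq (v, u) | v <- ds].
  apply/allP => c /mapP [x xd ->] /=; by apply: contraNneq und => <-.
transitivity (ssum [seq (v, u) | v <- ds] (ssum (cells us ds) phi) f).
  by apply: ssum_ext => // f' m'; apply: IH.
move: (ssum (cells us ds) phi) => psi; clear -fm und pc; elim: ds und f fm pc => //= v ds IHd.
rewrite inE negb_or => /andP [uv und] f fm /andP [/= pv pc].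
rewrite crossing_sym // /crossing /= !IHd //; first exact: cup_matching.
exact: swp_matching.
Qed.

(** Each crossing is transferred to the other ends of its two strands; there it is apart from the
    remaining crossings and can be made the last one. Hence the reversal. *)
Lemma ssum_flip_aux cs phi f : matching f -> loopless cs ->
  (forall c c', c \in cs -> c' \in cs -> apart (f c.1, f c.2) c') ->
  ssum cs phi f = ssum (rev [seq (f c.1, f c.2) | c <- cs]) phi f.
Proof.
move=> fm; have [fK _] := fm; elim: cs phi => //= c cs IH phi /andP [pc pcs] ap.
rewrite rev_cons -cats1 ssum_cat -IH //; last first.
  by move=> c1 c2 m1 m2; apply: ap; rewrite inE ?m1 ?m2 orbT.
transitivity (crossing (f c.1, f c.2) (ssum cs phi) f).
  by rewrite -crossing_out // -surjective_pairing.
apply: ssum_crossing_comm => //; first by rewrite (inj_eq (can_inj fK)).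
by apply/allP => c' c's; apply: ap; rewrite inE ?eqxx // c's orbT.
Qed.

(** No two of the lines still to be crossed belong to one strand. In particular the next crossing
    cannot close a component. *)
Definition outward f (s : seq P) := {in s, forall x, f x \notin s}.

(** A half turn of the picture: the lines are drawn backwards, starting at the opposite corner. *)
Lemma ssum_flip us ds phi f : matching f -> uniq (us ++ ds) ->
  outward f (us ++ ds) -> ssum (cells us ds) phi f =
  ssum (cells (rev (map f us)) (rev (map f ds))) phi f.
Proof.
move=> fm un out; rewrite ssum_flip_aux ?loopless_cells //; last first.
  move=> c c' /mem_cells [c1 c2] /mem_cells [c1' c2'].
  have H x y : x \in us ++ ds -> y \in us ++ ds -> f x != y.
    by move=> /out xs ys; apply: contraNneq xs => ->.
  by rewrite /apart /= !H // mem_cat ?c1 ?c2 ?c1' ?c2' ?orbT.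
rewrite -rev_cells; congr (ssum (rev _) phi f).
by rewrite /cells map_allpairs allpairs_mapl allpairs_mapr.
Qed.

(** An arc with no end on a line still to be crossed is complete and never changes again, so if it
    disagrees with [g] no state can lead to [g]. *)
Lemma ssum_dead cs phi f g p : (forall f, phi f = (f == g)%:R) -> matching f ->
  loopless cs -> (forall c, c \in cs -> [&& p != c.1, p != c.2, f p != c.1 & f p != c.2]) ->
  f p != g p -> ssum cs phi f = 0.
Proof.
move=> E fm pc H Nfg.
rewrite -[RHS](mul0r (ssum cs (fun=> 0) f)).
apply: (@ssum_inv _ _ al be de (fun f' => matching f' /\ f' p = f p)) => //.
  move=> c f' cs_c [f'm Ef']; case/and4P: (H c cs_c) => H1 H2 H3 H4.
  have c12 : c.1 != c.2 by apply: (allP pc).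
  split; split; [exact: swp_matching| |exact: cup_matching|].
    by rewrite swp_off ?Ef'.
  by rewrite cup_off ?Ef'.
move=> f' [_ Ef']; rewrite E mul0r; case: eqP => // Eg.
by rewrite -Ef' Eg eqxx in Nfg.
Qed.

Hypothesis al_be : al * be = 1.
Hypothesis deE : de = - al ^+ 2 - be ^+ 2.

(* Pulling a strand over an arc (second Reidemeister move). *)
Lemma crossing_arc h v w phi f : matching f -> f v = w -> h != v -> h != w ->
  crossing (h, v) (crossing (h, w) phi) f = phi f.
Proof.
move=> fm fv hv hw; rewrite /crossing /=.
have [-> ->] := loop_cup_arc de fm fv hv hw.
rewrite swp_swp_arc // cup_swp_arc // swp_cup_arc // cup_cup_arc //.
have -> : loop de h w (swp h v f) = de.
  by rewrite /loop ffunE tpermL fv tpermD ?eqxx // -fv eq_sym; case: fm.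
rewrite deE; set x := phi _; set y := phi f.
(* Three of the four states end in [x], one of them with a closed component, and their weights
   cancel; in the fourth the line has been pulled off the arc. *)
have -> : al * (al * x + be * (- al ^+ 2 - be ^+ 2) * x) +
  be * 1 * (al * y + be * 1 * x) =
  (al ^+ 2 + be ^+ 2 - (al * be) * (al ^+ 2 + be ^+ 2)) * x + (al * be) * y.
  by ring.
by rewrite al_be; ring.
Qed.

(** The horizontal lines are pulled over the arc one after the other. Crossings with [pre] and [suf]
    leave [v] and [w] joined, so the arc is still there for the next line. *)
Lemma ssum_slide us pre v w suf phi f : matching f -> f v = w ->
  uniq (us ++ pre ++ v :: w :: suf) ->
  ssum (cells us (pre ++ v :: w :: suf)) phi f = ssum (cells us (pre ++ suf)) phi f.
Proof.
elim: us phi f => [//|u us IH] phi f fm fv un.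
have un' : uniq (us ++ pre ++ v :: w :: suf) by case/andP: un.
have : u \notin pre ++ v :: w :: suf.
  by move: un; rewrite /= mem_cat negb_or -andbA => /and3P [].
rewrite mem_cat !inE !negb_or => /and4P [upre uv uw usuf].
have : uniq (pre ++ v :: w :: suf) by move: un'; rewrite cat_uniq => /and3P [].
rewrite uniq_catC /= !(inE, mem_cat) !negb_or -!andbA.
case/and5P => vw vsuf vpre wsuf /andP [wpre _].
rewrite !cells_cons !line_cat -!catA !ssum_cat.
have keep : forall s psi psi', u \notin s -> v \notin s -> w \notin s ->
   (forall f, matching f -> f v = w -> psi f = psi' f) ->
   forall f, matching f -> f v = w -> ssum (line u s) psi f = ssum (line u s) psi' f.
  move=> s psi psi' us_ vs ws E f' f'm f'v; rewrite -[RHS]mul1r.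
  apply: (@ssum_inv _ _ al be de (fun f' => matching f' /\ f' v = w)) => //.
    move=> c f1 /mem_line [-> c2] [m1 E1].
    have c12 : u != c.2 by apply: contraNneq us_ => ->.
    have vc : v != c.2 by apply: contraNneq vs => ->.
    have wc : w != c.2 by apply: contraNneq ws => ->.
    split; split; [exact: swp_matching| |exact: cup_matching|].
      by rewrite swp_off ?E1 // eq_sym.
    by rewrite cup_off ?E1 // eq_sym.
  by move=> f1 [m1 E1]; rewrite mul1r; apply: E.
apply: (keep) => // f1 m1 E1.
rewrite -/(line u suf) [LHS]crossing_arc //.
by apply: keep => // f2 m2 E2; apply: IH.
Qed.

End Grid.

(** * Invariants of the lines still to be crossed *)

Section Outward.
Variable P : finType.
Implicit Types (f g : {ffun P -> P}) (v w p q u : P) (s : seq P).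

Lemma outward_sub f s s' : {subset s' <= s} -> outward f s -> outward f s'.
Proof. by move=> sub out x /sub /out; apply: contra => /sub. Qed.

Lemma outward_swp f u v s : matching f -> u \in s -> v \in s ->
  outward f s -> outward (swp u v f) s.
Proof.
move=> fm us vs out x xs.
have ne y z : y \in s -> z \in s -> f y != z by move=> /out ys zs; apply: contraNneq ys => ->.
have [->|xu] := eqVneq x u; first by rewrite swp_r ?ne // out.
have [->|xv] := eqVneq x v; first by rewrite swp_l ?ne // out.
by rewrite swp_off ?ne // out.
Qed.

Lemma outward_cup f u v s s' : matching f -> u \in s -> v \in s ->
  {subset s' <= s} -> u \notin s' -> v \notin s' ->
  outward f s -> outward (cup u v f) s'.
Proof.
move=> fm us vs sub us' vs' out x xs.
have ne y z : y \in s -> z \in s -> f y != z by move=> /out ys zs; apply: contraNneq ys => ->.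
have xu : x != u by apply: contraNneq us' => <-.
have xv : x != v by apply: contraNneq vs' => <-.
have {}xs := sub _ xs.
by rewrite cup_off ?ne //; apply: contra (out _ xs) => /sub.
Qed.

(** Here [u] is joined to the vertical line [w] just crossed. Marker +1 at [v] joins [w] to [v] and
    hands the strand of [v] to [u]: [u] takes part again, while [v] and [w] drop out. *)
Lemma outward_swp_arc f u v w s s' : matching f -> f u = w -> u \notin s ->
  w \notin s -> v \in s -> {subset s' <= s} -> v \notin s' ->
  outward f s -> outward (swp u v f) (u :: s').
Proof.
move=> fm fu us ws vs sub vs' out x; have [fK fN] := fm.
have ne y z : y \in s -> z \in s -> f y != z by move=> /out ys zs; apply: contraNneq ys => ->.
have neu y : y \in s -> f y != u.
  by move=> ys; apply: contraNneq ws => E; rewrite -fu -E fK.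
have fuv : f u != v by rewrite fu; apply: contraNneq ws => ->.
rewrite inE => /predU1P [->|xs].
  rewrite swp_r // inE negb_or neu //=.
  by apply: contra (out _ vs) => /sub.
have xv : x != v by apply: contraNneq vs' => <-.
have {}xs := sub _ xs.
have xu : x != u by apply: contraNneq us => <-.
rewrite swp_off ?neu ?ne // inE negb_or neu //=.
by apply: contra (out _ xs) => /sub.
Qed.

(** Marker -1 at [v] hands the strand of [v] to [w] instead and leaves [u] joined to [v]; now [w]
    takes part and [v] is the pending line. *)
Lemma outward_cup_arc f u v w s s' : matching f -> f u = w -> u \notin s ->
  w \notin s -> v \in s -> {subset s' <= s} -> v \notin s' ->
  outward f s -> outward (cup u v f) (w :: s').
Proof.
move=> fm fu us ws vs sub vs' out x; have [fK fN] := fm.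
have ne y z : y \in s -> z \in s -> f y != z by move=> /out ys zs; apply: contraNneq ys => ->.
have neu y : y \in s -> f y != u.
  by move=> ys; apply: contraNneq ws => E; rewrite -fu -E fK.
have new y : y \in s -> f y != w.
  move=> ys; apply: contraNneq us => E.
  by rewrite -[u]fK fu -E fK.
have wu : w != u by rewrite -fu fN.
have wv : w != v by apply: contraNneq ws => ->.
rewrite inE => /predU1P [->|xs].
  have -> : cup u v f w = f v by rewrite ffunE (negbTE wu) (negbTE wv) fu eqxx.
  rewrite inE negb_or new //=.
  by apply: contra (out _ vs) => /sub.
have xv : x != v by apply: contraNneq vs' => <-.
have {}xs := sub _ xs.
have xu : x != u by apply: contraNneq us => <-.
rewrite cup_off ?neu ?ne // inE negb_or new //=.
by apply: contra (out _ xs) => /sub.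
Qed.

(* A horizontal line [u] has crossed the vertical lines [pre] (and [w], if
   [pend = Some w]) and is about to cross [ds]; [pend = Some w] means that [u]
   is currently joined to the vertical line [w] that it has just crossed. *)
Definition flush (pend : option P) (pre : seq P) :=
  if pend is Some w then rcons pre w else pre.

Definition sweepable u us pend pre ds f :=
  [/\ matching f, uniq (u :: us ++ flush pend pre ++ ds) &
   if pend is Some w then f u = w /\ outward f (us ++ pre ++ ds)
   else outward f (u :: us ++ pre ++ ds)].

(** With [w] pending, marker +1 joins the neighbours [w] and [v] below [u]; this arc is pulled off
    the later lines, so neither is kept. *)
Definition after_swp (pend : option P) pre v :=
  if pend is Some w then pre else rcons pre v : seq P.

Lemma sweepable_swp u us pend pre v ds f :
  sweepable u us pend pre (v :: ds) f ->
  sweepable u us None (after_swp pend pre v) ds (swp u v f).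
Proof.
case: pend => [w|] [fm un H]; split; try exact: swp_matching.
- apply: subseq_uniq un; rewrite /= eqxx; apply: cat_subseq => //=.
  apply: cat_subseq; first exact: subseq_rcons.
  exact: subseq_cons.
- case: H => fu out.
  move: (un); rewrite cons_uniq => /andP [un1 un2].
  move: un1 un2; rewrite /= !(mem_cat, mem_rcons, inE) !negb_or.
  case/and4P=> uus /andP [uw upre] uv uds.
  rewrite catA uniq_catC /= !(mem_cat, mem_rcons, inE) !negb_or.
  case/andP => /and3P [vds vus /andP [vw vpre]].
  rewrite uniq_catC -rcons_cat cat_rcons uniq_catC /= !(mem_cat, mem_rcons, inE) !negb_or.
  case/andP=> /andP [wds /andP [wus wpre]] _.
  apply: outward_swp_arc fu _ _ _ _ _ out => //.
  + by rewrite !(mem_cat, inE) !negb_or uus upre uv.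
  + by rewrite !(mem_cat, inE) !negb_or wus wpre eq_sym vw.
  + by rewrite !(mem_cat, inE) eqxx !orbT.
  + by move=> x; rewrite !(mem_cat, inE) => /or3P [] ->; rewrite ?orbT.
  + by rewrite !(mem_cat, inE) !negb_or vus vpre.
- by move: un; rewrite /= cat_rcons.
- apply: (@outward_sub _ (u :: us ++ pre ++ v :: ds)).
    by move=> x; rewrite cat_rcons.
  by apply: outward_swp => //; rewrite !(mem_cat, inE) eqxx ?orbT.
Qed.

Lemma sweepable_cup u us pend pre v ds f :
  sweepable u us pend pre (v :: ds) f ->
  sweepable u us (Some v) (flush pend pre) ds (cup u v f).
Proof.
case=> fm un H; have uv : u != v.
  by have [+ _] := andP un; rewrite !(mem_cat, inE) !negb_or => /and4P [].
split; first exact: cup_matching.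
  by move: un; rewrite /= cat_rcons.
split; first exact: cup_l.
move: (un); rewrite cons_uniq => /andP [un1 un2].
move: un1 un2; rewrite /= !(mem_cat, mem_rcons, inE) !negb_or.
case/and4P=> uus upend _ uds.
rewrite catA uniq_catC /= !(mem_cat, mem_rcons, inE) !negb_or.
case/andP => /and3P [vds vus vpend] un2.
case: pend upend vpend un2 H {un} => [w|] upend vpend un2 H; last first.
  apply: (outward_cup _ _ _ _ _ _ H) => //.
  - exact: mem_head.
  - by rewrite !(mem_cat, inE) eqxx !orbT.
  - by move=> x; rewrite !(mem_cat, inE) => /or3P [] ->; rewrite ?orbT.
  - by rewrite !(mem_cat, inE) !negb_or uus upend.
  - by rewrite !(mem_cat, inE) !negb_or vus vpend.
case: H => fu out.
move: upend vpend; rewrite /= !(mem_rcons, inE) !negb_or => /andP [uw upre] /andP [vw vpre].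
have : uniq ((w :: ds) ++ us ++ pre).
  by move: un2; rewrite uniq_catC [flush _ _]/= -rcons_cat cat_rcons uniq_catC.
rewrite cat_cons cons_uniq !(mem_cat, inE) !negb_or.
case/andP=> /andP [wds /andP [wus wpre]] _.
apply: (@outward_sub _ (w :: us ++ pre ++ ds)).
  move=> x; rewrite !(mem_cat, mem_rcons, inE).
  by case/or3P => [->|/orP [->|->]|->]; rewrite ?orbT.
apply: outward_cup_arc fu _ _ _ _ _ out => //.
+ by rewrite !(mem_cat, inE) !negb_or uus upre uv.
+ by rewrite !(mem_cat, inE) !negb_or wus wpre eq_sym vw.
+ by rewrite !(mem_cat, inE) eqxx !orbT.
+ by move=> x; rewrite !(mem_cat, inE) => /or3P [] ->; rewrite ?orbT.
+ by rewrite !(mem_cat, inE) !negb_or vus vpre.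
Qed.

End Outward.

(** * Drawing one horizontal line *)

Section Sweep.
Variables (P : finType) (R : comNzRingType) (al be de : R).
Implicit Types (f g : {ffun P -> P}) (h v w p q u : P) (c : P * P).
Implicit Types (us ds pre suf : seq P).
Implicit Types (phi : {ffun P -> P} -> R) (psi : seq P -> {ffun P -> P} -> R).
Local Notation crossing := (crossing al be de).
Local Notation ssum := (ssum al be de).

(* The expansion of a horizontal line [u]; an arc joining two vertical lines
   that are neighbours below [u] is pulled down through all the other lines,
   so that these two lines disappear. *)
Fixpoint sweep u psi pend pre ds f {struct ds} : R :=
  if ds is v :: ds' then
    al * sweep u psi None (after_swp pend pre v) ds' (swp u v f) +
    be * sweep u psi (Some v) (flush pend pre) ds' (cup u v f)
  else psi (flush pend pre) f.

Hypothesis al_be : al * be = 1.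
Hypothesis deE : de = - al ^+ 2 - be ^+ 2.

(** No loop factor appears because [u] is never joined to the line it is about to cross. The only
    geometric step is marker +1 with a line pending, where [ssum_slide] removes two vertical
    lines. *)
Lemma ssum_sweep u us pend pre ds phi f : sweepable u us pend pre ds f ->
  ssum (line u ds) (ssum (cells us (flush pend pre ++ ds)) phi) f =
  sweep u (fun ds f => ssum (cells us ds) phi f) pend pre ds f.
Proof.
elim: ds pend pre f => [|v ds IH] pend pre f sw; first by rewrite cats0.
have sw1 := sweepable_swp sw; have sw2 := sweepable_cup sw.
have [fm un H] := sw.
rewrite /= -/(line u ds) /crossing /= -IH // -IH //.
have fuv : f u != v.
  move: (un); rewrite cons_uniq !(mem_cat, inE) !negb_or => /andP [/and4P [_ _ _ _] un'].
  case: pend H un {sw sw1 sw2 un'} => [w|] H un.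
    case: H => -> _; move: un; rewrite cons_uniq catA cat_uniq.
    case/and4P => _ _ /hasPn /(_ v (mem_head _ _)) + _.
    rewrite /= mem_cat mem_rcons; apply: contraNneq => ->.
    by rewrite mem_head orbT.
  have := H u (mem_head _ _); apply: contraNneq => ->.
  by rewrite !(mem_cat, inE) eqxx !orbT.
have -> : loop de u v f = 1 by rewrite /loop (negbTE fuv).
rewrite mulr1 /=; congr (al * _ + be * _); last by rewrite cat_rcons.
case: pend H un sw1 {sw sw2} => [w|] H un sw1 /=; last by rewrite cat_rcons.
have [f1m un1 out1] := sw1.
have [fu out] := H.
have uds : [/\ v \notin ds, w \notin ds, u != v & u \notin ds].
  move: (un); rewrite cons_uniq !(mem_cat, inE) !negb_or => /andP [/and4P [_ _ uv ud] un'].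
  move: un'; rewrite catA cat_uniq => /and3P [_ /hasPn dis].
  rewrite cons_uniq => /andP [vds _]; split=> //.
  apply/negP => wds; have := dis w; rewrite !inE wds orbT => /(_ isT).
  by rewrite !mem_cat mem_rcons mem_head orbT.
case: uds => vds wds uv uds.
have wv : swp u v f w = v.
  have [fK _] := f1m; rewrite -[RHS]fK; congr (swp u v f _).
  by rewrite swp_l // fu.
have uw : u != w by rewrite -fu eq_sym; case: fm.
(* While [u] crosses the rest of [ds], the lines [w] and [v] stay joined; this carries the arc down
   to the lines [us], where it can be slid off. *)
rewrite -[RHS]mul1r.
apply: (@ssum_inv _ _ al be de (fun f' => matching f' /\ f' w = v)) => //.
  move=> c f' /mem_line [-> c2] [m1 E1].
  have c12 : u != c.2 by apply: contraNneq uds => ->.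
  have vc : v != c.2 by apply: contraNneq vds => ->.
  have wc : w != c.2 by apply: contraNneq wds => ->.
  split; split; [exact: swp_matching| |exact: cup_matching|].
    by rewrite swp_off ?E1 // eq_sym.
  by rewrite cup_off ?E1 // eq_sym.
move=> f' [m1 E1]; rewrite mul1r cat_rcons ssum_slide //.
move: un; rewrite cons_uniq => /andP [_].
by rewrite /= cat_rcons.
Qed.

Lemma ssum_cells_sweep u us ds phi f : matching f -> uniq (u :: us ++ ds) ->
  outward f (u :: us ++ ds) ->
  ssum (cells (u :: us) ds) phi f =
  sweep u (fun ds f => ssum (cells us ds) phi f) None [::] ds f.
Proof.
move=> fm un out; rewrite cells_cons ssum_cat.
exact: (@ssum_sweep u us None [::] ds).
Qed.

End Sweep.

(** * Plucking words *)

Section Returns.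
Variable T : eqType.
Implicit Types (w x y u e t s : seq T) (k : nat) (a : T).

Definition ret w k := if drop k w is a :: b :: _ then a == b else false.

Definition del2 k w := take k w ++ drop k.+2 w.

Lemma ret_nth z w k :
  ret w k = (k.+1 < size w)%N && (nth z w k == nth z w k.+1).
Proof.
have -> : nth z w k = nth z (drop k w) 0 by rewrite nth_drop addn0.
have -> : nth z w k.+1 = nth z (drop k w) 1 by rewrite nth_drop addn1.
rewrite /ret; case E: (drop k w) (size_drop k w) => [|a [|b r]] /= S.
- by rewrite (_ : (k.+1 < _)%N = false) //; lia.
- by rewrite (_ : (k.+1 < _)%N = false) //; lia.
- by rewrite (_ : (k.+1 < _)%N = true) //; lia.
Qed.

Lemma ret_size w k : ret w k -> (k.+1 < size w)%N.
Proof.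
rewrite /ret; case E: (drop k w) => [|a [|b r]] // _.
by have := congr1 size E; rewrite size_drop /=; lia.
Qed.

Lemma size_del2 w k : (k.+1 < size w)%N -> size (del2 k w) = (size w - 2)%N.
Proof. by move=> lt_k; rewrite size_cat size_take size_drop; case: ifP; lia. Qed.

Lemma mem_del2 w k : {subset del2 k w <= w}.
Proof. by move=> a; rewrite mem_cat => /orP [/mem_take|/mem_drop]. Qed.

Lemma del2_catl x y k : (k.+1 < size x)%N -> del2 k (x ++ y) = del2 k x ++ y.
Proof.
move=> lt_k; rewrite /del2 take_cat drop_cat (_ : (k < size x)%N); last by lia.
case: ltnP => [lt2|ge2]; first by rewrite catA.
have E : (k.+2 - size x = 0)%N by lia.
by rewrite E drop0 (drop_oversize ge2) cats0.
Qed.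

Lemma del2_catr x y k : del2 (size x + k) (x ++ y) = x ++ del2 k y.
Proof.
rewrite /del2 take_cat drop_cat ltnNge leq_addr /= addKn -catA; congr (_ ++ _).
by rewrite ltnNge (_ : (size x <= _)%N) /=; [congr (_ ++ drop _ _)|]; lia.
Qed.

Lemma ret_catl x y k : (k.+1 < size x)%N -> ret (x ++ y) k = ret x k.
Proof.
move=> lt_k; case: x lt_k => // a x lt_k.
rewrite !(ret_nth a) size_cat !nth_cat lt_k (_ : (k < _)%N); last by lia.
by rewrite (_ : (k.+1 < _ + _)%N) //; lia.
Qed.

Lemma ret_catr x y k : ret (x ++ y) (size x + k) = ret y k.
Proof. by rewrite /ret drop_cat ltnNge leq_addr addKn. Qed.

Definition apart_words x y := {in x, forall a, a \notin y}.

Lemma ret_junction x y k : apart_words x y -> k.+1 = size x ->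
  ret (x ++ y) k = false.
Proof.
case/lastP: x => // x a ap; rewrite size_rcons => -[->].
rewrite cat_rcons -[size x]addn0 ret_catr /ret drop0.
case: y ap => // b y ap; apply/eqP => E.
by have := ap a; rewrite mem_rcons !inE E eqxx => /(_ isT).
Qed.

Lemma sum_ret_cat_gen (R : nmodType) x y (F : nat -> R) :
  (forall k, k.+1 = size x -> ret (x ++ y) k = false) ->
  \sum_(0 <= k < size (x ++ y) | ret (x ++ y) k) F k =
  \sum_(0 <= k < size x | ret x k) F k +
  \sum_(0 <= k < size y | ret y k) F (size x + k)%N.
Proof.
move=> jn; rewrite size_cat (@big_cat_nat _ _ _ (size x)) ?leq_addr //=.
congr (_ + _).
  rewrite big_nat_cond [RHS]big_nat_cond; apply: eq_bigl => k.
  rewrite leq0n /=; case: ltnP => //= lt_k.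
  have [lt2|ge2] := ltnP k.+1 (size x); first by rewrite ret_catl.
  have E : k.+1 = size x by lia.
  rewrite jn //; apply/esym/negbTE/negP => /ret_size; lia.
rewrite -{1}[size x]add0n big_addn addKn.
by apply: eq_big => k; rewrite addnC ?ret_catr.
Qed.

Lemma sum_ret_cat (R : nmodType) x y (F : nat -> R) : apart_words x y ->
  \sum_(0 <= k < size (x ++ y) | ret (x ++ y) k) F k =
  \sum_(0 <= k < size x | ret x k) F k +
  \sum_(0 <= k < size y | ret y k) F (size x + k)%N.
Proof. by move=> ap; apply: sum_ret_cat_gen => k; apply: ret_junction. Qed.

(* The weighted count of the ways to empty a word of [2 r] letters by
   successively deleting two equal neighbours. *)
Section Pluck.
Variables (R : comNzRingType) (al be : R).
Hypothesis al_be : al * be = 1.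

Fixpoint pluck r e : R :=
  if r is r'.+1 then
    \sum_(0 <= k < size e | ret e k)
      al ^+ k * be ^+ (size e - 2 - k) * pluck r' (del2 k e)
  else 1.

(** The Gaussian binomial coefficient of r1 + r2 over r1 in symmetric form, with q = al^2 and 1/q =
    be^2. It counts with weights the ways to interleave r1 and r2 pluckings in adjacent words. *)
Fixpoint gauss r1 := fix gauss' r2 : R :=
  if r1 is r1'.+1 then
    if r2 is r2'.+1 then be ^+ r2.*2 * gauss r1' r2 + al ^+ r1.*2 * gauss' r2'
    else 1
  else 1.

Lemma gauss0r r : gauss 0 r = 1. Proof. by case: r. Qed.
Lemma gaussr0 r : gauss r 0 = 1. Proof. by case: r. Qed.

Lemma gaussSS r1 r2 : gauss r1.+1 r2.+1 =
  be ^+ r2.+1.*2 * gauss r1 r2.+1 + al ^+ r1.+1.*2 * gauss r1.+1 r2.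
Proof. by []. Qed.

Lemma expr_al_be k : al ^+ k * be ^+ k = 1.
Proof. by rewrite -exprMn al_be expr1n. Qed.

(** As [be] is the inverse of [al], only the difference of the exponents matters. *)
Lemma expr_shift i j i' j' : (i + j' = i' + j)%N ->
  al ^+ i * be ^+ j = al ^+ i' * be ^+ j'.
Proof.
wlog le_i : i j i' j' / (i <= i')%N => [H E|E].
  case: (leqP i i') => [|/ltnW] le_i; first exact: H.
  by apply/esym/H => //; lia.
have -> : i' = (i + (i' - i))%N by lia.
have -> : j' = (j + (i' - i))%N by lia.
by rewrite !exprD mulrACA expr_al_be mulr1.
Qed.

(** The second Pascal rule, from which the symmetry of [gauss] follows. Expanding the smaller
    coefficients once more by both rules reduces it to [al * be = 1]. *)
Lemma gaussSS' r1 r2 : gauss r1.+1 r2.+1 =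
  al ^+ r2.+1.*2 * gauss r1 r2.+1 + be ^+ r1.+1.*2 * gauss r1.+1 r2.
Proof.
have [N] := ubnP (r1 + r2); elim: N r1 r2 => // N IH r1 r2 lt_N.
have E (a : R) i : a ^+ i.+1.*2 = a ^+ 2 * a ^+ i.*2 by rewrite doubleS !exprS expr0 mulr1 mulrA.
have xx := expr_al_be r1.*2; have yy := expr_al_be r2.*2.
have zz := expr_al_be 2.
rewrite gaussSS; case: r1 r2 lt_N xx yy => [|r1] [|r2] lt_N xx yy.
- by rewrite !gauss0r !gaussr0 addrC.
- rewrite !gauss0r !mulr1 [in LHS]IH; last by lia.
  move: yy; rewrite gaussSS !gauss0r !mulr1 !E => yy.
  by rewrite !double0 !expr0 !mulr1; ring: yy zz.
- rewrite !gaussr0 !mulr1 [in LHS]IH; last by lia.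
  move: xx; rewrite gaussSS !gaussr0 !mulr1 !E => xx.
  by rewrite !double0 !expr0 !mulr1; ring: xx zz.
- rewrite [X in _ * X + _ = _]IH; last by lia.
  rewrite [X in _ + _ * X = _]IH; last by lia.
  rewrite [X in _ = _ * X + _]gaussSS [X in _ = _ + _ * X]gaussSS.
  have xx' := expr_al_be r1.*2; have yy' := expr_al_be r2.*2.
  rewrite !E; set a := gauss r1 r2.+2; set b := gauss r1.+1 r2.+1.
  set c := gauss r1.+2 r2; ring: xx' yy' zz.
Qed.

End Pluck.
End Returns.

Section Words.
Variable T : eqType.
Implicit Types (w x y u e t s : seq T) (k : nat) (a : T).
Variables (R : comNzRingType) (al be : R).
Hypothesis al_be : al * be = 1.
Local Notation pluck := (pluck al be).
Local Notation gauss := (gauss al be).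

Lemma gaussC r1 r2 : gauss r1 r2 = gauss r2 r1.
Proof.
elim: r1 r2 => [|r1 IH1]; first by move=> r2; rewrite gauss0r gaussr0.
elim=> [|r2 IH2]; first by rewrite gauss0r gaussr0.
by rewrite gaussSS (gaussSS' al_be) IH1 IH2 addrC.
Qed.

Lemma pluckS r e : pluck r.+1 e = \sum_(0 <= k < size e | ret e k)
  al ^+ k * be ^+ (size e - 2 - k) * pluck r (del2 k e).
Proof. by []. Qed.

Lemma apart_words_sub x y x' y' : {subset x' <= x} -> {subset y' <= y} ->
  apart_words x y -> apart_words x' y'.
Proof. by move=> sx sy ap a /sx /ap; apply: contra => /sy. Qed.

Lemma apart_wordsC x y : apart_words x y -> apart_words y x.
Proof. by move=> ap a ay; apply: contraL ay; apply: ap. Qed.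

Lemma apart_words_cat x y z :
  apart_words x (y ++ z) <-> apart_words x y /\ apart_words x z.
Proof.
split=> [ap|[ay az] a ax]; last by rewrite mem_cat negb_or ay ?az.
by split=> a /ap; rewrite mem_cat negb_or => /andP [].
Qed.

Lemma apart_del2l x y k : apart_words x y -> apart_words (del2 k x) y.
Proof. by apply: apart_words_sub => //; apply: mem_del2. Qed.

Lemma apart_del2r x y k : apart_words x y -> apart_words x (del2 k y).
Proof. by apply: apart_words_sub => //; apply: mem_del2. Qed.

(** A pair plucked from [e1] has all of [e2] on its right, which gives be^(size e2), and a pair from
    [e2] has all of [e1] on its left, which gives al^(size e1). These are the coefficients of the
    Pascal rule. *)
Lemma pluck_cat r1 r2 e1 e2 : apart_words e1 e2 ->
  size e1 = r1.*2 -> size e2 = r2.*2 ->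
  pluck (r1 + r2) (e1 ++ e2) = gauss r1 r2 * pluck r1 e1 * pluck r2 e2.
Proof.
have [N] := ubnP (r1 + r2); elim: N r1 r2 e1 e2 => // N IH.
move=> [|r1] [|r2] e1 e2 lt_N ap.
- by rewrite gauss0r /= !mul1r.
- by move=> /size0nil -> s2; rewrite gauss0r mulr1 mul1r.
- by move=> s1 /size0nil ->; rewrite gaussr0 cats0 addn0 mulr1 mul1r.
move=> s1 s2; rewrite addSn pluckS sum_ret_cat // gaussSS !mulrDl.
congr (_ + _).
  rewrite -[_ * _ * pluck r2.+1 e2]mulrA [pluck r1.+1 e1 * _]mulrC (pluckS r1 e1).
  rewrite mulrA big_distrr; apply: eq_bigr => k /ret_size lt_k.
  rewrite del2_catl // IH //; last first.
  - by rewrite size_del2 // s1 doubleS; lia.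
  - exact: apart_del2l.
  have -> : (size (e1 ++ e2) - 2 - k = (size e1 - 2 - k) + r2.+1.*2)%N.
    by rewrite size_cat; lia.
  rewrite exprD; move: (be ^+ _) (be ^+ _) (al ^+ _) (gauss _ _) (pluck _ _).
  by move: (pluck _ _) => a1 a2 a3 a4 a5 a6; rewrite /=; ring.
rewrite (pluckS r2 e2) big_distrr; apply: eq_bigr => k /ret_size lt_k.
rewrite del2_catr -[(r1 + r2.+1)%N]addSnnS IH //; last first.
- by rewrite size_del2 // s2 doubleS; lia.
- exact: apart_del2r.
- by lia.
have -> : (size (e1 ++ e2) - 2 - (size e1 + k) = size e2 - 2 - k)%N.
  by rewrite size_cat; lia.
rewrite s1 exprD; move: (be ^+ _) (al ^+ _) (al ^+ _) (gauss _ _) (pluck _ _).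
by move: (pluck _ _) => a1 a2 a3 a4 a5 a6; rewrite /=; ring.
Qed.

Lemma sum_ret1 a (F : nat -> R) :
  \sum_(0 <= k < size [:: a] | ret [:: a] k) F k = 0.
Proof. by rewrite /= big_mkcond big_nat1. Qed.

(** The outer pair can only be plucked last, with weight 1. Until then it puts one more letter on
    each side of every plucked pair, a factor [al * be = 1]. *)
Lemma pluck_wrap r a e : a \notin e -> size e = r.*2 ->
  pluck r.+1 (a :: rcons e a) = pluck r e.
Proof.
have be1 : be * al = 1 by rewrite mulrC.
elim: r e => [|r IH] e ae.
  move=> /size0nil -> /=; rewrite big_mkcond /= big_nat_recl // big_nat1.
  by rewrite /ret /= eqxx !expr0 !mulr1 addr0.
move=> se; have ap1 : apart_words [:: a] e by move=> b; rewrite inE => /eqP ->.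
have ap2 : apart_words e [:: a] by apply: apart_wordsC.
have sE : size (a :: rcons e a) = (size e).+2 by rewrite /= size_rcons.
have -> : a :: rcons e a = [:: a] ++ (e ++ [:: a]) by rewrite cats1.
have sumE (F : nat -> R) : \sum_(0 <= k < size ([:: a] ++ (e ++ [:: a]))
    | ret ([:: a] ++ (e ++ [:: a])) k) F k =
    \sum_(0 <= k < size e | ret e k) F k.+1.
  rewrite sum_ret_cat_gen; last first.
    move=> [] // _; case: e ae se {ap1 ap2 sE} => // x e ae _; move: ae.
    by rewrite inE negb_or /ret /= => /andP [/negbTE -> _].
  by rewrite sum_ret1 add0r (sum_ret_cat (fun k => F (1 + k)%N) ap2) sum_ret1 addr0.
rewrite !pluckS sumE.
apply: eq_bigr => k /ret_size lt_k.
have -> : del2 k.+1 ([:: a] ++ (e ++ [:: a])) = a :: rcons (del2 k e) a.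
  by rewrite -[k.+1]/(size [:: a] + k)%N del2_catr del2_catl // cats1.
rewrite IH; last first.
- by rewrite size_del2 // se doubleS; lia.
- by apply: contra ae; apply: mem_del2.
congr (_ * _).
by apply: expr_shift => //; rewrite !size_cat /=; lia.
Qed.

(** The words read along a non-crossing matching whose arcs are distinct letters; the index is the
    number of arcs. *)
Inductive dyck : nat -> seq T -> Prop :=
| Dyck0 : dyck 0 [::]
| DyckS r1 r2 a e1 e2 : a \notin e1 -> apart_words (a :: e1) e2 ->
    dyck r1 e1 -> dyck r2 e2 -> dyck (r1 + r2).+1 (a :: rcons e1 a ++ e2).

Lemma dyck_size r e : dyck r e -> size e = r.*2.
Proof.
elim=> // r1 r2 a e1 e2 _ _ _ s1 _ s2.
by rewrite /= size_cat size_rcons s1 s2; lia.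
Qed.

(** Reversal keeps an enclosing pair and exchanges the two factors of a concatenation, and [gauss]
    is symmetric. *)
Lemma pluck_rev r e : dyck r e -> pluck r (rev e) = pluck r e.
Proof.
elim=> // r1 r2 a e1 e2 ae ap d1 IH1 d2 IH2.
have s1 := dyck_size d1; have s2 := dyck_size d2.
have ap' : apart_words (a :: rcons e1 a) e2.
  by apply: apart_words_sub ap => // b; rewrite !(inE, mem_rcons) => /orP [->|].
have ap2 : apart_words (rev e2) (rev (a :: rcons e1 a)).
  apply: apart_wordsC; apply: apart_words_sub ap' => b; by rewrite mem_rev.
have sw x : size x = r1.*2 -> size (a :: rcons x a) = r1.+1.*2.
  by move=> sx; rewrite /= size_rcons sx doubleS.
rewrite -[a :: _]/((a :: rcons e1 a) ++ e2) rev_cat -addSn [in LHS]addnC.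
rewrite pluck_cat ?size_rev ?sw // pluck_cat ?sw //.
rewrite gaussC IH2 rev_cons rev_rcons -rcons_cons rcons_cons.
by rewrite !pluck_wrap ?mem_rev ?size_rev // IH1 mulrAC.
Qed.

End Words.

Lemma pluck_gt0 (T : eqType) r (e : seq T) : dyck r e ->
  0 < pluck (1 : int) 1 r e.
Proof.
have g r1 r2 : 0 < gauss (1 : int) 1 r1 r2.
  elim: r1 r2 => [|r1 IH1] r2; first by rewrite gauss0r.
  elim: r2 => [|r2 IH2]; first by rewrite gaussr0.
  by rewrite gaussSS !expr1n !mul1r addr_gt0.
elim=> // r1 r2 a e1 e2 ae ap d1 IH1 d2 IH2.
rewrite -[a :: _]/((a :: rcons e1 a) ++ e2) -addSn pluck_cat.
- by rewrite pluck_wrap ?mulr_gt0 ?(dyck_size d1).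
- apply: apart_words_sub ap => // b.
  by rewrite !(inE, mem_rcons) => /orP [->|].
- by rewrite /= size_rcons (dyck_size d1).
- exact: dyck_size d2.
Qed.

(** Only the pattern of equal letters matters. The two words are carried as one list of pairs, so
    that a deletion acts on both. *)
Lemma eq_pluck (T1 T2 : eqType) (R : comNzRingType) (al be : R) r
    (z : seq (T1 * T2)) :
  {in z &, forall x y, (x.1 == y.1) = (x.2 == y.2)} ->
  pluck al be r (unzip1 z) = pluck al be r (unzip2 z).
Proof.
elim: r z => // r IH z E; rewrite !pluckS /unzip1 /unzip2 !size_map.
have retE k : ret [seq x.1 | x <- z] k = ret [seq x.2 | x <- z] k.
  rewrite /ret -!map_drop; case Ez : (drop k z) => [|x [|y z']] //=.
  by apply: E; apply: (@mem_drop k); rewrite Ez !inE eqxx ?orbT.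
rewrite (eq_bigl _ _ retE); apply: eq_bigr => k _.
rewrite /del2 -!map_take -!map_drop -!map_cat -/(unzip1 _) -/(unzip2 _).
rewrite -/(del2 k z) IH // => x y /mem_del2 zx /mem_del2 zy.
exact: E.
Qed.

(** * Plucking with a moving window *)

Section Window.
Variable T : eqType.
Implicit Types (A w x y u e t s : seq T) (k : nat) (a : T).
Variables (R : comNzRingType) (al be : R).
Hypothesis al_be : al * be = 1.

(** The weight of a line that plucks the pair at [k]: it meets [size A] lines, the first [k - n] of
    them with marker +1 and the others with marker -1. *)
Definition window A n k : R :=
  if (n <= k <= n + size A)%N then al ^+ (k - n) * be ^+ (n + size A - k)
  else 0.

Lemma windowE A n k : (n <= k <= n + size A)%N ->
  window A n k = al ^+ (k - n) * be ^+ (n + size A - k).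
Proof. by rewrite /window => ->. Qed.

(* The letters of [w] are plucked as in [pluck], but when [n + 1] vertical
   lines are left only the pairs of neighbours in the positions [n], ...,
   [n + size A + 1] may be deleted. *)
Fixpoint plucks A n w : R :=
  if n is n'.+1 then
    \sum_(0 <= k < size w | ret w k) window A n' k * plucks A n' (del2 k w)
  else (w == A)%:R.

Lemma plucksS A n w : plucks A n.+1 w =
  \sum_(0 <= k < size w | ret w k) window A n k * plucks A n (del2 k w).
Proof. by []. Qed.

Lemma ret_uniq s k : uniq s -> ret s k = false.
Proof.
case: s => // z s0; set s := z :: s0 => un; apply/negbTE/negP => r.
move: (r); rewrite (ret_nth z) => /andP [lt_k].
by rewrite nth_uniq //; [lia|apply: ltnW].
Qed.

Lemma sum_ret_uniq s (F : nat -> R) : uniq s ->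
  \sum_(0 <= k < size s | ret s k) F k = 0.
Proof. by move=> un; rewrite big1 // => k; rewrite ret_uniq. Qed.

Lemma sum_ret_par s a (F : nat -> R) : uniq (rcons s a) ->
  \sum_(0 <= k < size (rcons s a ++ rev (rcons s a)) |
      ret (rcons s a ++ rev (rcons s a)) k) F k = F (size s).
Proof.
rewrite rcons_uniq => /andP [a_s un].
rewrite rev_rcons cat_rcons sum_ret_cat_gen; last first.
  case/lastP: s a_s {un} => // s b a_s k; rewrite size_rcons => -[->].
  rewrite cat_rcons -[size s]addn0 ret_catr /ret drop0.
  by apply/negbTE; apply: contraNneq a_s => ->; rewrite mem_rcons mem_head.
rewrite sum_ret_uniq // add0r.
rewrite -[a :: a :: rev s]/([:: a; a] ++ rev s) sum_ret_cat; last first.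
  by move=> b; rewrite !inE mem_rev orbb => /eqP ->.
rewrite [X in _ + X]sum_ret_uniq ?rev_uniq // addr0 /=.
rewrite big_mkcond /= big_nat_recl // big_nat1 /ret /= eqxx addn0.
by rewrite addr0.
Qed.

Lemma plucks_factor A n r u e t s :
  apart_words e (u ++ t ++ A) -> apart_words s (u ++ t ++ A) ->
  size e = r.*2 -> size s = r -> uniq s ->
  (forall k, ret e k -> (n <= size u + k.+1 <= n + size A)%N) ->
  (n <= size u + r <= n + size A)%N ->
  plucks A n (u ++ e ++ t) =
  pluck al be r e * plucks A n (u ++ (s ++ rev s) ++ t).
Proof.
elim: n r u e t s => [|n IH] [|r] u e t s ap aps se ss un wn wnr.
- by rewrite (size0nil se) (size0nil ss) mul1r.
- have no (v : seq T) : (0 < size v)%N -> apart_words v (u ++ t ++ A) ->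
      plucks A 0 (u ++ v ++ t) = 0.
    case: v => // b v _ apv /=; case: eqP => // E.
    have := apv b (mem_head _ _); rewrite !mem_cat !negb_or -E.
    by rewrite !mem_cat mem_head orbT !andbF.
  rewrite !no ?mulr0 ?se ?size_cat ?ss //.
  by apply: apart_words_sub aps => // b; rewrite mem_cat mem_rev orbb.
- by rewrite (size0nil se) (size0nil ss) mul1r.
case/lastP: s aps ss un => // s a aps; rewrite size_rcons => -[ss] un.
set p := rcons s a ++ rev (rcons s a).
have app : apart_words p (u ++ t ++ A).
  by apply: apart_words_sub aps => // b; rewrite mem_cat mem_rev orbb.
have sp : size p = r.+1.*2 by rewrite size_cat size_rev size_rcons ss addnn.
have split3 v (F : nat -> R) : apart_words v (u ++ t ++ A) -> (0 < size v)%N ->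
    \sum_(0 <= k < size (u ++ v ++ t) | ret (u ++ v ++ t) k) F k =
    \sum_(0 <= k < size u | ret u k) F k +
    (\sum_(0 <= k < size v | ret v k) F (size u + k)%N +
     \sum_(0 <= k < size t | ret t k) F (size u + (size v + k))%N).
  move=> apv v_gt0; have [avu /apart_words_cat [avt _]] := (apart_words_cat _ _ _).1 apv.
  rewrite sum_ret_cat_gen; last first.
    case: v v_gt0 avu {apv avt} => // b v _ avu k.
    case/lastP: u avu {ap aps wn wnr app} => // u c avu; rewrite size_rcons => -[->].
    rewrite cat_rcons -[size u]addn0 ret_catr /ret drop0 /=.
    apply/negbTE; apply: contraNneq (avu b (mem_head _ _)) => <-.
    by rewrite mem_rcons mem_head.
  by congr (_ + _); rewrite (sum_ret_cat (fun k => F (size u + k)%N)).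
have e_gt0 : (0 < size e)%N by rewrite se.
have p_gt0 : (0 < size p)%N by rewrite sp.
rewrite plucksS split3 // [X in _ = _ * X]plucksS split3 //.
rewrite !mulrDr; congr (_ + (_ + _)).
- rewrite big_distrr; apply: eq_bigr => k /ret_size lt_k.
  rewrite !del2_catl //.
  (* Outside the window both terms vanish. Inside it, [n <= k] gives [n + 2 <= size u], so [e] stays
     in the window although it moves by two letters and the window by one. *)
  have [wk|wk] := boolP (n <= k <= n + size A)%N; last first.
    by rewrite /window (negbTE wk) !mul0r /= mulr0.
  rewrite (IH r.+1 _ e t (rcons s a)) //.
  + by rewrite /=; ring.
  + apply: apart_words_sub ap => // b; rewrite !mem_cat => /orP [|->]; rewrite ?orbT //.
    by case/orP => [/mem_take|/mem_drop] ->.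
  + apply: apart_words_sub aps => // b; rewrite !mem_cat => /orP [|->]; rewrite ?orbT //.
    by case/orP => [/mem_take|/mem_drop] ->.
  + by rewrite size_rcons ss.
  + by move=> k' /[dup] /ret_size lt_k' /wn; rewrite size_del2 //; lia.
  + by rewrite size_del2 //; lia.
- have parE (F : nat -> R) : \sum_(0 <= k < size p | ret p k) F k = F (size s).
    exact: sum_ret_par.
  rewrite parE.
  rewrite pluckS big_distrl; apply: eq_bigr => k /[dup] rk /ret_size lt_k.
  rewrite !del2_catr (del2_catl _ lt_k).
  have -> : del2 (size s) (p ++ t) = (s ++ rev s) ++ t.
    rewrite /p rev_rcons cat_rcons -catA -{1}[size s]addn0 del2_catr /del2 /=.
    by rewrite ?take0 ?drop0 ?catA.
  have wnk := wn _ rk.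
  rewrite (IH r u (del2 k e) t s) //.
  + rewrite ss !windowE; try by lia.
    set x := plucks _ _ _; set y := pluck _ _ _ _.
    (* The position is measured from the middle [r] of the parallel word; as [size e - 2 = 2 r], the
       shift is exactly the weight of the pair in [pluck]. *)
    have -> : al ^+ (size u + k - n) * be ^+ (n + size A - (size u + k)) =
      (al ^+ k * be ^+ (size e - 2 - k)) *
      (al ^+ (size u + r - n) * be ^+ (n + size A - (size u + r))).
      rewrite mulrACA -!exprD; apply: expr_shift => //.
      by rewrite se doubleS; lia.
    by rewrite /=; ring.
  + exact: apart_del2l.
  + by apply: apart_words_sub aps => // b; rewrite mem_rcons inE orbC => ->.
  + by rewrite size_del2 // se doubleS; lia.
  + by move: un; rewrite rcons_uniq => /andP [].
  (* A return of the shortened word is an old return to the left or right of the gap, or it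
     straddles the gap and is placed by the pair just removed. *)
  + move=> k'; rewrite (ret_nth a) => /andP [].
    rewrite size_del2 // => lt_k' E.
    have szk : size (take k e) = k by rewrite size_takel; lia.
    have [lt1|ge1] := ltnP k'.+1 k.
      have : ret e k'.
        have lt2 : (k' < k)%N by lia.
        move: E; rewrite (ret_nth a) !nth_cat szk lt1 lt2 !nth_take // => ->.
        by rewrite andbT; lia.
      by move/wn; lia.
    have [lt2|ge2] := ltnP k' k; first by lia.
    have : ret e k'.+2.
      move: E; rewrite (ret_nth a) !nth_cat szk [(k' < k)%N]ltnNge ge2 /=.
      rewrite ltnNge ge1 /= !nth_drop.
      have -> : (k.+2 + (k' - k) = k'.+2)%N by lia.
      have -> : (k.+2 + (k'.+1 - k) = k'.+3)%N by lia.
      by move=> ->; rewrite andbT; lia.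
    by move/wn; lia.
  + by lia.
- rewrite big_distrr; apply: eq_bigr => k /ret_size lt_k.
  rewrite !del2_catr se sp.
  have [wk|wk] := boolP (n <= size u + (r.+1.*2 + k) <= n + size A)%N; last first.
    by rewrite /window (negbTE wk) !mul0r /= mulr0.
  rewrite (IH r.+1 u e (del2 k t) (rcons s a)) //.
  + by rewrite /=; ring.
  + apply: apart_words_sub ap => // b; rewrite !mem_cat.
    by case/or3P => [->|/orP [/mem_take|/mem_drop] ->|->]; rewrite ?orbT.
  + apply: apart_words_sub aps => // b; rewrite !mem_cat.
    by case/or3P => [->|/orP [/mem_take|/mem_drop] ->|->]; rewrite ?orbT.
  + by rewrite size_rcons ss.
  + by move=> k' /[dup] /ret_size lt_k' /wn; rewrite se in lt_k'; lia.
  + by lia.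
Qed.

(** Only the innermost pair can be plucked each time. As [u] and [t] have equal length it sits in
    the middle of the window, where [al] and [be] have equal exponents. *)
Lemma plucks_par A u s t : uniq (u ++ t) -> u ++ t = A -> uniq s ->
  apart_words s A -> size u = size t ->
  plucks A (size s) (u ++ (s ++ rev s) ++ t) = 1.
Proof.
move=> un E; elim/last_ind: s => [|s a IH] uns ap st; first by rewrite /= E eqxx.
have [un_u un_t ut] : [/\ uniq u, uniq t & apart_words u t].
  move: un; rewrite cat_uniq => /and3P [? /hasPn H ?]; split=> // b bu.
  by apply/negP => /H; rewrite bu.
have sub : {subset rcons s a ++ rev (rcons s a) <= rcons s a}.
  by move=> b; rewrite mem_cat mem_rev orbb.
have app : apart_words (rcons s a ++ rev (rcons s a)) (u ++ t).
  by rewrite E; apply: apart_words_sub ap.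
have [apu apt] := (apart_words_cat _ _ _).1 app.
rewrite size_rcons plucksS sum_ret_cat; last first.
  by apply/apart_words_cat; split=> //; apply: apart_wordsC.
rewrite sum_ret_uniq // add0r.
rewrite (sum_ret_cat (fun k => window A (size s) (size u + k) *
  plucks A (size s) (del2 (size u + k) (u ++ (rcons s a ++ rev (rcons s a)) ++ t)))) //.
rewrite [X in _ + X]sum_ret_uniq // addr0.
rewrite (sum_ret_par (fun k => window A (size s) (size u + k) *
  plucks A (size s) (del2 (size u + k) (u ++ (rcons s a ++ rev (rcons s a)) ++ t)))) //.
have -> : del2 (size u + size s) (u ++ (rcons s a ++ rev (rcons s a)) ++ t) =
    u ++ (s ++ rev s) ++ t.
  rewrite del2_catr rev_rcons cat_rcons -catA -{1}[size s]addn0 del2_catr.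
  by rewrite /del2 /= ?take0 ?drop0 ?catA.
rewrite IH //; last first.
- by apply: apart_words_sub ap => // b; rewrite mem_rcons inE orbC => ->.
- by move: uns; rewrite rcons_uniq => /andP [].
have szA : size A = (size u + size u)%N by rewrite -E size_cat st.
rewrite windowE szA; last by lia.
have -> : (size u + size s - size s = size u)%N by lia.
have -> : (size s + (size u + size u) - (size u + size s) = size u)%N by lia.
by rewrite expr_al_be // mulr1.
Qed.

(** Restricts one step of [plucks] to the part of the word seen by the window, the form in which it
    arises from drawing one line. *)
Lemma plucks_window A n x y z : size x = n -> size z = (size A).+2 ->
  plucks A n.+1 (x ++ z ++ y) =
  \sum_(0 <= i < (size A).+1 | ret z i)
    al ^+ i * be ^+ (size A - i) * plucks A n (x ++ del2 i z ++ y).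
Proof.
move=> sx sz; rewrite plucksS; set w := x ++ z ++ y.
have sw : (n + (size A).+1 <= size w)%N by rewrite !size_cat sx sz; lia.
rewrite (@big_cat_nat _ _ _ n) //=; last by lia.
rewrite [X in X + _]big_nat_cond big1 ?add0r; last first.
  move=> k /andP [/andP [_ lt_k] _].
  by rewrite /window leqNgt lt_k mul0r.
rewrite (@big_cat_nat _ _ _ (n + (size A).+1)) //=; last by lia.
rewrite [X in _ + X]big_nat_cond [X in _ + X]big1 ?addr0; last first.
  move=> k /andP [/andP [le_k _] _]; rewrite /window ifF ?mul0r //.
  by apply/negbTE/negP; lia.
rewrite -{1}[n]add0n big_addn addKn.
rewrite big_nat_cond [RHS]big_nat_cond; apply: eq_big => i.
  case: ltnP => //= lt_i; rewrite addnC -sx ret_catr ret_catl //; lia.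
move=> /andP [/andP [_ lt_i] _].
rewrite addnC -sx del2_catr del2_catl; last by lia.
rewrite windowE ?addKn; last by lia.
by have -> : (size x + size A - (size x + i) = size A - i)%N by lia.
Qed.

End Window.

(** * The state sum as a plucking count *)

Section Agree.
Variable P : finType.
Implicit Types (f g : {ffun P -> P}) (v w p q u : P) (us ds pre s : seq P).

Lemma uniq_mid (x y : seq P) a : uniq (x ++ a :: y) -> a \notin x ++ y.
Proof. by rewrite uniq_catC cat_cons cons_uniq !mem_cat orbC => /andP []. Qed.

Lemma sweepable_off u us pend pre v ds f x :
  sweepable u us pend pre (v :: ds) f -> x \in us ++ pre ++ ds ->
  [/\ x != u, x != v, f x != u & f x != v].
Proof.
case=> fm un H xs; have [fK fN] := fm.
have pre_sub : {subset pre <= flush pend pre}.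
  by case: (pend) => [w|] // y yp; rewrite /= mem_rcons inE yp orbT.
have xs' : x \in us ++ flush pend pre ++ ds.
  by move: xs; rewrite !mem_cat => /or3P [->|/pre_sub ->|->]; rewrite ?orbT.
move: un; rewrite cons_uniq => /andP [uN un].
have vN : v \notin us ++ flush pend pre ++ ds.
  by rewrite catA; apply: uniq_mid; rewrite -catA.
have xu : x != u.
  apply: contraNneq uN => <-; move: xs'; rewrite !(mem_cat, inE).
  by case/or3P => ->; rewrite ?orbT.
have xv : x != v by apply: contraNneq vN => <-.
have xv' : x \in us ++ pre ++ v :: ds.
  by move: xs; rewrite !(mem_cat, inE) => /or3P [] ->; rewrite ?orbT.
have out : f x != v.
  suff : f x \notin us ++ pre ++ v :: ds.
    by apply: contraNneq => ->; rewrite !mem_cat mem_head !orbT.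
  case: pend H {uN pre_sub xs' un vN} => [w [_]|]; first by apply.
  move=> /(_ x); rewrite inE xv' orbT => /(_ isT).
  by apply: contra; rewrite inE orbC => ->.
split=> //; case: pend H un {uN pre_sub xs' vN} => [w [fu _]|H] un; last first.
  have := H x; rewrite inE xv' orbT => /(_ isT).
  by apply: contraNneq => ->; rewrite mem_head.
have : w \notin us ++ pre ++ v :: ds.
  by rewrite catA; apply: uniq_mid; rewrite -catA -cat_rcons.
by apply: contraNneq => E; rewrite -fu -E fK.
Qed.

Lemma sweepable_map u us pend pre v ds f :
  sweepable u us pend pre (v :: ds) f ->
  {in us ++ pre ++ ds, swp u v f =1 f} /\ {in us ++ pre ++ ds, cup u v f =1 f}.
Proof.
move=> sw; have [fm _ _] := sw; split=> x xs;
  have [? ? ? ?] := sweepable_off sw xs; first by rewrite swp_off.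
by rewrite cup_off.
Qed.

(** A condition on the complete arcs, those with neither end on a line still to be crossed. *)
Definition outside (r : P -> P -> Prop) f s :=
  forall p, p \notin s -> f p \notin s -> r p (f p).

Lemma outside_eqi r f s s' : s =i s' -> outside r f s -> outside r f s'.
Proof. by move=> E ag p; rewrite -!E; apply: ag. Qed.

Lemma outside_swp r u v f s : matching f -> u \in s -> v \in s ->
  outside r f s -> outside r (swp u v f) s.
Proof.
move=> [fK fN] us vs ag p ps; have pu : u != p by apply: contraNneq ps => <-.
have pv : v != p by apply: contraNneq ps => <-.
rewrite ffunE (tpermD pu pv); case: tpermP => [_|_|_ _].
- by rewrite vs.
- by rewrite us.
- exact: ag.
Qed.

Lemma outside_cup (r : P -> P -> Prop) u v f s : matching f -> u != v ->
  u \in s -> v \in s ->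
  (f u \notin s -> f v \notin s -> r (f u) (f v) /\ r (f v) (f u)) ->
  outside r f s -> outside r (cup u v f) s.
Proof.
move=> [fK fN] uv us vs new ag p ps.
have pu : p != u by apply: contraNneq ps => ->.
have pv : p != v by apply: contraNneq ps => ->.
rewrite ffunE (negbTE pu) (negbTE pv); case: eqP => [E|_].
  by rewrite E in ps * => fvs; case: (new ps fvs).
case: eqP => [E fus|_]; last exact: ag.
by rewrite E in ps *; case: (new fus ps).
Qed.

Definition agree f g s := outside (fun p q => q = g p) f s.

End Agree.

Section Columns.
Variables (P : finType) (R : comNzRingType) (al be de : R).
Hypothesis al_be : al * be = 1.
Hypothesis deE : de = - al ^+ 2 - be ^+ 2.
Variable g : {ffun P -> P}.
Hypothesis g_matching : matching g.
Implicit Types (f : {ffun P -> P}) (v w p q u : P) (us ds pre s : seq P).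
Local Notation ssum := (ssum al be de).
Local Notation delta := (fun f => (f == g)%:R : R).
Local Notation sweep u us :=
  (sweep al be u (fun ds f => ssum (cells us ds) delta f)).

(** The letters of the words are arcs of the target [g], not of the current matching; so two
    neighbours are equal letters when joining them is what [g] demands. *)
Definition chord p : {set P} := [set p; g p].

Lemma map_del2 (T1 T2 : Type) (h : T1 -> T2) k (s : seq T1) :
  map h (take k s ++ drop k.+2 s) = take k (map h s) ++ drop k.+2 (map h s).
Proof. by rewrite map_cat map_take map_drop. Qed.

Lemma eq_chord p q : p != q -> (chord p == chord q) = (g p == q).
Proof.
have [gK gN] := g_matching; move=> pq; apply/eqP/eqP => [/setP /(_ q)|<-].
  by rewrite !inE eqxx eq_sym (negbTE pq) /= => /eqP.
by rewrite /chord gK setUC.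
Qed.

Lemma sweep_dead u us pend pre ds f p : sweepable u us pend pre ds f ->
  p \notin u :: us ++ flush pend pre ++ ds ->
  f p \notin u :: us ++ flush pend pre ++ ds -> f p != g p ->
  sweep u us pend pre ds f = 0.
Proof.
move=> sw ps fps ne; have [fm un _] := sw.
rewrite -(ssum_sweep al_be deE _ sw) -ssum_cat; apply: (@ssum_dead _ _ al be de _ _ f g p) => //.
  have un' : u \notin us ++ flush pend pre ++ ds by move: un; rewrite cons_uniq => /andP [].
  rewrite /loopless all_cat -!/(loopless _) loopless_line ?loopless_cells //.
    by move: un; rewrite cons_uniq => /andP [].
  by move: un'; rewrite !mem_cat !negb_or => /and3P [].
move=> c; rewrite mem_cat => cs.
have [c1 c2] : c.1 \in u :: us ++ flush pend pre ++ ds /\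
    c.2 \in u :: us ++ flush pend pre ++ ds.
  case/orP: cs => [/mem_line [-> c2]|/mem_cells [c1 c2]].
    by rewrite mem_head inE !mem_cat c2 !orbT.
  by rewrite !inE !mem_cat c1; move: c2; rewrite mem_cat => ->; rewrite !orbT.
apply/and4P; split.
- by apply: contraNneq ps => ->.
- by apply: contraNneq ps => ->.
- by apply: contraNneq fps => ->.
- by apply: contraNneq fps => ->.
Qed.

Lemma cells_dead us ds f p : matching f -> uniq (us ++ ds) ->
  p \notin us ++ ds -> f p \notin us ++ ds -> f p != g p ->
  ssum (cells us ds) delta f = 0.
Proof.
move=> fm un ps fps ne; apply: (@ssum_dead _ _ al be de _ _ f g p) => //.
  exact: loopless_cells.
move=> c /mem_cells [c1 c2].
have c1' : c.1 \in us ++ ds by rewrite mem_cat c1.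
have c2' : c.2 \in us ++ ds by rewrite mem_cat c2 orbT.
apply/and4P; split.
- by apply: contraNneq ps => ->.
- by apply: contraNneq ps => ->.
- by apply: contraNneq fps => ->.
- by apply: contraNneq fps => ->.
Qed.

Local Notation unpaired := (sorted (fun v w => g v != w)).
Local Notation plucks_of us ds w :=
  (plucks al be (map chord ds) (size us) (map chord w)).

Lemma unpaired_mid x y v w : unpaired (x ++ v :: w :: y) -> g v != w.
Proof.
by move/(drop_sorted (size x)); rewrite drop_size_cat //= => /andP [].
Qed.

Section Step.
Variables (u : P) (us : seq P).
Hypothesis IHus : forall ds f, matching f -> uniq (us ++ ds) ->
  outward f (us ++ ds) -> agree f g (us ++ ds) -> unpaired ds ->
  ssum (cells us ds) delta f =
  plucks_of us ds (rev (map f us) ++ map f ds ++ us).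

(** After one marker -1 all later markers on the line must be -1: a marker +1 would complete an arc
    between the neighbours [w] and [v], which [unpaired] excludes from [g]. Hence a single term, a
    power of [be]. *)
Lemma sweep_arc w pre ds f : sweepable u us (Some w) pre ds f ->
  agree f g (u :: us ++ pre ++ w :: ds) -> unpaired (pre ++ w :: ds) ->
  sweep u us (Some w) pre ds f = be ^+ size ds *
  plucks_of us (pre ++ w :: ds)
    (rev (map f us) ++ (map f pre ++ map f ds ++ [:: u]) ++ us).
Proof.
have [gK gN] := g_matching.
elim: ds w pre f => [|v ds IH] w pre f sw ag up.
  have [fm un [fu out]] := sw; have [fK fN] := fm.
  have fw : f w = u by rewrite -fu fK.
  move: un; rewrite cons_uniq /= cats0 => /andP [uN un].
  have wN : w \notin us ++ pre.
    by rewrite -(cats0 pre) catA; apply: uniq_mid; rewrite -catA cats1.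
  rewrite mul1r /= IHus //.
  - have -> : map f (rcons pre w) = map f pre ++ [:: u] by rewrite map_rcons fw cats1.
    by rewrite (cats1 pre).
  - move=> x; rewrite -rcons_cat mem_rcons inE => /predU1P [->|xs].
      by rewrite fw rcons_cat.
    rewrite mem_rcons inE negb_or; apply/andP; split.
      apply: contraNneq uN => E.
      by rewrite -fw -E fK mem_cat mem_rcons inE; move: xs; rewrite mem_cat => /orP [] ->; rewrite ?orbT.
    by have := out x; rewrite cats0 => /(_ xs).
  - move=> p; rewrite -rcons_cat !mem_rcons !inE !negb_or => /andP [pw ps] /andP [fpw fps].
    have pu : p != u by apply: contraNneq fpw => ->; rewrite fu.
    have fpu : f p != u by apply: contraNneq pw => E; rewrite -fu -E fK.
    apply: ag; rewrite !(inE, mem_cat) !negb_or ?pu ?fpu ?pw ?fpw /= ?andbT.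
      by move: ps; rewrite mem_cat negb_or.
    by move: fps; rewrite mem_cat negb_or.
  - by rewrite -cats1.
have sw1 := sweepable_swp sw; have sw2 := sweepable_cup sw.
have [offs offc] := sweepable_map sw.
have [fm un [fu out]] := sw; have [fK fN] := fm.
have uv : u != v.
  by move: un; rewrite cons_uniq !(mem_cat, inE) !negb_or => /andP [/and4P []].
have Nuvw : u != w by rewrite -fu eq_sym fN.
have wN : w \notin us ++ pre ++ v :: ds.
  rewrite catA; apply: uniq_mid; rewrite -catA -cat_rcons.
  by move: un; rewrite cons_uniq => /andP [].
have wv : w != v.
  by apply: contraNneq wN => ->; rewrite !mem_cat mem_head !orbT.
have fvu : f v != w by rewrite -fu (inj_eq (can_inj fK)) eq_sym.
have fvN : f v \notin us ++ pre ++ v :: ds.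
  by apply: out; rewrite !mem_cat mem_head !orbT.
rewrite /= (sweep_dead (p := w) sw1); first last.
- have -> : swp u v f w = v.
    have [sK _] := swp_matching u v fm.
    by rewrite -[RHS]sK swp_l // fu.
  by rewrite eq_sym (unpaired_mid up).
- have -> : swp u v f w = v.
    have [sK _] := swp_matching u v fm.
    by rewrite -[RHS]sK swp_l // fu.
  move: un; rewrite cons_uniq /= => /andP [uN un].
  rewrite inE negb_or eq_sym uv /=.
  have : v \notin us ++ rcons pre w ++ ds.
    by rewrite catA; apply: uniq_mid; rewrite -catA.
  by apply: contra; rewrite !(mem_cat, mem_rcons, inE) => /or3P [] ->; rewrite ?orbT.
- rewrite /= inE negb_or eq_sym Nuvw /=.
  by apply: contra wN; rewrite !(mem_cat, inE) => /or3P [] ->; rewrite ?orbT.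
rewrite mulr0 add0r IH //; last first.
- by rewrite cat_rcons.
- rewrite /= cat_rcons; apply: outside_cup => //.
  + exact: mem_head.
  + by rewrite !(mem_cat, inE) eqxx !orbT.
  + by rewrite fu !(mem_cat, inE) eqxx !orbT.
have mapE s : {subset s <= us ++ pre ++ ds} -> map (cup u v f) s = map f s.
  by move=> sub; apply/eq_in_map => x /sub /offc.
rewrite exprS mulrA /= map_rcons !mapE.
- have -> : cup u v f w = f v.
    by rewrite ffunE eq_sym (negbTE Nuvw) (negbTE wv) fu eqxx.
  by rewrite !cat_rcons.
- by move=> x; rewrite !mem_cat => ->; rewrite ?orbT.
- by move=> x; rewrite !mem_cat => ->; rewrite ?orbT.
- by move=> x; rewrite !mem_cat => ->; rewrite ?orbT.
Qed.

(** The surviving choices are [i] markers +1 followed by markers -1 only. The first -1 completes an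
    arc between two neighbours of [z], which must therefore be equal letters; if there is no -1, the
    completed arc is the one from the last strand to [u]. *)
Lemma sweep_free pre ds f : sweepable u us None pre ds f ->
  agree f g (u :: us ++ pre ++ ds) -> unpaired (pre ++ ds) ->
  let z := map f pre ++ f u :: map f ds ++ [:: u] in
  sweep u us None pre ds f =
  \sum_(0 <= i < (size ds).+1 | ret (map chord z) (size pre + i))
    al ^+ i * be ^+ (size ds - i) *
    plucks_of us (pre ++ ds) (rev (map f us) ++ del2 (size pre + i) z ++ us).
Proof.
have [gK gN] := g_matching.
elim: ds pre f => [|v ds IH] pre f sw ag up z.
  have [fm un out] := sw; have [fK fN] := fm.
  move: un; rewrite cons_uniq /= cats0 => /andP [uN un].
  rewrite cats0 in out ag up; rewrite big_mkcond big_nat1 addn0.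
  have -> : ret (map chord z) (size pre) = (g (f u) == u).
    rewrite map_cat -[X in ret _ X]addn0 -(size_map f) -(size_map chord) ret_catr.
    by rewrite /ret /= eq_chord.
  have -> : del2 (size pre) z = map f pre.
    by rewrite -[size pre]addn0 -(size_map f pre) del2_catr /del2 /= cats0.
  case: ifP => E; last first.
    rewrite /= (@cells_dead _ _ _ u) //.
      by apply: contra (out _ (mem_head _ _)); rewrite inE orbC => ->.
    by apply: contraFneq E => E; rewrite E gK.
  rewrite mul1r mul1r /= IHus //.
  - by move=> x xs; have := out x; rewrite !inE xs orbT => /(_ isT) /norP [].
  - move=> p ps fps; have [->|pu] := eqVneq p u; first by rewrite -{2}(eqP E) gK.
    have [fpu|fpu] := eqVneq (f p) u.
      by rewrite -[p in g p]fK fpu (eqP E).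
    by apply: ag; rewrite inE negb_or ?pu ?fpu.
have sw1 := sweepable_swp sw; have sw2 := sweepable_cup sw.
have [offs offc] := sweepable_map sw.
have mapS s : {subset s <= us ++ pre ++ ds} -> map (swp u v f) s = map f s.
  by move=> sub; apply/eq_in_map => x /sub /offs.
have mapC s : {subset s <= us ++ pre ++ ds} -> map (cup u v f) s = map f s.
  by move=> sub; apply/eq_in_map => x /sub /offc.
have sub1 : {subset us <= us ++ pre ++ ds} by move=> x; rewrite !mem_cat => ->.
have sub2 : {subset pre <= us ++ pre ++ ds} by move=> x; rewrite !mem_cat => ->; rewrite orbT.
have sub3 : {subset ds <= us ++ pre ++ ds} by move=> x; rewrite !mem_cat => ->; rewrite !orbT.
have [fm un out] := sw; have [fK fN] := fm.
have uv : u != v.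
  by move: un; rewrite cons_uniq !(mem_cat, inE) !negb_or => /andP [/and4P []].
have vs : v \in u :: us ++ pre ++ v :: ds by rewrite !(mem_cat, inE) eqxx !orbT.
have fus := out _ (mem_head _ _); have fvs := out _ vs.
have fuv : f u != v by apply: contraNneq fus => ->.
rewrite [LHS]/= big_mkcond big_nat_recl // -big_mkcond [LHS]addrC; congr (_ + _).
- have -> : ret (map chord z) (size pre + 0) = (g (f u) == f v).
    rewrite map_cat -{1}(size_map f) -(size_map chord) ret_catr.
    rewrite /ret /= eq_chord //.
    by rewrite (inj_eq (can_inj fK)).
  have -> : del2 (size pre + 0) z = map f pre ++ map f ds ++ [:: u].
    by rewrite -(size_map f pre) del2_catr /del2 /= drop0.
  rewrite /= mul1r; case: eqP => E.
    rewrite mulrC sweep_arc //; last first.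
      rewrite /=; apply: outside_cup => //; [exact: mem_head|by rewrite -E gK].
    by rewrite !mapC // mulrC exprS mulrA.
  rewrite (@sweep_dead _ _ _ _ _ _ (f u)) ?mulr0 //.
  + by rewrite /= cat_rcons.
  + rewrite /= cat_rcons.
    have -> : cup u v f (f u) = f v; last by [].
    by rewrite ffunE (negbTE (fN u)) (negbTE fuv) eqxx.
  + have -> : cup u v f (f u) = f v.
      by rewrite ffunE (negbTE (fN u)) (negbTE fuv) eqxx.
    by rewrite eq_sym; apply/eqP.
rewrite IH //; last first.
- by rewrite cat_rcons.
- rewrite cat_rcons; apply: outside_swp => //; exact: mem_head.
rewrite big_distrr.
have z1 : map (swp u v f) (rcons pre v) ++ swp u v f u :: map (swp u v f) ds ++ [:: u] = z.
  by rewrite map_rcons !mapS // swp_l // swp_r // cat_rcons.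
rewrite z1 size_rcons; apply: eq_big => i; first by rewrite addSnnS.
by rewrite !mapS // addSnnS cat_rcons exprS subSS -!mulrA.
Qed.

End Step.

(** The word runs up the left side, along the top and down the right side of the part still to be
    drawn. The first line, with left end [f u] and right end [u], plucks one pair of [f u :: map f
    ds ++ [:: u]], which is the current window. *)
Lemma ssum_plucks us ds f : matching f -> uniq (us ++ ds) ->
  outward f (us ++ ds) -> agree f g (us ++ ds) -> unpaired ds ->
  ssum (cells us ds) delta f =
  plucks_of us ds (rev (map f us) ++ map f ds ++ us).
Proof.
elim: us ds f => [|u us IH] ds f fm un out ag up.
  (* With no line left, equality of the words says that the strands on [ds] are arcs of [g]; the
     complete arcs are covered by [agree]. *)
  rewrite /= cats0; congr ((nat_of_bool _)%:R); apply/eqP/eqP => [->|E].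
    by rewrite -map_comp; apply: eq_map => x /=; rewrite /chord setUC; case: g_matching => ->.
  have H x : x \in ds -> f x = g x.
    move=> xs; have := congr1 (fun s : seq {set P} => nth set0 s (index x ds)) E.
    have lt_x : (index x ds < size ds)%N by rewrite index_mem.
    rewrite !(nth_map x) ?size_map // nth_index // => /eqP.
    have [fK fN] := fm; rewrite eq_sym eq_chord; last by rewrite eq_sym fN.
    by move/eqP.
  have [fK fN] := fm; have [gK gN] := g_matching.
  apply/ffunP => p; have [ps|ps] := boolP (p \in ds); first exact: H.
  have [fps|fps] := boolP (f p \in ds); last exact: ag.
  by have := H _ fps; rewrite fK => {2}->; rewrite gK.
rewrite (ssum_cells_sweep al_be deE) // (sweep_free IH) //.
have -> : rev (map f (u :: us)) ++ map f ds ++ u :: us =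
    rev (map f us) ++ (f u :: map f ds ++ [:: u]) ++ us.
  by rewrite /= rev_cons cat_rcons -catA.
rewrite -[size (u :: us)]/(size us).+1 !map_cat.
have h1 : size (map chord (rev (map f us))) = size us.
  by rewrite size_map size_rev size_map.
rewrite (plucks_window _ _ _ h1) ?size_map; last first.
  by rewrite /= size_cat /= !size_map addn1.
apply: eq_big => // i _.
by rewrite /del2 -map_del2 -!map_cat.
Qed.

End Columns.

(** * The abstract factorization *)

Section Rows.
Variables (P : finType) (R : comNzRingType) (al be de : R).
Hypothesis al_be : al * be = 1.
Hypothesis deE : de = - al ^+ 2 - be ^+ 2.
Implicit Types (f g : {ffun P -> P}) (v w p q u : P) (us ds pre s : seq P).
Local Notation ssum := (ssum al be de).
Variables (phi phi' : {ffun P -> P} -> R) (k : R) (sm : rel P).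
Local Notation sweep u us phi :=
  (sweep al be u (fun ds f => ssum (cells us ds) phi f)).

(* The ports at the upper end of the vertical lines and of [u]. *)
Definition upper u (pend : option P) pre ds f :=
  if pend is Some _ then map f pre ++ map f ds ++ [:: u]
  else map f pre ++ f u :: map f ds ++ [:: u].

(** Arcs completed by a row join two ports of the upper side [Z] or two vertical lines of [ds0].
    Both lists stay fixed while the current ports shrink to subsequences of them, so [outside sm]
    persists. *)
Lemma sweep_scale u us ds0 Z Us :
  {in ds0 &, forall p q, sm p q} -> {in Z &, forall p q, sm p q} ->
  (forall ds f, matching f -> uniq (us ++ ds) -> outward f (us ++ ds) ->
    subseq ds ds0 -> subseq (map f ds) Z -> map f us = Us ->
    outside sm f (us ++ ds) ->
    ssum (cells us ds) phi f = k * ssum (cells us ds) phi' f) ->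
  forall pend pre ds f, sweepable u us pend pre ds f ->
  subseq (flush pend pre ++ ds) ds0 -> subseq (upper u pend pre ds f) Z ->
  map f us = Us -> outside sm f (u :: us ++ flush pend pre ++ ds) ->
  sweep u us phi pend pre ds f = k * sweep u us phi' pend pre ds f.
Proof.
move=> smd smZ H pend pre ds; elim: ds pend pre => [|v ds IH] pend pre f.
  rewrite cats0 => sw sd sZ fus J; have [fm un out] := sw; have [fK fN] := fm.
  move: un; rewrite cons_uniq /= cats0 => /andP [uN un].
  case: pend uN un sd sZ J out {sw} => [w|] uN un sd sZ J out /=.
    case: out => fu out; rewrite cats0 in out.
    have fw : f w = u by rewrite -fu fK.
    have wN : w \notin us ++ pre.
      by rewrite -(cats0 pre) catA; apply: uniq_mid; rewrite -catA cats1.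
    apply: H => //.
    - move=> x; rewrite -rcons_cat mem_rcons inE => /predU1P [->|xs].
        by rewrite fw rcons_cat.
      rewrite mem_rcons inE negb_or out // andbT.
      apply: contraNneq uN => E.
      rewrite -fw -E fK mem_cat mem_rcons inE.
      by move: xs; rewrite mem_cat => /orP [] ->; rewrite ?orbT.
    - by rewrite map_rcons fw -cats1.
    - move=> p ps fps; have pw : p != w.
        by apply: contraNneq ps => ->; rewrite mem_cat mem_rcons mem_head orbT.
      have fpw : f p != w.
        by apply: contraNneq fps => ->; rewrite mem_cat mem_rcons mem_head orbT.
      have pu : p != u by apply: contraNneq fpw => ->; rewrite fu.
      have fpu : f p != u by apply: contraNneq pw => E; rewrite -fu -E fK.
      by apply: J; rewrite inE negb_or ?pu ?fpu.
  rewrite cats0 in out; apply: H => //.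
  - by move=> x xs; have := out x; rewrite !inE xs orbT => /(_ isT) /norP [].
  - by apply: subseq_trans sZ; apply: prefix_subseq.
  - have uZ : u \in Z by apply: (mem_subseq sZ); rewrite !(mem_cat, inE) eqxx !orbT.
    have fuZ : f u \in Z by apply: (mem_subseq sZ); rewrite !(mem_cat, inE) eqxx !orbT.
    move=> p ps fps; have [->|pu] := eqVneq p u; first exact: smZ.
    have [fpu|fpu] := eqVneq (f p) u.
      by rewrite -[p in sm p]fK fpu; apply: smZ.
    by apply: J; rewrite inE negb_or ?pu ?fpu.
move=> sw sd sZ fus J.
have sw1 := sweepable_swp sw; have sw2 := sweepable_cup sw.
have [offs offc] := sweepable_map sw.
have mapS s : {subset s <= us ++ pre ++ ds} -> map (swp u v f) s = map f s.
  by move=> sub; apply/eq_in_map => x /sub /offs.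
have mapC s : {subset s <= us ++ pre ++ ds} -> map (cup u v f) s = map f s.
  by move=> sub; apply/eq_in_map => x /sub /offc.
have sub1 : {subset us <= us ++ pre ++ ds} by move=> x; rewrite !mem_cat => ->.
have sub2 : {subset pre <= us ++ pre ++ ds} by move=> x; rewrite !mem_cat => ->; rewrite orbT.
have sub3 : {subset ds <= us ++ pre ++ ds} by move=> x; rewrite !mem_cat => ->; rewrite !orbT.
have [fm un out] := sw; have [fK fN] := fm.
have uv : u != v.
  by move: un; rewrite cons_uniq !(mem_cat, inE) !negb_or => /andP [/and4P []].
have us_ : u \in u :: us ++ flush pend pre ++ v :: ds by rewrite mem_head.
have vs : v \in u :: us ++ flush pend pre ++ v :: ds by rewrite !(mem_cat, inE) eqxx !orbT.
have vds0 : v \in ds0 by apply: (mem_subseq sd); rewrite mem_cat mem_head orbT.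
have fuvw : if pend is Some w then [/\ f u = w, w != v & w != u] else f u != v.
  case: pend un out {sw sd sZ J sw1 sw2 us_ vs} => [w un [fu out]|un out].
    split=> //; last by rewrite -fu fN.
    have : w \notin us ++ pre ++ v :: ds.
      rewrite catA; apply: uniq_mid; rewrite -catA -cat_rcons.
      by case/andP: un.
    by apply: contraNneq => ->; rewrite !mem_cat mem_head !orbT.
  apply: contraNneq (out _ (mem_head _ _)) => ->.
  by rewrite !(inE, mem_cat) eqxx !orbT.
rewrite /= mulrDr !mulrA ![k * _]mulrC -!mulrA; congr (_ * _ + _ * _); apply: IH => //.
- apply: subseq_trans sd; case: (pend) => [w|] /=; last by rewrite cat_rcons.
  by rewrite cat_rcons; apply: cat_subseq => //; apply: (@subseq_trans _ (v :: ds)); apply: subseq_cons.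
- apply: subseq_trans sZ; case: pend fuvw {sw out sw1 sw2 sd J un us_ vs} => [w [fu wv wu]|fuv] /=.
    by rewrite !mapS // swp_r // fu.
  by rewrite map_rcons !mapS // swp_l // swp_r // cat_rcons.
- by rewrite mapS.
(* When [w] is pending, the arc between [w] and [v] becomes complete here; both are lines of
   [ds0]. *)
- have J1 := outside_swp fm us_ vs J.
  case: pend fuvw sd J1 {sw sw1 sw2 sZ J un us_ vs out} => [w [fu wv wu]|fuv] sd J1; last first.
    by move: J1; rewrite /= cat_rcons.
  have [sK sN] := swp_matching u v fm.
  have Ev : swp u v f v = w by rewrite swp_l // fu.
  have Ew : swp u v f w = v by rewrite -Ev sK.
  have wds0 : w \in ds0 by apply: (mem_subseq sd); rewrite mem_cat mem_rcons mem_head.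
  move=> p ps fps; have [->|pw] := eqVneq p w; first by rewrite Ew; apply: smd.
  have [->|pv] := eqVneq p v; first by rewrite Ev; apply: smd.
  have fpw : swp u v f p != w by apply: contraNneq pv => E; apply/eqP; rewrite -[LHS]sK E.
  have fpv : swp u v f p != v by apply: contraNneq pw => E; apply/eqP; rewrite -[LHS]sK E.
  apply: J1.
    move: ps; rewrite !(inE, mem_cat, mem_rcons) !negb_or pw pv /=.
    by case/and4P => -> -> -> ->.
  move: fps; rewrite !(inE, mem_cat, mem_rcons) !negb_or fpw fpv /=.
  by case/and4P => -> -> -> ->.
- by move: sd; rewrite /= cat_rcons.
- apply: subseq_trans sZ; case: pend fuvw {sw out sw1 sw2 sd J un us_ vs} => [w [fu wv wu]|fuv] /=.
    rewrite map_rcons !mapC // ffunE (negbTE wu) (negbTE wv) fu eqxx.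
    by rewrite cat_rcons.
  rewrite !mapC //; apply: cat_subseq => //.
  by apply: (@subseq_trans _ (f v :: map f ds ++ [:: u])); apply: subseq_cons.
- by rewrite mapC.
- rewrite /= cat_rcons; apply: outside_cup => //.
  case: pend fuvw sZ {sw sw1 sw2 sd J un us_ vs out} => [w [fu wv wu]|fuv] sZ.
    by rewrite fu /= !(inE, mem_cat, mem_rcons) eqxx !orbT.
  have fuZ : f u \in Z by apply: (mem_subseq sZ); rewrite !(mem_cat, inE) eqxx !orbT.
  have fvZ : f v \in Z by apply: (mem_subseq sZ); rewrite !(mem_cat, inE) eqxx !orbT.
  by move=> _ _; split; apply: smZ.
Qed.

(** Reduces a proportionality of state sums to the lines [us'], for every matching that the lines
    [us] can leave behind. All that is remembered of [us] is that the arcs completed by it satisfy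
    [sm]. *)
Lemma rows_scale us us' ds f ds0 Z : subseq ds ds0 ->
  subseq (rev (map f us) ++ map f ds ++ us) Z ->
  {in ds0 &, forall p q, sm p q} -> {in Z &, forall p q, sm p q} ->
  (forall ds1 f1, matching f1 -> uniq (us' ++ ds1) -> outward f1 (us' ++ ds1) ->
    subseq ds1 ds0 -> subseq (map f1 ds1) Z ->
    map f1 us' = map f us' -> outside sm f1 (us' ++ ds1) ->
    ssum (cells us' ds1) phi f1 = k * ssum (cells us' ds1) phi' f1) ->
  matching f -> uniq ((us ++ us') ++ ds) -> outward f ((us ++ us') ++ ds) ->
  outside sm f ((us ++ us') ++ ds) ->
  ssum (cells (us ++ us') ds) phi f = k * ssum (cells (us ++ us') ds) phi' f.
Proof.
move=> sd sZ smd smZ.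
elim: us ds f sd sZ => [|u us IH] ds f sd sZ H fm un out J.
  by apply: H => //; apply: subseq_trans sZ; rewrite /= cats0.
rewrite !cat_cons !(ssum_cells_sweep al_be deE) //.
apply: (@sweep_scale u (us ++ us') ds (f u :: map f ds ++ [:: u]) (map f (us ++ us'))) => //.
- by move=> p q ps qs; apply: smd; apply: (mem_subseq sd).
- have sub : {subset f u :: map f ds ++ [:: u] <= Z}.
    move=> p ps; apply: (mem_subseq sZ).
    move: ps; rewrite /= rev_cons !(mem_cat, inE, mem_rcons).
    by case/or3P => [->|->|/eqP ->]; rewrite ?eqxx ?orbT.
  by move=> p q /sub ps /sub qs; apply: smZ.
move=> ds1 f1 f1m un1 out1 sd1 sZ1 E J1.
have [E1 E2] : map f1 us = map f us /\ map f1 us' = map f us'.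
  move/eqP: E; rewrite !map_cat eqseq_cat ?size_map //.
  by case/andP => /eqP -> /eqP ->.
apply: IH => //.
- exact: subseq_trans sd1 sd.
- rewrite E1; apply: subseq_trans sZ; rewrite /= rev_cons cat_rcons.
  apply: cat_subseq => //.
  have -> : f u :: map f ds ++ u :: us = (f u :: map f ds ++ [:: u]) ++ us.
    by rewrite /= -catA.
  exact: cat_subseq.
- by rewrite E2.
Qed.

End Rows.

Lemma outward_map (P : finType) (f : {ffun P -> P}) (s : seq P) :
  matching f -> outward f s -> outward f (map f s).
Proof.
move=> [fK _] out x /mapP [y ys ->]; rewrite fK.
by apply/mapP => -[z zs E]; have := out z zs; rewrite -E ys.
Qed.

Lemma outside_map (P : finType) (f : {ffun P -> P}) r (s : seq P) :
  matching f -> outside r f s -> outside r f (map f s).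
Proof.
move=> [fK _] J p ps fps; apply: J.
  by apply: contra fps => ps'; apply: map_f.
by apply: contra ps => fps'; apply/mapP; exists (f p); rewrite ?fK.
Qed.

Lemma filter_mid (T : eqType) (w x e y : seq T) : uniq (x ++ e ++ y) ->
  subseq w (x ++ e ++ y) -> {subset e <= w} ->
  w = filter (mem w) x ++ e ++ filter (mem w) y.
Proof.
move=> un /(subseq_uniqP un) E sub; rewrite [LHS]E !filter_cat.
by congr (_ ++ (_ ++ _)); apply/all_filterP/allP => p /sub.
Qed.

Section Factor.
Variables (P : finType) (R : comNzRingType) (al be de : R).
Hypothesis al_be : al * be = 1.
Hypothesis deE : de = - al ^+ 2 - be ^+ 2.
Implicit Types (f : {ffun P -> P}) (v w p q u : P).
Local Notation ssum := (ssum al be de).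
Local Notation delta g := (fun f => (f == g)%:R : R).

(* The left side is [a1 ++ a2 ++ a3], the right side [c1 ++ c2 ++ c3], both
   read downwards; [b] is the top and [d] the bottom, read to the right. *)
Variables (a1 a2 a3 b c1 c2 c3 d E u0 t0 : seq P) (g g' : {ffun P -> P}).
Variables (r : nat) (s : seq {set P}).
Let above := rev a1 ++ b ++ c1.
Let below := c3 ++ rev d ++ rev a3.
Let same p q := [&& p \in above & q \in above] || [&& p \in below & q \in below].
Hypothesis boundary : above ++ c2 ++ below = u0 ++ E ++ t0.
Hypothesis un : uniq (a2 ++ above ++ c2 ++ below).
Hypotheses (gm : matching g) (gm' : matching g').
Hypothesis gE : {in E, forall p, g p \in E}.
Hypothesis gE' : {in E, forall p, g' p \in E}.
Hypothesis eq_gg' : forall p, p \notin E -> g' p = g p.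
Hypothesis gN : {in E, forall p, ~~ same p (g p)}.
Hypothesis gN' : {in E, forall p, ~~ same p (g' p)}.
Hypothesis unpaired_a2 : sorted (fun v w => g v != w) (rev a2).
Hypothesis sizeE : size E = r.*2.
Hypotheses (par : map (chord g') (rev E) = s ++ rev s) (uniq_s : uniq s).
Hypothesis size_s : size s = r.
Hypothesis r_gt0 : (0 < r)%N.

Let un_lin : uniq (u0 ++ E ++ t0).
Proof. by move: un; rewrite boundary cat_uniq => /and3P []. Qed.

Let a2_lin p : p \in a2 -> p \notin u0 ++ E ++ t0.
Proof.
move: un; rewrite boundary cat_uniq => /and3P [_ /hasPn H _] pa.
by apply/negP => /H; rewrite pa.
Qed.

Lemma chord_apart g0 : matching g0 -> {in E, forall p, g0 p \in E} ->
  forall e x : seq P, {subset e <= E} -> {in x, forall p, p \notin E} ->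
  (forall p, p \notin E -> g0 p = g p) ->
  apart_words (map (chord g0) e) (map (chord g) x).
Proof.
move=> g0m g0E e x eE xE eqg A /mapP [p pe ->]; apply/mapP => -[q qx].
have pE := eE _ pe; move/setP/(_ q); rewrite !inE eqxx /= => /orP [] /eqP Eq.
  by have := xE _ qx; rewrite Eq pE.
by have := xE _ qx; rewrite Eq g0E.
Qed.

(** The middle rows are drawn by columns: after a half turn and a transposition the columns cross
    [rev a2], in which [g] joins no neighbours, so [ssum_plucks] applies. The word is the boundary
    word [w] read backwards; [E] is a contiguous part of it, so the factorization becomes
    [plucks_factor]. *)
Lemma factor_mid f d3 : matching f -> uniq (c2 ++ d3) ->
  outward f (c2 ++ d3) -> map f c2 = a2 -> subseq (rev d3) below ->
  subseq (map f d3) above -> outside same f (c2 ++ d3) ->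
  ssum (cells c2 d3) (delta g) f =
  pluck al be r (map (chord g) (rev E)) * ssum (cells c2 d3) (delta g') f.
Proof.
move=> fm un3 out fc2 sd sb J; have [fK fN] := fm.
set S := c2 ++ d3.
(* A complete arc stays within [above] or within [below], so it is never one of the arcs in which
   [g] and [g'] differ. *)
have eq_out p : p \notin S -> f p \notin S -> (f p == g p) = (f p == g' p).
  move=> pS fpS; have := J p pS fpS => sm.
  have [pE|pE] := boolP (p \in E); last by rewrite eq_gg'.
  apply/eqP/eqP => Ep; have := gN pE; have := gN' pE; rewrite -?Ep ?sm //.
have [ag|] := boolP [forall p, (p \notin S) ==> (f p \notin S) ==> (f p == g p)]; last first.
  rewrite negb_forall => /existsP [p]; rewrite !negb_imply => /and3P [pS fpS ne].
  have ne' : f p != g' p by rewrite -eq_out.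
  by rewrite !(@cells_dead _ _ _ _ _ _ _ _ _ p) ?mulr0.
have {}ag : agree f g S.
  by move=> p pS fpS; apply/eqP; move/forallP: ag => /(_ p); rewrite pS fpS.
have ag' : agree f g' S by move=> p pS fpS; apply/eqP; rewrite -eq_out // ag.
set b3 := map f d3.
have unS : uniq (rev b3 ++ rev a2).
  rewrite -rev_cat rev_uniq -fc2 /b3 -map_cat map_inj_uniq //; exact: can_inj fK.
have transp phi : ssum (cells c2 d3) phi f = ssum (cells (rev b3) (rev a2)) phi f.
  by rewrite ssum_flip // fc2 ssum_transpose.
have memS : rev b3 ++ rev a2 =i map f S.
  by move=> p; rewrite /S map_cat fc2 !mem_cat !mem_rev orbC.
have outS : outward f (rev b3 ++ rev a2).
  by move=> p; rewrite !memS; apply: outward_map.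
have agS g0 : agree f g0 S -> agree f g0 (rev b3 ++ rev a2).
  by move=> ag0; apply: (outside_eqi (s := map f S)) => [p|]; [rewrite memS|exact: outside_map].
have a2E p : p \in a2 -> p \notin E.
  by move=> /a2_lin; apply: contra => pE; rewrite !mem_cat pE orbT.
have up' : sorted (fun v w => g' v != w) (rev a2).
  apply: (@sub_in_sorted _ [pred p | p \notin E] _ _ _ _ _ unpaired_a2).
    by move=> p q pE _ /=; rewrite eq_gg'.
  by apply/allP => p; rewrite mem_rev; apply: a2E.
rewrite !transp !(ssum_plucks al_be deE) //; try exact: agS.
have fb3 : map f (rev b3) = rev d3.
  by rewrite map_rev /b3 -map_comp map_id_in // => p _ /=.
have fa2 : map f (rev a2) = rev c2.
  by rewrite map_rev -fc2 -map_comp map_id_in // => p _ /=.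
rewrite fb3 fa2 revK size_rev.
set w := b3 ++ c2 ++ rev d3.
have -> : d3 ++ rev c2 ++ rev b3 = rev w by rewrite /w !rev_cat revK catA.
have sw : subseq w (u0 ++ E ++ t0).
  by rewrite -boundary; apply: cat_subseq => //; apply: cat_subseq.
(* No end of the family has been used up: a complete arc at it would be an arc of [g] within one
   part. *)
have Ew : {subset E <= w}.
  move=> p pE; have pl : p \in u0 ++ E ++ t0 by rewrite !mem_cat pE orbT.
  have pa2 : p \notin a2 by apply: contraL pl; apply: a2_lin.
  have [pS|pS] := boolP (p \in S).
    by move: pS; rewrite !mem_cat mem_rev => /orP [] ->; rewrite ?orbT.
  have [fpS|fpS] := boolP (f p \in S); last first.
    have := J p pS fpS; rewrite (ag p pS fpS) => sm.
    by have := gN pE; rewrite sm.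
  move: (fpS); rewrite mem_cat => /orP [fc|fd].
    by move: pa2; rewrite -fc2 -(fK p) map_f.
  by rewrite !mem_cat -[p in p \in b3]fK map_f.
have := filter_mid un_lin sw Ew.
set x := filter _ u0; set y := filter _ t0 => Ew'.
have xE : {in x, forall p, p \notin E}.
  move=> p; rewrite mem_filter => /andP [_ pu]; move: un_lin.
  rewrite cat_uniq => /and3P [_ /hasPn H _]; apply/negP => pE.
  by have := H p; rewrite mem_cat pE /= pu => /(_ isT).
have yE : {in y, forall p, p \notin E}.
  move=> p; rewrite mem_filter => /andP [_ pu]; move: un_lin.
  rewrite catA cat_uniq => /and3P [_ /hasPn H _]; apply/negP => pE.
  by have := H p pu; rewrite mem_cat pE orbT.
have chordE p : p \notin E -> chord g' p = chord g p.
  by move=> pE; rewrite /chord eq_gg'.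
have mapE (z : seq P) : {in z, forall p, p \notin E} -> map (chord g') z = map (chord g) z.
  by move=> zE; apply/eq_in_map => p pz; rewrite chordE // zE.
have [p0 p0E] : exists p, p \in E.
  by case: E sizeE r_gt0 => [|p e _ _]; [case: (r)|exists p; rewrite mem_head].
have revE : rev w = rev y ++ rev E ++ rev x by rewrite Ew' !rev_cat catA.
have revE' : rev w = d3 ++ rev c2 ++ rev b3 by rewrite /w !rev_cat revK catA.
have nthE i : (i < r.*2)%N -> nth p0 (rev w) (size y + i) = nth p0 (rev E) i.
  move=> lt_i; rewrite revE nth_cat size_rev ltnNge leq_addr /= addKn nth_cat.
  by rewrite size_rev sizeE lt_i.
have sizew : size w = (size b3 + size c2 + size d3)%N.
  by rewrite !size_cat size_rev addnA.
have sizew' : size w = (size x + r.*2 + size y)%N.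
  by rewrite Ew' !size_cat sizeE addnA.
have sd3 : size d3 = size b3 by rewrite size_map.
have low i : (i < r.*2)%N -> (size y + i < size b3)%N -> nth p0 (rev E) i \in below.
  move=> lt_i lt_n; rewrite -nthE // revE' nth_cat sd3 lt_n.
  by apply: (mem_subseq sd); rewrite mem_rev mem_nth ?sd3.
have high i : (i < r.*2)%N -> (size b3 + size c2 <= size y + i)%N ->
    nth p0 (rev E) i \in above.
  move=> lt_i le_n; rewrite -nthE // revE' nth_cat sd3 ltnNge.
  rewrite (leq_trans _ le_n) ?leq_addr //= nth_cat size_rev ltnNge.
  rewrite (_ : (size c2 <= _)%N) /=; last by lia.
  apply: (mem_subseq sb); rewrite -mem_rev mem_nth // size_rev.
  move: sizew lt_i le_n; rewrite sizew' sd3; move: (size x) (size y) (size b3) (size c2).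
  by clear; lia.
have inE_ i : (i < r.*2)%N -> nth p0 (rev E) i \in E.
  by move=> lt_i; rewrite -mem_rev mem_nth // size_rev sizeE.
have unE : uniq (rev E).
  by rewrite rev_uniq; move: un_lin; rewrite !cat_uniq => /and3P [_ _ /and3P []].
have pair_chord g0 i j : matching g0 -> (i < j < r.*2)%N ->
    chord g0 (nth p0 (rev E) i) = chord g0 (nth p0 (rev E) j) ->
    g0 (nth p0 (rev E) i) = nth p0 (rev E) j.
  move=> g0m /andP [ij lt_j] /eqP; rewrite eq_chord // => [/eqP //|].
  by rewrite nth_uniq ?size_rev ?sizeE ?(ltn_trans ij lt_j) // neq_ltn ij.
have sc2 : size a2 = size c2 by rewrite -fc2 size_map.
rewrite revE !map_cat mapE; last by move=> p; rewrite mem_rev; apply: a2E.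
rewrite [map (chord g') (rev y)]mapE; last by move=> p; rewrite mem_rev; apply: yE.
rewrite [map (chord g') (rev x)]mapE; last by move=> p; rewrite mem_rev; apply: xE.
rewrite par; set u := map _ (rev y); set t := map _ (rev x).
have apE g0 : matching g0 -> {in E, forall p, g0 p \in E} ->
    (forall p, p \notin E -> g0 p = g p) ->
    apart_words (map (chord g0) (rev E)) (u ++ t ++ map (chord g) (rev a2)).
  move=> g0m g0E eq0; rewrite /u /t -!map_cat; apply: chord_apart => //.
    by move=> p; rewrite mem_rev.
  by move=> p; rewrite !mem_cat !mem_rev => /or3P [/yE|/xE|/a2E].
apply: plucks_factor => //.
- exact: apE.
- apply: (apart_words_sub _ _ (apE g' gm' gE' eq_gg')) => // A As.
  by rewrite par mem_cat As.
- by rewrite size_map size_rev sizeE.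
(* A return outside the window would have both ends in [d3], hence below, or both in [b3], hence
   above. *)
- move=> k; rewrite (ret_nth (chord g p0)) size_map size_rev sizeE.
  case/andP => lt_k; rewrite !(nth_map p0) ?size_rev ?sizeE //; last exact: ltnW.
  move/eqP/(pair_chord _ _ _ gm).
  rewrite ltnSn lt_k => /(_ isT) Eg; have kE := inE_ _ (ltnW lt_k).
  have := gN kE; rewrite Eg /same; rewrite !size_map !size_rev sc2 sd3.
  case: (leqP (size b3) (size y + k.+1)) => [le1|lt1]; last first.
    have lt0 : (size y + k < size b3)%N by apply: leq_trans lt1; rewrite addnS ltnS ltnW.
    by rewrite !low ?orbT // ltnW.
  case: (leqP (size y + k.+1) (size b3 + size c2)) => [le2|lt2] //.
  have le0 : (size b3 + size c2 <= size y + k)%N by move: lt2; rewrite addnS ltnS.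
  by rewrite !high // ltnW.
(* The middle pair of the parallel family is an arc of [g'], so the same argument places it in the
   window. *)
- have lt_r : (r.-1 < r < r.*2)%N by clear -r_gt0; lia.
  have lt_r1 : (r.-1 < r.*2)%N by clear -r_gt0; lia.
  have lt_r2 : (r < r.*2)%N by clear -r_gt0; lia.
  have lt_r3 : (r.-1 < r)%N by clear -r_gt0; lia.
  have Eg : g' (nth p0 (rev E) r.-1) = nth p0 (rev E) r.
    apply: (pair_chord _ _ _ gm') => //.
    rewrite -!(nth_map p0 (chord g p0)) ?size_rev ?sizeE //.
    by rewrite par !nth_cat size_s ltnn subnn lt_r3 nth_rev size_s // subn1.
  have kE := inE_ _ lt_r1.
  have := gN' kE; rewrite Eg /same; rewrite !size_map !size_rev sc2 sd3.
  case: (leqP (size b3) (size y + r)) => [le1|lt1]; last first.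
    have lt0 : (size y + r.-1 < size b3)%N by rewrite (leq_ltn_trans _ lt1) // leq_add2l ltnW.
    by rewrite !low ?orbT.
  case: (leqP (size y + r) (size b3 + size c2)) => [le2|lt2] //.
  have le0 : (size b3 + size c2 <= size y + r.-1)%N.
    by move: lt2; rewrite -{1}(prednK r_gt0) addnS ltnS.
  by rewrite !high // ltnW.
Qed.

(** A half turn makes the bottom rows [a3] the first ones, and [rows_scale] removes them; a second
    half turn brings the top rows [c1] to the front, and what remains is [factor_mid]. *)
Lemma factor_ssum f : matching f ->
  map f c1 = a1 -> map f c2 = a2 -> map f c3 = a3 -> map f d = b ->
  let S := (c1 ++ c2 ++ c3) ++ d in
  uniq S -> outward f S -> (forall p, (p \in S) || (f p \in S)) ->
  ssum (cells (c1 ++ c2 ++ c3) d) (delta g) f =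
  pluck al be r (map (chord g) (rev E)) *
  ssum (cells (c1 ++ c2 ++ c3) d) (delta g') f.
Proof.
move=> fm f1 f2 f3 fd S unS outS tot; have [fK fN] := fm.
have J : outside same f S by move=> p /negbTE pS /negbTE fpS; have := tot p; rewrite pS fpS.
have fa1 : map f a1 = c1 by rewrite -f1 -map_comp map_id_in // => p _ /=.
have fa2 : map f a2 = c2 by rewrite -f2 -map_comp map_id_in // => p _ /=.
have fa3 : map f a3 = c3 by rewrite -f3 -map_comp map_id_in // => p _ /=.
have fb : map f b = d by rewrite -fd -map_comp map_id_in // => p _ /=.
have flip1 phi : ssum (cells (c1 ++ c2 ++ c3) d) phi f =
    ssum (cells (rev a3 ++ rev (a1 ++ a2)) (rev b)) phi f.
  by rewrite ssum_flip // !map_cat f1 f2 f3 fd -rev_cat catA.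
set S1 := (rev a3 ++ rev (a1 ++ a2)) ++ rev b.
have memS1 : map f S =i S1.
  move=> p; rewrite /S /S1 !map_cat f1 f2 f3 fd -rev_cat !(mem_cat, mem_rev).
  by rewrite -!orbA.
have unS1 : uniq S1.
  have -> : S1 = rev (b ++ map f (c1 ++ c2 ++ c3)).
    by rewrite rev_cat !map_cat f1 f2 f3 /S1 -rev_cat catA.
  rewrite rev_uniq uniq_catC -fd -map_cat map_inj_uniq //; exact: can_inj fK.
have samea p q : p \in above -> q \in above -> same p q by rewrite /same => -> ->.
have sameb p q : p \in below -> q \in below -> same p q by rewrite /same => -> ->; rewrite orbT.
rewrite !flip1; apply: (rows_scale al_be deE (sm := same) (ds0 := rev b) (Z := below)) => //.
- by rewrite !map_rev fa3 fb revK.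
- by move=> p q pb qb; apply: samea; rewrite /above !mem_cat -?(mem_rev b) ?pb ?qb orbT.
- move=> d1 h hm un1 out1 sd1 sb1 hE J1; have [hK hN] := hm.
  have hE' : map h (a1 ++ a2) = c1 ++ c2.
    have : rev (map h (a1 ++ a2)) = rev (c1 ++ c2).
      by rewrite -map_rev hE map_rev map_cat fa1 fa2.
    by move/(congr1 rev); rewrite !revK.
  have [ha1 ha2] : map h a1 = c1 /\ map h a2 = c2.
    move/eqP: hE'; rewrite map_cat eqseq_cat ?size_map -?f1 ?size_map //.
    by case/andP => /eqP -> /eqP ->.
  have hc1 : map h c1 = a1 by rewrite -ha1 -map_comp map_id_in // => p _ /=.
  have hc2 : map h c2 = a2 by rewrite -ha2 -map_comp map_id_in // => p _ /=.
  set d2 := rev (map h d1).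
  have hd2 : map h d2 = rev d1 by rewrite map_rev -map_comp map_id_in // => p _ /=.
  have flip2 phi : ssum (cells (rev (a1 ++ a2)) d1) phi h =
      ssum (cells (c1 ++ c2) d2) phi h.
    by rewrite ssum_flip // map_rev revK hE'.
  have memS2 : map h (rev (a1 ++ a2) ++ d1) =i (c1 ++ c2) ++ d2.
    by move=> p; rewrite map_cat map_rev hE' !(mem_cat, mem_rev).
  rewrite !flip2.
  apply: (rows_scale al_be deE (sm := same) (ds0 := d2) (Z := above)) => //.
  + rewrite hc1 hd2; apply: cat_subseq => //; apply: cat_subseq => //.
    by rewrite -[b]revK subseq_rev.
  + move=> p q; rewrite !mem_rev => pd qd.
    by apply: sameb; apply: (mem_subseq sb1).
  + move=> d3 h3 h3m un3 out3 sd3 sb3 h3E J3; apply: factor_mid => //.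
      by rewrite h3E.
    by apply: subseq_trans sb1; rewrite -[map h d1]revK subseq_rev.
  + rewrite -(eq_uniq _ memS2); first by rewrite map_inj_uniq //; apply: can_inj hK.
    by rewrite map_cat map_rev hE' !size_cat !size_rev size_cat.
  + by move=> p; rewrite -!memS2; apply: outward_map.
  + by apply: outside_eqi memS2 _; apply: outside_map.
- by move=> p; rewrite -!memS1; apply: outward_map.
- by apply: outside_eqi memS1 _; apply: outside_map.
Qed.

End Factor.

(** * Positivity at A = 1 *)

Section Reach.
Variable P : finType.
Implicit Types (f : {ffun P -> P}) (v w p q u : P) (c : P * P).
Implicit Types (us ds pre suf s : seq P) (cs : seq (P * P)).
Variable g : {ffun P -> P}.

Fixpoint reach cs f : Prop :=
  if cs is c :: cs' then
    reach cs' (swp c.1 c.2 f) \/ reach cs' (cup c.1 c.2 f)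
  else f = g.

(** Carries an alternative about the arc between [v] and [w] past crossings that avoid both
    lines. *)
Lemma reach_cat_cup cs cs1 cs2 v w : loopless cs -> v != w ->
  all (apart (v, w)) cs ->
  (forall f, matching f -> reach cs1 (cup v w f) ->
     reach cs2 (cup v w f) \/ reach cs1 f) ->
  forall f, matching f -> reach (cs ++ cs1) (cup v w f) ->
    reach (cs ++ cs2) (cup v w f) \/ reach (cs ++ cs1) f.
Proof.
move=> pcs vw acs H; elim: cs pcs acs => //= c cs IH /andP [pc pcs] /andP [ac acs] f fm.
have ac' : apart (c.1, c.2) (v, w) by rewrite apartC -surjective_pairing.
rewrite (swp_cup_apart f ac').
have [n1 n2 n3 n4] := and4P ac'.
rewrite (cup_cup pc vw n1 n2 n3 n4 fm).
case=> /IH [] //; try by [exact: swp_matching|exact: cup_matching].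
- by left; left.
- by right; left.
- by left; right.
- by right; right.
Qed.

(** Reachability does not by itself survive sliding an arc off. What replaces it is an alternative:
    a state that does not pull a line off the arc can be imitated from [f], where [v] and [w] have
    not been joined. *)
Lemma reach_arc us pre v w suf f : uniq (us ++ pre ++ v :: w :: suf) ->
  matching f -> reach (cells us (pre ++ v :: w :: suf)) (cup v w f) ->
  reach (cells us (pre ++ suf)) (cup v w f) \/
  reach (cells us (pre ++ v :: w :: suf)) f.
Proof.
elim: us f => [|u us IH] f un fm; first by left.
have un' : uniq (us ++ pre ++ v :: w :: suf) by case/andP: un.
have : u \notin pre ++ v :: w :: suf.
  by move: un; rewrite /= mem_cat negb_or -andbA => /and3P [].
rewrite mem_cat !inE !negb_or => /and4P [upre uv uw usuf].
have : uniq (pre ++ v :: w :: suf) by move: un'; rewrite cat_uniq => /and3P [].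
rewrite uniq_catC /= !(inE, mem_cat) !negb_or -!andbA.
case/and5P => vw vsuf vpre wsuf /andP [wpre _].
have ap s : u \notin s -> v \notin s -> w \notin s -> all (apart (v, w)) (line u s).
  move=> us_ vs ws; apply/allP => c /mem_line [c1 c2].
  rewrite /apart c1 /= ![_ == u]eq_sym uv uw /=; apply/andP; split.
    by apply: contraNneq vs => ->.
  by apply: contraNneq ws => ->.
rewrite !cells_cons !line_cat /= -/(line u suf) -!catA.
apply: reach_cat_cup => //; [exact: loopless_line|exact: ap|].
(* Three of the four ways to draw [u] over the arc of [cup v w f] lead to [Y], which also comes from
   [f] by markers +1 and -1. The fourth leaves [cup v w f], which equals [cup v w Y], so the rest
   can be treated with [Y] in place of [f]. *)
move=> {}f {}fm; set Y := cup u w (swp u v f).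
have EY : swp u v (cup v w f) = Y.
  rewrite swp_cup tpermR tpermD // eq_sym //.
have EY2 : cup v w Y = cup v w f by apply: cup_swp_cup.
have mY : matching Y by apply: cup_matching => //; apply: swp_matching.
have mX := cup_matching vw fm; have Xv : cup v w f v = w by rewrite cup_l.
rewrite /= (swp_swp_arc mX Xv uv uw) (cup_swp_arc mX Xv uv uw).
rewrite (swp_cup_arc mX Xv uv uw) (cup_cup_arc mX Xv uv uw) EY.
have right : reach (line u suf ++ cells us (pre ++ v :: w :: suf)) Y ->
    (reach (line u suf ++ cells us (pre ++ v :: w :: suf)) (swp u w (swp u v f)) \/
    reach (line u suf ++ cells us (pre ++ v :: w :: suf)) Y) \/
   (reach (line u suf ++ cells us (pre ++ v :: w :: suf)) (swp u w (cup u v f)) \/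
    reach (line u suf ++ cells us (pre ++ v :: w :: suf)) (cup u w (cup u v f))).
  by move=> ?; left; right.
case=> [[]|[|]] H; try by right; apply: right.
rewrite -EY2 in H *.
have [H1|H1] : reach (line u suf ++ cells us (pre ++ suf)) (cup v w Y) \/
  reach (line u suf ++ cells us (pre ++ v :: w :: suf)) Y.
- apply: reach_cat_cup H => //; [exact: loopless_line|exact: ap|].
  by move=> f' f'm; apply: IH.
- by left.
- by right; apply: right.
Qed.

Local Notation ssum := (ssum (1 : int) 1 (- 2)).
Local Notation delta := (fun f => (f == g)%:R : int).
Local Notation sweep u us :=
  (sweep (1 : int) 1 u (fun ds f => ssum (cells us ds) delta f)).

(** With [w] pending, a state leading to [g] need not survive the removal of arcs. It then yields
    another state with marker +1 at [w], a choice that the sum at the previous crossing also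
    contains; this is the second alternative. *)
Lemma sweep_pos u us :
  (forall ds f, matching f -> uniq (us ++ ds) -> outward f (us ++ ds) ->
    0 <= ssum (cells us ds) delta f /\
    (reach (cells us ds) f -> 0 < ssum (cells us ds) delta f)) ->
  forall ds,
  (forall pre f, sweepable u us None pre ds f ->
     0 <= sweep u us None pre ds f /\
     (reach (line u ds ++ cells us (pre ++ ds)) f ->
      0 < sweep u us None pre ds f)) /\
  (forall w pre f, sweepable u us (Some w) pre ds (cup u w f) -> matching f ->
     0 <= sweep u us (Some w) pre ds (cup u w f) /\
     (reach (line u ds ++ cells us (pre ++ w :: ds)) (cup u w f) ->
      0 < sweep u us (Some w) pre ds (cup u w f) \/
      reach (line u ds ++ cells us (pre ++ w :: ds)) (swp u w f))).
Proof.
move=> H; elim=> [|v ds [IH1 IH2]].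
  split=> [pre f sw|w pre f sw fm0].
    have [fm un out] := sw; rewrite !cats0 in un out *; apply: H => //.
      by case/andP: un.
    by move=> x xs; have := out x; rewrite !inE xs orbT => /(_ isT) /norP [].
  have [fm un [fu out]] := sw; rewrite !cats0 in un out; have [fK fN] := fm.
  move: un; rewrite cons_uniq /= => /andP [uN un].
  have fw : cup u w f w = u by rewrite -{2}[u]fK fu.
  have outw : outward (cup u w f) (us ++ rcons pre w).
    move=> x; rewrite -rcons_cat mem_rcons inE => /predU1P [->|xs].
      by rewrite fw rcons_cat.
    rewrite mem_rcons inE negb_or out // andbT.
    apply: contraNneq uN => E.
    have <- : x = u by rewrite -[LHS]fK E.
    rewrite mem_cat mem_rcons inE.
    by move: xs; rewrite mem_cat => /orP [] ->; rewrite ?orbT.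
  have [p q] := H (rcons pre w) _ fm un outw.
  by split=> //; rewrite cats1 => rc; left; apply: q.
have swE pend pre f : sweepable u us pend pre (v :: ds) f ->
  sweep u us pend pre (v :: ds) f =
  sweep u us None (after_swp pend pre v) ds (swp u v f) +
  sweep u us (Some v) (flush pend pre) ds (cup u v f).
  by move=> _; rewrite /= !mul1r.
split=> [pre f sw|w pre f sw fm0].
  have sw1 := sweepable_swp sw; have sw2 := sweepable_cup sw.
  have [fm _ _] := sw.
  have [p1 q1] := IH1 _ _ sw1; have [p2 q2] := IH2 _ _ _ sw2 fm.
  rewrite swE //; split; first exact: addr_ge0.
  rewrite cat_rcons in q1 q2.
  case=> [/q1 lt|/q2 [lt|/q1 lt]].
  - exact: ltr_wpDr.
  - exact: ltr_wpDl.
  - exact: ltr_wpDr.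
have sw1 := sweepable_swp sw; have sw2 := sweepable_cup sw.
have [fm un [fu out]] := sw.
have [p1 q1] := IH1 _ _ sw1; have [p2 q2] := IH2 _ _ _ sw2 fm.
rewrite swE //; split; first exact: addr_ge0.
have uF : uniq (us ++ pre ++ w :: v :: ds).
  by move: un; rewrite cons_uniq /= cat_rcons => /andP [].
have wv : w != v.
  move: uF; rewrite catA cat_uniq => /and3P [_ _].
  by rewrite cons_uniq inE negb_or => /andP [/andP []].
have uds : u \notin ds.
  by move: un; rewrite cons_uniq !(mem_cat, inE) !negb_or => /andP [/and4P []].
have [wds vds] : w \notin ds /\ v \notin ds.
  move: uF; rewrite catA cat_uniq => /and3P [_ _].
  by rewrite !cons_uniq inE negb_or => /and3P [/andP [_ ->] ->].
have [uw uv] : u != w /\ u != v.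
  by move: un; rewrite cons_uniq !(mem_cat, mem_rcons, inE) !negb_or; case/andP=> /and4P [_ /andP []].
set Y := swp u v (swp u w f).
have mY : matching Y by do 2!apply: swp_matching.
have EY : swp u v (cup u w f) = cup w v Y.
  have -> : cup u w f = cup u w (swp u w f).
    rewrite -[LHS](swp_id (h := u) (v := w) fm) // swp_cup tpermL tpermR cupC //.
      by rewrite eq_sym.
    exact: swp_matching.
  have vw : v != w by rewrite eq_sym.
  by rewrite swp_cup tpermL tpermD // -/Y cupC.
(* Marker +1 at [v] after -1 at [w] gives [cup w v Y], where [Y] is the result of +1 at both. Either
   the arc slides off, and the swept sum is positive, or [Y] itself leads to [g]. *)
have swapcase : reach (line u ds ++ cells us (pre ++ w :: v :: ds)) (swp u v (cup u w f)) ->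
  0 < sweep u us None (after_swp (Some w) pre v) ds (swp u v (cup u w f)) +
      sweep u us (Some v) (flush (Some w) pre) ds (cup u v (cup u w f)) \/
  reach (line u (v :: ds) ++ cells us (pre ++ w :: v :: ds)) (swp u w f).
  rewrite EY => rc.
  have [_ un1 _] := sw1.
  have [H1|H1] : reach (line u ds ++ cells us (pre ++ ds)) (cup w v Y) \/
    reach (line u ds ++ cells us (pre ++ w :: v :: ds)) Y.
  + apply: reach_cat_cup rc => //.
    * exact: loopless_line.
    * apply/allP => c /mem_line [c1 c2].
      rewrite /apart c1 /= ![_ == u]eq_sym uw uv /=; apply/andP; split.
        by apply: contraNneq wds => ->.
      by apply: contraNneq vds => ->.
    * by move=> f' f'm; apply: reach_arc.
  + by left; apply: ltr_wpDr => //; rewrite -EY; apply: q1; rewrite EY.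
  + by right; left.
rewrite cat_rcons in q2.
case=> [/swapcase //|/q2 [lt|/swapcase //]].
by left; apply: ltr_wpDl.
Qed.

Lemma ssum_pos us ds f : matching f -> uniq (us ++ ds) -> outward f (us ++ ds) ->
  0 <= ssum (cells us ds) delta f /\
  (reach (cells us ds) f -> 0 < ssum (cells us ds) delta f).
Proof.
elim: us ds f => [|u us IH] ds f fm un out.
  by split=> [|->]; rewrite /= ?ler0n ?eqxx.
have al_be : (1 : int) * 1 = 1 by [].
have [+ _] := @sweep_pos u us IH ds; move=> /(_ [::] f).
rewrite (@ssum_cells_sweep _ int 1 1 (- 2) al_be (erefl _) u us ds _ f fm un out).
by apply.
Qed.

End Reach.

(** * Kauffman states and the state sum *)

Section States.
Variables (P I : finType) (ports : I -> P * P).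
Implicit Types (f : {ffun P -> P}) (s : {ffun I -> bool}) (x y : I) (xs : seq I).

Definition smooth (b : bool) x f : {ffun P -> P} :=
  if b then swp (ports x).1 (ports x).2 f else cup (ports x).1 (ports x).2 f.

Definition resolve s xs f := foldl (fun f x => smooth (s x) x f) f xs.

Fixpoint nloops s xs f : nat :=
  if xs is x :: xs' then
    (~~ s x && (f (ports x).1 == (ports x).2)) + nloops s xs' (smooth (s x) x f)
  else 0.

Lemma eq_resolve s s' xs f : {in xs, s =1 s'} -> resolve s xs f = resolve s' xs f.
Proof.
elim: xs f => //= x xs IH f E; rewrite -E ?mem_head // IH // => y ys.
by rewrite E // inE ys orbT.
Qed.

Lemma eq_nloops s s' xs f : {in xs, s =1 s'} -> nloops s xs f = nloops s' xs f.
Proof.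
elim: xs f => //= x xs IH f E; rewrite -E ?mem_head // IH // => y ys.
by rewrite E // inE ys orbT.
Qed.

Lemma reach_resolve g s xs f : resolve s xs f = g -> reach g (map ports xs) f.
Proof.
elim: xs f => //= x xs IH f /IH; rewrite /smooth.
by case: (s x); [left|right].
Qed.

Variables (R : comNzRingType) (al be de : R).

(** States are functions on all crossings; setting the markers off [xs] to -1 makes every choice on
    [xs] count once. *)
Lemma ssum_states xs phi f : uniq xs ->
  ssum al be de (map ports xs) phi f =
  \sum_(s : {ffun I -> bool} | [forall y, (y \notin xs) ==> ~~ s y])
    \prod_(x <- xs) (if s x then al else be) * de ^+ nloops s xs f *
    phi (resolve s xs f).
Proof.
elim: xs f => [|x xs IH] f /=.
  move=> _; rewrite (big_pred1 [ffun=> false]).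
    by rewrite big_nil expr0 !mul1r.
  move=> s /=; apply/forallP/eqP => [H|-> y]; last by rewrite ffunE.
  by apply/ffunP => y; rewrite ffunE; have := H y; case: (s y).
case/andP => xN un; rewrite (bigID (fun s => s x)) /=.
pose set_x b s := [ffun y => if y == x then b else s y] : {ffun I -> bool}.
have setE b s : {in xs, set_x b s =1 s}.
  by move=> y ys; rewrite ffunE; case: eqP => // E; rewrite -E ys in xN.
have set_xx b s : set_x b s x = b by rewrite ffunE eqxx.
have predF s : [forall y, (y \notin x :: xs) ==> ~~ s y] && ~~ s x =
    [forall y, (y \notin xs) ==> ~~ s y].
  apply/andP/forallP => [[/forallP H sx] y|H].
    have := H y; rewrite inE negb_or; case: eqP => [->|_] //=; first by rewrite sx implybT.
  split; last by have := H x; rewrite xN.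
  apply/forallP => y; rewrite inE negb_or; have := H y.
  by case: (y \in xs) => /= [_|->]; rewrite ?andbF ?implybT.
have prodE b s : \prod_(y <- xs) (if set_x b s y then al else be) =
    \prod_(y <- xs) (if s y then al else be).
  by rewrite big_seq [RHS]big_seq; apply: eq_bigr => y ys; rewrite setE.
rewrite [crossing _ _ _ _ _ _]/crossing; congr (_ + _).
  rewrite IH // big_distrr /= [RHS](reindex_onto (set_x true) (set_x false)) /=.
    apply: eq_big => s.
      rewrite set_xx andbT; apply/idP/andP => [/forallP H|[/forallP H /eqP E]].
        split.
          apply/forallP => y; rewrite inE negb_or ffunE; case: eqP => //= _; exact: H.
        apply/eqP/ffunP => y; rewrite !ffunE; case: eqP => // ->.
        by have := H x; rewrite xN => /negbTE ->.
      apply/forallP => y; rewrite -E ffunE; case: eqP => //; first by rewrite implybT.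
      move=> yx; have := H y; rewrite inE negb_or ffunE; case: eqP => //.
    move=> _; rewrite big_cons set_xx prodE /smooth /=.
    by rewrite (eq_nloops _ (setE _ _)) (eq_resolve _ (setE _ _)) add0n !mulrA.
  move=> s /andP [_ sx]; apply/ffunP => y; rewrite !ffunE; case: eqP => // ->.
  by rewrite sx.
rewrite IH // big_distrr /=; apply: eq_big => [s|s /forallP H]; first by rewrite predF.
have sx : s x = false by have := H x; rewrite xN => /negbTE.
rewrite big_cons sx /= exprD /loop.
by case: eqP => _; rewrite /= ?expr1 ?expr0; ring.
Qed.

End States.

(** * Tracing strands and components through the grid *)

Section Grid.
Variables (m n : nat).
Local Notation P := (bpoint m n).
Local Notation S := (segment m n).
Implicit Types (f : {ffun P -> P}) (s : kauffman m n) (x y : 'I_m * 'I_n).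
Implicit Types (xs : seq ('I_m * 'I_n)) (lab : S -> S) (cur : {ffun P -> S}).

Definition crossing_ports x : P * P := (Rgt x.1, Bot x.2).
Local Notation smooth := (smooth crossing_ports).
Local Notation resolve := (resolve crossing_ports).
Local Notation nloops := (nloops crossing_ports).

(* The components of the part of the diagram drawn so far are the fibers of
   [lab]; smoothing a crossing glues two pairs of them. *)
Definition glue lab (a b z : S) : S := if lab z == lab a then lab b else lab z.

Definition glue_smooth (b : bool) x lab : S -> S :=
  if b then glue (glue lab (right_half x) (top_half x)) (bottom_half x) (left_half x)
  else glue (glue lab (bottom_half x) (right_half x)) (top_half x) (left_half x).

Definition labels s xs lab := foldl (fun lab x => glue_smooth (s x) x lab) lab xs.

(* [cur p] is the segment at which the strand of the port [p] currently ends. *)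
Definition advance x cur : {ffun P -> S} :=
  [ffun p => if p == Rgt x.1 then right_half x
             else if p == Bot x.2 then bottom_half x else cur p].

Fixpoint drawable xs cur : Prop :=
  if xs is x :: xs' then
    [/\ cur (Rgt x.1) = left_half x, cur (Bot x.2) = top_half x &
        drawable xs' (advance x cur)]
  else True.

Definition fresh xs (z : S) :=
  (z \in map (@right_half m n) xs) || (z \in map (@bottom_half m n) xs).

Lemma right_half_inj : injective (@right_half m n).
Proof. by case=> [j i] [j' i'] [-> /= E]; congr (_, _); apply/val_inj. Qed.

Lemma bottom_half_inj : injective (@bottom_half m n).
Proof. by case=> [j i] [j' i'] [-> /= E]; congr (_, _); apply/val_inj. Qed.

(** The invariant linking the matching of the ports to the components of the segments, while the
    segments not yet reached are still components by themselves. *)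
Definition traced xs f lab cur :=
  [/\ matching f,
      forall p q, p != q -> (f p == q) = (lab (cur p) == lab (cur q)),
      forall z z', fresh xs z -> lab z' = lab z -> z' = z &
      forall p, ~~ fresh xs (cur p)].

Definition isolated lab (a : S) := forall z, (lab z == lab a) = (z == a).

Lemma glue_true lab r b t l : isolated lab r -> isolated lab b -> r != b ->
  t != b -> l != r ->
  glue (glue lab r t) b l =1 (fun z =>
    if z == r then lab t else if z == b then lab l else lab z).
Proof.
move=> nr nb rb tb lr z; rewrite /glue !nr (negbTE lr) [b == r]eq_sym (negbTE rb).
by case: (z == r); rewrite nb ?(negbTE tb).
Qed.

Lemma glue_false lab r b t l : isolated lab r -> isolated lab b ->
  t != r -> t != b -> l != b ->
  glue (glue lab b r) t l =1 (fun z =>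
    if z == b then lab r else if lab z == lab t then lab l else lab z).
Proof.
move=> nr nb tr tb lb z; rewrite /glue !nb (negbTE tb) (negbTE lb).
by case: (z == b); rewrite // [lab r == _]eq_sym nr (negbTE tr).
Qed.

(** Gluing two pairs of classes removes two classes. The exception is marker -1 at a crossing whose
    left and top halves are already connected: this closes a component and only the other pair is
    merged. *)
Lemma traced_step s x xs f lab cur : uniq (x :: xs) ->
  cur (Rgt x.1) = left_half x -> cur (Bot x.2) = top_half x ->
  traced (x :: xs) f lab cur ->
  traced xs (smooth (s x) x f) (glue_smooth (s x) x lab) (advance x cur) /\
  (#|glue_smooth (s x) x lab @: [set: S]| + 2 = #|lab @: [set: S]| +
    (~~ s x && (f (Rgt x.1) == Bot x.2)))%N.
Proof.
case/andP => xN un Eh Ev [fm La Lf Lc].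
set h : P := Rgt x.1; set v : P := Bot x.2.
have hv : h != v by [].
set r := right_half x; set bt := bottom_half x.
set lh := left_half x in Eh *; set th := top_half x in Ev *.
have fr : fresh (x :: xs) r by rewrite /fresh inE eqxx.
have fb : fresh (x :: xs) bt by rewrite /fresh !inE eqxx orbT.
have rb : r != bt by [].
have fsub z : fresh xs z -> [/\ fresh (x :: xs) z, z != r & z != bt].
  rewrite /fresh !inE => /orP [] zx; rewrite zx ?orbT; split=> //.
  - by apply: contraNneq xN => E; move: zx; rewrite E mem_map //; apply: right_half_inj.
  - by case/mapP: zx => y _ ->.
  - by case/mapP: zx => y _ ->.
  - by apply: contraNneq xN => E; move: zx; rewrite E mem_map //; apply: bottom_half_inj.
have lhr : lh != r by rewrite -Eh; apply: contraNneq (Lc h) => ->.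
have lhb : lh != bt by rewrite -Eh; apply: contraNneq (Lc h) => ->.
have thr : th != r by rewrite -Ev; apply: contraNneq (Lc v) => ->.
have thb : th != bt by rewrite -Ev; apply: contraNneq (Lc v) => ->.
have curN p : cur p != r /\ cur p != bt.
  by split; apply: contraNneq (Lc p) => ->.
have nr : isolated lab r by move=> z; apply/eqP/eqP => [/(Lf _ _ fr)|->].
have nb : isolated lab bt by move=> z; apply/eqP/eqP => [/(Lf _ _ fb)|->].
have [fK fN] := fm.
have i1 : lab bt \in lab @: [set: S] by rewrite imset_f.
have fresh_adv p : ~~ fresh xs (advance x cur p).
  rewrite ffunE; apply/negP; case: eqP => [_ /fsub [_]|_]; first by rewrite eqxx.
  case: eqP => [_ /fsub [_ _]|_ /fsub []]; first by rewrite eqxx.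
  by rewrite (negbTE (Lc p)).
case sx : (s x); rewrite /glue_smooth /smooth /=.
- set lab2 := glue _ _ _.
  have labE : lab2 =1 (fun z => if z == r then lab th else if z == bt then lab lh else lab z).
    exact: glue_true.
  have lab2o z : z != r -> z != bt -> lab2 z = lab z.
    by move=> /negbTE zr /negbTE zb; rewrite labE zr zb.
  have lab2r : lab2 r = lab th by rewrite labE eqxx.
  have lab2b : lab2 bt = lab lh by rewrite labE eq_sym (negbTE rb) eqxx.
  have lcur p : lab2 (advance x cur p) = lab (cur (tperm h v p)).
    rewrite ffunE -/h -/v; case: (eqVneq p h) => [->|ph].
      by rewrite tpermL Ev lab2r.
    case: (eqVneq p v) => [->|pv]; first by rewrite tpermR Eh lab2b.
    by rewrite tpermD 1?eq_sym // lab2o; case: (curN p).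
  split; last first.
    rewrite addn0; have -> : lab2 @: [set: S] = (lab @: [set: S]) :\ lab bt :\ lab r.
      apply/setP => a; rewrite !inE; apply/imsetP/and3P.
        case=> z _ ->; have [->|zr] := eqVneq z r.
          by rewrite lab2r nb nr thr thb imset_f.
        have [->|zb] := eqVneq z bt; first by rewrite lab2b nb nr lhr lhb imset_f.
        by rewrite lab2o // nb nr zr zb imset_f.
      case=> ar ab /imsetP [z _ Ea]; rewrite Ea nb in ab; rewrite Ea nr in ar.
      by exists z => //; rewrite lab2o.
    have i2 : lab r \in (lab @: [set: S]) :\ lab bt by rewrite !inE nb rb imset_f.
    rewrite [#|lab @: [set: S]|](cardsD1 (lab bt)) i1.
    by rewrite [X in (_ = _ + X)%N](cardsD1 (lab r)) i2 !add1n addn2.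
  split=> //.
  + exact: swp_matching.
  + move=> p q pq; rewrite !lcur -La ?(inj_eq perm_inj) // ffunE.
    by rewrite -(inj_eq (@perm_inj _ (tperm h v))) tpermK.
  + move=> z z' /fsub [fz zr zb]; rewrite (lab2o z) // labE.
    case: eqP => [_ E|_]; first by have := Lf _ _ fz E => E'; move: fz; rewrite -E' -Ev (negbTE (Lc _)).
    case: eqP => [_ E|_]; last exact: Lf.
    by have := Lf _ _ fz E => E'; move: fz; rewrite -E' -Eh (negbTE (Lc _)).
- set lab2 := glue _ _ _.
  have labE : lab2 =1 (fun z => if z == bt then lab r else if lab z == lab th then lab lh else lab z).
    exact: glue_false.
  have lab2b : lab2 bt = lab r by rewrite labE eqxx.
  have lab2r : lab2 r = lab r by rewrite labE (negbTE rb) [_ == lab th]eq_sym nr (negbTE thr).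
  have lcur p : p != h -> p != v ->
      lab2 (advance x cur p) = lab (cur (if f v == p then h else p)).
    move=> ph pv; rewrite ffunE -/h -/v (negbTE ph) (negbTE pv) labE.
    have [_ /negbTE ->] := curN p; rewrite -Ev [_ == lab (cur v)]eq_sym -La 1?eq_sym //.
    by rewrite [p == _]eq_sym; case: ifP => //; rewrite Eh.
  have lcurhv p : (p == h) || (p == v) -> lab2 (advance x cur p) = lab r.
    by rewrite ffunE -/h -/v; case/orP => /eqP ->; rewrite ?eqxx.
  have lcurN p : p != h -> p != v -> (lab2 (advance x cur p) == lab r) = false.
    by move=> ph pv; rewrite lcur // nr; case: (curN (if f v == p then h else p)) => /negbTE.
  have mc := cup_matching hv fm; have [cK cN] := mc.
  split; last first.
    have lhth : (lab lh == lab th) = (f h == v) by rewrite -Eh -Ev La.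
    have imE : lab2 @: [set: S] = if lab lh == lab th then (lab @: [set: S]) :\ lab bt
        else (lab @: [set: S]) :\ lab bt :\ lab th.
      apply/setP => a; apply/imsetP/idP => [[z _ ->]|].
        have [->|zb] := eqVneq z bt.
          have rt : lab r != lab th by rewrite eq_sym nr.
          by rewrite lab2b; case: ifP => _; rewrite !inE ?rt nb rb imset_f.
        rewrite labE (negbTE zb); case: (eqVneq (lab z) (lab th)) => [Ez|Nz].
          case: (boolP (lab lh == lab th)) => ll; first by rewrite !inE nb lhb imset_f.
          by rewrite !inE ll nb lhb imset_f.
        by case: ifP => _; rewrite !inE ?Nz nb zb imset_f.
      have [ll|ll] := eqVneq (lab lh) (lab th).
        rewrite !inE => /andP [ab /imsetP [z _ Ea]]; exists z => //.
        rewrite Ea nb in ab; rewrite labE (negbTE ab).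
        by case: eqP => // E; rewrite Ea E.
      rewrite !inE => /and3P [at_ ab /imsetP [z _ Ea]]; exists z => //.
      by rewrite Ea nb in ab; rewrite labE (negbTE ab) -Ea (negbTE at_).
    rewrite /= -/h -/v -lhth imE [#|lab @: [set: S]|](cardsD1 (lab bt)) i1.
    case: eqP => _; first by rewrite add1n addn1 addn2.
    have i2 : lab th \in (lab @: [set: S]) :\ lab bt by rewrite !inE nb thb imset_f.
    by rewrite [X in (_ = _ + X + _)%N](cardsD1 (lab th)) i2 !add1n addn2 addn0.
  have half p q : p != q -> p != h -> p != v ->
      (cup h v f p == q) = (lab2 (advance x cur p) == lab2 (advance x cur q)).
    move=> pq ph pv; rewrite lcur //.
    have [qhv|] := boolP ((q == h) || (q == v)).
      rewrite (lcurhv _ qhv) nr; case: (curN (if f v == p then h else p)) => /negbTE -> _.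
      apply/negP => /eqP E; have Ep : p = cup h v f q by rewrite -E cK.
      case/orP: qhv Ep => /eqP -> Ep; first by rewrite Ep cup_l eqxx in pv.
      by rewrite Ep cup_r ?eqxx in ph.
    rewrite negb_or => /andP [qh qv]; rewrite lcur // ffunE (negbTE ph) (negbTE pv).
    have [Efh|Nfh] := eqVneq (f h) v.
      have fv : f v = h by rewrite -Efh fK.
      rewrite fv ![h == _]eq_sym (negbTE ph) (negbTE qh) Efh (negbTE pv).
      by rewrite La.
    have [Ep|Nvp] := eqVneq (f v) p.
      rewrite -Ep in pq *; rewrite (inj_eq (can_inj fK)) [v == h]eq_sym (negbTE hv).
      by rewrite ?eqxx (negbTE pq) La // eq_sym.
    have [<-|Nvq] := eqVneq (f v) q.
      rewrite -La //; have [->|Nph] := eqVneq p (f h); first by rewrite fK !eqxx.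
      rewrite (inj_eq (can_inj fK)) (negbTE pv); apply/esym/negbTE.
      by apply: contraNneq Nph => <-; rewrite fK.
    rewrite -La //; have [->|//] := eqVneq p (f h).
    by rewrite fK (negbTE Nvq) eq_sym (negbTE qh).
  split=> //.
  + move=> p q pq.
    have [phv|] := boolP ((p == h) || (p == v)); last first.
      by rewrite negb_or => /andP [ph pv]; apply: half.
    have [qhv|] := boolP ((q == h) || (q == v)); last first.
      rewrite negb_or => /andP [qh qv]; rewrite [RHS]eq_sym -(half q p) //; last by rewrite eq_sym.
      by apply/eqP/eqP => [<-|<-]; rewrite cK.
    rewrite !lcurhv // eqxx; apply/eqP.
    case/orP: phv pq => /eqP ->; case/orP: qhv => /eqP ->; rewrite ?eqxx // => _.
      exact: cup_l.
    exact: cup_r.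
  + move=> z z' /fsub [fz zr zb].
    have zth : (lab z == lab th) = false.
      apply/negP => /eqP E; have E' := Lf _ _ fz (esym E).
      by move: fz; rewrite -E' -Ev (negbTE (Lc _)).
    rewrite !labE (negbTE zb) zth; case: eqP => [_ E|_].
      by have := nr z; rewrite E eqxx (negbTE zr).
    case: eqP => [_ E|_]; last exact: Lf.
    by have := Lf _ _ fz E => E'; move: fz; rewrite -E' -Eh (negbTE (Lc _)).
Qed.

End Grid.

Section Bridge.
Variables (m n : nat).
Local Notation P := (bpoint m n).
Local Notation S := (segment m n).
Implicit Types (f : {ffun P -> P}) (s : kauffman m n) (x y : 'I_m * 'I_n).
Implicit Types (xs : seq ('I_m * 'I_n)) (lab : S -> S) (cur : {ffun P -> S}).
Local Notation resolve := (resolve (@crossing_ports m n)).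
Local Notation nloops := (nloops (@crossing_ports m n)).

Lemma traced_run s xs f lab cur : uniq xs -> drawable xs cur ->
  traced xs f lab cur ->
  traced [::] (resolve s xs f) (labels s xs lab)
    (foldl (fun cur x => advance x cur) cur xs) /\
  (#|labels s xs lab @: [set: S]| + 2 * size xs =
    #|lab @: [set: S]| + nloops s xs f)%N.
Proof.
elim: xs f lab cur => [|x xs IH] f lab cur; first by rewrite muln0 addn0.
move=> un [Eh Ev dr] tr; have [tr1 c1] := traced_step s un Eh Ev tr.
have un' : uniq xs by case/andP: un.
have [tr2 c2] := IH _ _ _ un' dr tr1; split=> //=.
have e : (#|glue_smooth (s x) x lab @: [set: S]| + 2 + nloops s xs
   (smooth (@crossing_ports m n) (s x) x f) =
   #|lab @: [set: S]| + (~~ s x && (f (Rgt x.1) == Bot x.2)) +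
   nloops s xs (smooth (@crossing_ports m n) (s x) x f))%N by rewrite c1.
rewrite addnA -e mulnS addnCA c2 addnC -!addnA; congr (_ + _)%N.
by rewrite addnC.
Qed.

Lemma glue_eq lab a b z z' : lab z = lab z' -> glue lab a b z = glue lab a b z'.
Proof. by rewrite /glue => ->. Qed.

Lemma glue_edge lab a b : glue lab a b a = glue lab a b b.
Proof. by rewrite /glue eqxx; case: eqP. Qed.

Lemma glue_smooth_eq c x lab z z' : lab z = lab z' ->
  glue_smooth c x lab z = glue_smooth c x lab z'.
Proof. by move=> E; rewrite /glue_smooth; case: c; do 2!apply: glue_eq. Qed.

Lemma labels_eq s xs lab z z' : lab z = lab z' ->
  labels s xs lab z = labels s xs lab z'.
Proof. by elim: xs lab => //= x xs IH lab E; apply/IH/glue_smooth_eq. Qed.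

Lemma labels_edge s xs lab x u v : x \in xs -> [set u; v] \in smoothing s x ->
  labels s xs lab u = labels s xs lab v.
Proof.
have pair (L : S -> S) a b : L a = L b -> [set u; v] = [set a; b] -> L u = L v.
  move=> E ab; have : u \in [set a; b] by rewrite -ab !inE eqxx.
  have : v \in [set a; b] by rewrite -ab !inE eqxx orbT.
  by rewrite !inE => /orP [] /eqP -> /orP [] /eqP ->.
elim: xs lab => //= y xs IH lab; rewrite inE => /predU1P [<- uv|xxs]; last exact: IH.
apply: labels_eq; move: uv; rewrite /smoothing /glue_smooth.
case: (s x); rewrite !inE => /orP [] /eqP.
- apply: pair; apply: glue_eq; apply/esym; exact: glue_edge.
- by apply: pair; apply/esym; apply: glue_edge.
- by apply: pair; apply: glue_edge.
- by apply: pair; apply: glue_eq; apply: glue_edge.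
Qed.

Lemma joined_sym s : symmetric (joined s).
Proof.
apply: sym_connect_sym => u v.
by apply: eq_existsb => c; rewrite setUC.
Qed.

Lemma joined_edge s x u v : [set u; v] \in smoothing s x -> joined s u v.
Proof. by move=> uv; apply: connect1; apply/existsP; exists x. Qed.

Lemma glue_joined s lab a b : joined s a b ->
  (forall z z', lab z = lab z' -> joined s z z') ->
  forall z z', glue lab a b z = glue lab a b z' -> joined s z z'.
Proof.
move=> ab H z z'; rewrite /glue.
have js z1 z2 : joined s z1 z2 -> joined s z2 z1 by rewrite joined_sym.
have jt : transitive (joined s) by apply: connect_trans.
case: eqP => [/H za|_]; case: eqP => [/H za'|_].
- by move=> _; apply: (jt a); rewrite // js.
- by move/H => bz; apply: (jt a) => //; apply: (jt b).
- by move/H => zb; apply: (jt b) => //; apply: (jt a); apply: js.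
- exact: H.
Qed.

Lemma labels_joined s xs lab : (forall z z', lab z = lab z' -> joined s z z') ->
  forall z z', labels s xs lab z = labels s xs lab z' -> joined s z z'.
Proof.
elim: xs lab => //= x xs IH lab H; apply: IH; rewrite /glue_smooth.
case sx : (s x); (apply: glue_joined; last apply: glue_joined => //).
- by rewrite joined_sym; apply: (@joined_edge s x); rewrite /smoothing sx !inE eqxx orbT.
- by rewrite joined_sym; apply: (@joined_edge s x); rewrite /smoothing sx !inE eqxx.
- by apply: (@joined_edge s x); rewrite /smoothing sx !inE eqxx.
- by apply: (@joined_edge s x); rewrite /smoothing sx !inE eqxx orbT.
Qed.

Lemma joinedE s xs : (forall x, x \in xs) -> forall z z',
  joined s z z' = (labels s xs id z == labels s xs id z').
Proof.
move=> xsT z z'; apply/idP/eqP => [|E]; last first.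
  by apply: (labels_joined (lab := id)) E => ? ? ->; apply: connect0.
case/connectP => p; elim: p z => [|y p IH] z /=; first by move=> _ ->.
case/andP => /existsP [x zy] yp /(IH _ yp) <-.
exact: labels_edge zy.
Qed.

End Bridge.

Section Draw.
Variables (m n : nat).
Local Notation P := (bpoint m n).
Local Notation S := (segment m n).
Implicit Types (f : {ffun P -> P}) (s : kauffman m n) (x y : 'I_m * 'I_n).
Local Notation resolve := (resolve (@crossing_ports m n)).
Local Notation nloops := (nloops (@crossing_ports m n)).

Definition crossings : seq ('I_m * 'I_n) :=
  [seq (j, i) | j <- enum 'I_m, i <- enum 'I_n].

Definition rights : seq P := [seq Rgt j | j <- enum 'I_m].
Definition bottoms : seq P := [seq Bot i | i <- enum 'I_n].

(* The diagram of m horizontal and n vertical lines before any crossing. *)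
Definition straight : {ffun P -> P} := [ffun p => match p with
  | Top i => Bot i | Bot i => Top i | Lft j => Rgt j | Rgt j => Lft j end].

Lemma cells_crossings :
  cells rights bottoms = map (@crossing_ports m n) crossings.
Proof. by rewrite /crossings map_allpairs /cells allpairs_mapl allpairs_mapr. Qed.

Lemma mem_crossings x : x \in crossings.
Proof. by case: x => j i; apply/allpairsP; exists (j, i); rewrite !mem_enum. Qed.

Lemma crossings_uniq : uniq crossings.
Proof. by apply: allpairs_uniq; rewrite ?enum_uniq // => -[? ?] [? ?]. Qed.

Lemma size_crossings : size crossings = (m * n)%N.
Proof. by rewrite size_allpairs !size_enum_ord. Qed.

Lemma straight_matching : matching straight.
Proof.
by split=> p; rewrite !ffunE; case: p => i; rewrite ?ffunE //; apply/eqP.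
Qed.

(* The pen after [j] rows and [i] crossings of the next one. *)
Definition pen (j i : nat) : {ffun P -> S} := [ffun p => match p with
  | Top i' => inl (i', ord0)
  | Lft j' => inr (j', ord0)
  | Rgt j' => inr (j', inord (if (j' < j)%N then n else if j' == j :> nat then i else 0))
  | Bot i' => inl (i', inord (if (i' < i)%N then j.+1 else j))
  end].

Lemma inord_val k (i : 'I_k.+1) t : i = t :> nat -> inord t = i.
Proof. by move=> E; apply: val_inj; rewrite /= inordK -E. Qed.

Lemma advance_pen (j : 'I_m) (i : 'I_n) : advance (j, i) (pen j i) = pen j i.+1.
Proof.
apply/ffunP => -[i'|i'|j'|j']; rewrite !ffunE //=; have := ltn_ord j; have := ltn_ord i => lti ltj.
- case: (Bot i' =P Bot i) => [[->]|ne].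
    rewrite ltnSn; congr (inl (_, _)); apply/esym/inord_val; by rewrite /= /bump.
  congr (inl (_, inord _)); rewrite ltnS [in RHS]leq_eqVlt.
  by case: eqP => //= E; case: ne; congr Bot; apply: val_inj.
- case: (Rgt j' =P Rgt j) => [[->]|ne].
    rewrite ltnn eqxx; congr (inr (_, _)); apply/esym/inord_val; by rewrite /= /bump.
  congr (inr (_, inord _)); case: ltnP => // _.
  by case: eqP => //= E; case: ne; congr Rgt; apply: val_inj.
Qed.

Lemma pen_next j : pen j n = pen j.+1 0.
Proof.
apply/ffunP => -[i'|i'|j'|j']; rewrite !ffunE //.
  by rewrite ltn_ord.
congr (inr (_, inord _)); rewrite [in RHS]ltnS [in RHS]leq_eqVlt.
by case: (j' == j :> nat); case: (j' < j)%N; rewrite /= ?if_same.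
Qed.

Lemma draw_row (j : 'I_m) k rest : (k <= n)%N -> drawable rest (pen j n) ->
  drawable (map (pair j) (drop k (enum 'I_n)) ++ rest) (pen j k) /\
  foldl (fun cur x => advance x cur) (pen j k) (map (pair j) (drop k (enum 'I_n))) =
    pen j n.
Proof.
move=> le_k dr; have [d Ed] : exists d, d = (n - k)%N by exists (n - k)%N.
elim: d k Ed le_k => [|d IH] k Ed le_k.
  have -> : k = n by lia.
  by rewrite drop_oversize // size_enum_ord.
have lt_k : (k < n)%N by lia.
have [i Ei] : exists i : 'I_n, i = k :> nat by exists (Ordinal lt_k).
have nthE : nth i (enum 'I_n) k = i by rewrite -Ei nth_ord_enum.
have adv : advance (j, i) (pen j k) = pen j k.+1 by rewrite -Ei advance_pen.
rewrite (drop_nth i) ?size_enum_ord // nthE /= adv.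
have [d1 e1] := IH k.+1 (ltac:(lia)) lt_k.
split=> //; split=> //.
- rewrite ffunE ltnn eqxx; congr (inr (_, _)).
  by apply: inord_val.
- rewrite ffunE Ei ltnn; congr (inl (_, _)).
  by apply: inord_val.
Qed.

Lemma draw_rows k : (k <= m)%N ->
  let xs := [seq (j, i) | j <- drop k (enum 'I_m), i <- enum 'I_n] in
  drawable xs (pen k 0) /\
  foldl (fun cur x => advance x cur) (pen k 0) xs = pen m 0.
Proof.
move=> le_k; have [d Ed] : exists d, d = (m - k)%N by exists (m - k)%N.
elim: d k Ed le_k => [|d IH] k Ed le_k.
  have -> : k = m by lia.
  by rewrite drop_oversize // size_enum_ord.
have lt_k : (k < m)%N by lia.
have [j Ej] : exists j : 'I_m, j = k :> nat by exists (Ordinal lt_k).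
have nthE : nth j (enum 'I_m) k = j by rewrite -Ej nth_ord_enum.
rewrite (drop_nth j) ?size_enum_ord // nthE /=.
have [d1 e1] := IH k.+1 (ltac:(lia)) lt_k.
rewrite -pen_next in d1 e1; rewrite -Ej in d1 e1 *.
have [d2 e2] := @draw_row j 0 _ (leq0n n) d1.
rewrite drop0 in d2 e2; split; first exact: d2.
by rewrite foldl_cat e2 e1.
Qed.

Lemma pen_end : pen m 0 = [ffun p => bsegment p].
Proof.
apply/ffunP => -[i'|i'|j'|j']; rewrite !ffunE //=.
  by congr (inl (_, _)); apply: inord_val.
by rewrite ltn_ord; congr (inr (_, _)); apply: inord_val.
Qed.

Lemma traced_straight : traced crossings straight id (pen 0 0).
Proof.
have i0 k : inord 0 = ord0 :> 'I_k.+1 by apply: inord_val.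
split=> //.
- exact: straight_matching.
- move=> p q /eqP; case: p => i; case: q => i'; rewrite !ffunE ?if_same ?i0 => pq;
    by do !case: eqP => ?; congruence.
- move=> p; apply/negP; rewrite /fresh !ffunE; case: p => k /=;
    case/orP => /mapP [[j i] _ []] // ; rewrite ?if_same ?i0 => _ /(congr1 val) //.
Qed.

Lemma trace s :
  [/\ matching (resolve s crossings straight),
      forall p q, p != q -> (resolve s crossings straight p == q) =
        joined s (bsegment p) (bsegment q) &
      #|labels s crossings id @: [set: S]| =
        (m + n + nloops s crossings straight)%N].
Proof.
have [dr fin] := draw_rows (leq0n m); rewrite drop0 in dr fin.
have [[rm rE _ _] cnt] := traced_run s crossings_uniq dr traced_straight.
split=> //.
  by move=> p q pq; rewrite (joinedE _ mem_crossings) rE // fin pen_end !ffunE.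
(* There are 2mn + m + n segments at the start, and each of the mn crossings accounts for two
   classes. *)
move: cnt; rewrite imset_id cardsT card_sum !card_prod !card_ord size_crossings.
by move: #|_| => c; lia.
Qed.

End Draw.

(** * The coefficient as a state sum *)

Section Coefficient.
Variables (m n : nat).
Local Notation P := (bpoint m n).
Local Notation S := (segment m n).
Implicit Types (s : kauffman m n) (C : catState m n).
Local Notation crossings := (crossings m n).
Local Notation straight := (straight m n).
Local Notation final s := (resolve (@crossing_ports m n) s crossings straight).
Local Notation loops s := (nloops (@crossing_ports m n) s crossings straight).

Lemma resolvesE s C : resolves s C = (final s == mate C).
Proof.
have [[fK fN] fE _] := trace s.
apply/idP/eqP => [/forallP H|EC].
  apply/ffunP => p; have /forallP/(_ (final s p)) := H p.
  have pq : p != final s p by rewrite eq_sym.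
  by rewrite pq -(fE _ _ pq) eqxx => /eqP/eqP ->.
apply/forallP => p; apply/forallP => q; rewrite -EC.
case: (eqVneq p q) => [<-|pq] /=; first by rewrite (negbTE (fN p)).
by rewrite (fE _ _ pq).
Qed.

Lemma card_fibers2 (T1 T2 : finType) (F : T1 -> T2) (h : T1 -> T1) :
  (forall x, h x != x) -> (forall x y, (F x == F y) = (x == y) || (h x == y)) ->
  #|T1| = (#|F @: [set: T1]| * 2)%N.
Proof.
move=> hN FE; rewrite -cardsT -sum1_card (partition_big_imset F) /=.
rewrite -sum_nat_const; apply: eq_bigr => a /imsetP [x _ ->].
rewrite (eq_bigl (mem [set x; h x])).
  by rewrite sum1_card cards2 eq_sym hN.
by move=> y; rewrite !inE eq_sym FE ![_ == y]eq_sym.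
Qed.

(** Of the m + n + [loops s] components, m + n reach the boundary, since each of these contains
    exactly two of the 2(m + n) boundary points. *)
Lemma nclosedE s : nclosed s = loops s.
Proof.
have [[fK fN] fE cnt] := trace s.
set L := labels s crossings id in cnt.
have jE : forall z z', joined s z z' = (L z == L z').
  by apply: joinedE => x; apply: mem_crossings.
pose comp (a : S) : {set S} := [set y | a == L y].
have compI : {in L @: [set: S] &, injective comp}.
  move=> a a' /imsetP [z _ ->] _ E; have : z \in comp (L z) by rewrite inE.
  by rewrite E inE => /eqP ->.
pose B := (fun p : P => L (bsegment p)) @: [set: P].
have -> : nclosed s = #|L @: [set: S] :\: B|.
  rewrite /nclosed -(card_in_imset (f := comp)); last first.
    by move=> a a'; rewrite !inE => /andP [_ aI] /andP [_ aI']; apply: compI.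
  apply: eq_card => K; rewrite inE; apply/andP/imsetP.
    case=> /imsetP [z _ EK] /forallP H; exists (L z).
      rewrite inE imset_f // andbT; apply/imsetP => -[p _ E].
      by have := H p; rewrite EK !inE jE E eqxx.
    by rewrite EK; apply/setP => y; rewrite !inE jE.
  case=> a; rewrite inE => /andP [aB /imsetP [z _ Ea]] ->; split.
    apply/imsetP; exists z => //; rewrite Ea.
    by apply/setP => y; rewrite !inE jE.
  apply/forallP => p; rewrite inE; apply: contra aB => /eqP ->.
  by apply/imsetP; exists p.
have cardB : #|B| = (m + n)%N.
  have FE p q : (L (bsegment p) == L (bsegment q)) = (p == q) || (final s p == q).
    have [->|pq] := eqVneq p q; first by rewrite eqxx.
    by rewrite -jE -fE.
  have := card_fibers2 (F := fun p : P => L (bsegment p)) fN FE.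
  have -> : #|{: P}| = (m + n).*2.
    by rewrite -size_clockwise -(card_uniqP (clockwise_uniq m n)); apply: eq_card => p; rewrite mem_clockwise.
  by rewrite -/B -muln2 => /eqP; rewrite eqn_pmul2r // => /eqP <-.
rewrite cardsD cnt.
have -> : L @: [set: S] :&: B = B.
  by apply/setIidPr/subsetP => _ /imsetP [p _ ->]; apply: imset_f.
by rewrite cardB addKn.
Qed.

Lemma ssum_coefficient (R : comNzRingType) (al be de : R) C :
  ssum al be de (cells (rights m n) (bottoms m n))
    (fun f => (f == mate C)%:R) straight =
  \sum_(s : kauffman m n | resolves s C)
     al ^+ #|[set c | s c]| * be ^+ #|[set c | ~~ s c]| * de ^+ nclosed s.
Proof.
rewrite cells_crossings ssum_states ?crossings_uniq // [RHS]big_mkcond /=.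
apply: eq_big => s; first by apply/forallP => y; rewrite mem_crossings.
move=> _; rewrite resolvesE nclosedE; case: eqP => _; last by rewrite mulr0.
rewrite mulr1; congr (_ * _).
have perm_xs : perm_eq crossings (index_enum ('I_m * 'I_n)%type).
  apply: uniq_perm; rewrite ?crossings_uniq ?index_enum_uniq // => x.
  by rewrite mem_crossings mem_index_enum.
rewrite (perm_big _ perm_xs) /= (bigID (fun x => s x)) /=; congr (_ * _).
  rewrite (eq_bigr (fun=> al)) => [|x ->//]; rewrite prodr_const.
  by congr (_ ^+ _); apply: eq_card => x; rewrite !inE.
rewrite (eq_bigr (fun=> be)) => [|x /negbTE ->//]; rewrite prodr_const.
by congr (_ ^+ _); apply: eq_card => x; rewrite !inE.
Qed.

Lemma varA_neq0 : varA != 0.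
Proof. by rewrite /varA tofrac_eq0 polyX_eq0. Qed.

Lemma varA_inv : varA * varA^-1 = 1.
Proof. by rewrite mulfV // varA_neq0. Qed.

Lemma coefficientE C : coefficient C =
  ssum varA varA^-1 (- varA ^+ 2 - varA^-1 ^+ 2)
    (cells (rights m n) (bottoms m n)) (fun f => (f == mate C)%:R) straight.
Proof.
rewrite ssum_coefficient; apply: eq_bigr => s _; rewrite exprVn; congr (_ * _).
by rewrite expfzDr ?varA_neq0 // exprVn -exprnN.
Qed.

Lemma realizableE C : realizable C <->
  ssum (1 : int) 1 (- 2) (cells (rights m n) (bottoms m n))
    (fun f => (f == mate C)%:R) straight != 0.
Proof.
have un : uniq (rights m n ++ bottoms m n).
  have i1 : injective (@Rgt m n) by move=> ? ? [].
  have i2 : injective (@Bot m n) by move=> ? ? [].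
  rewrite cat_uniq (map_inj_uniq i1) (map_inj_uniq i2) !enum_uniq andbT /=.
  by apply/hasPn => p /mapP [i _ ->]; apply/mapP => -[].
have out : outward straight (rights m n ++ bottoms m n).
  move=> p; rewrite mem_cat => /orP [] /mapP [i _ ->]; rewrite ffunE mem_cat;
  by apply/norP; split; apply/mapP => -[].
split=> [[s]|].
  rewrite resolvesE => /eqP /reach_resolve; rewrite -cells_crossings => rc.
  have [_ H] := ssum_pos (mate C) (straight_matching m n) un out.
  by rewrite gt_eqF // H.
rewrite ssum_coefficient => H; case: (pickP (fun s => resolves s C)) => [s|no].
  by exists s.
by rewrite big_pred0 // eqxx in H.
Qed.

End Coefficient.

(** * Non-crossing matchings *)

Section NonCrossing.
Variable P : finType.
Implicit Types (p q : P) (l : seq P).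
Variables (g : {ffun P -> P}) (pos : P -> nat).
Hypothesis g_matching : matching g.
Hypothesis noncrossing : forall p q,
  ~ (pos p < pos q /\ pos q < pos (g p) /\ pos (g p) < pos (g q))%N.
Hypothesis pos_inj : injective pos.

Local Notation increasing := (sorted (fun p q => pos p < pos q)%N).

(** The mate of the first point cuts the list in two; as arcs do not cross, both pieces are closed
    under [g]. *)
Lemma noncrossing_dyck l : increasing l -> {in l, forall p, g p \in l} ->
  exists r, dyck r (map (chord g) l).
Proof.
have [gK gN] := g_matching.
have tr : transitive (fun p q => pos p < pos q)%N by move=> q p r; apply: ltn_trans.
have [N] := ubnP (size l); elim: N l => // N IH [|p l] lt_N inc cl.
  by exists 0; apply: Dyck0.
have gpl : g p \in l by have := cl p (mem_head _ _); rewrite inE (negbTE (gN p)).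
have [e1 [e2 El]] : exists e1 e2, l = e1 ++ g p :: e2.
  by case/splitPr: gpl => e1 e2; exists e1, e2.
rewrite El in inc cl lt_N *.
have un : uniq (p :: e1 ++ g p :: e2).
  by apply: (sorted_uniq tr) inc => q; rewrite /= ltnn.
move: (inc); rewrite /= (path_sortedE tr) => /andP [/allP ltp].
rewrite (sorted_pairwise tr) pairwise_cat pairwise_cons => /and3P [/allrelP lt12].
rewrite -!(sorted_pairwise tr) => inc1 /andP [/allP lt2 inc2].
move: un; rewrite /= mem_cat inE !negb_or cat_uniq /=.
case/andP => /and3P [pe1 _ pe2] /and3P [un1 /norP [gpe1 /hasPn dis] /andP [gpe2 un2]].
have cl1 : {in e1, forall q, g q \in e1}.
  move=> q q1; have q_gp := lt12 _ _ q1 (mem_head _ _).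
  have := cl q; rewrite !(inE, mem_cat) q1 orbT => /(_ isT).
  case/or4P => // [/eqP E|/eqP E|g2].
  - by move: gpe1; rewrite -E gK q1.
  - by move: pe1; rewrite -(can_inj gK E) q1.
  - case: (noncrossing (p := p) (q := q)); split.
      by apply: ltp; rewrite mem_cat q1.
    by split=> //; apply: lt2.
have cl2 : {in e2, forall q, g q \in e2}.
  move=> q q2; have := cl q; rewrite !(inE, mem_cat) q2 !orbT => /(_ isT).
  case/or4P => // [/eqP E|g1|/eqP E].
  - by move: gpe2; rewrite -E gK q2.
  - by have := cl1 _ g1; rewrite gK => q1; have := dis _ q2; rewrite /= q1.
  - by move: pe2; rewrite -(can_inj gK E) q2.
have [|r1 d1] := IH e1 _ inc1 cl1.
  by move: lt_N; rewrite /= size_cat /=; lia.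
have [|r2 d2] := IH e2 _ inc2 cl2.
  by move: lt_N; rewrite /= size_cat /=; lia.
exists (r1 + r2).+1.
have -> : chord g p :: map (chord g) (e1 ++ g p :: e2) =
    chord g p :: rcons (map (chord g) e1) (chord g p) ++ map (chord g) e2.
  rewrite map_cat cat_rcons /=; congr (_ :: _ ++ _ :: _).
  by rewrite /chord gK setUC.
apply: DyckS => //.
  apply/mapP => -[q q1]; move/setP/(_ q); rewrite !inE eqxx /= => /orP [] /eqP E.
    by rewrite -E q1 in pe1.
  by rewrite -E q1 in gpe1.
move=> A; rewrite inE => /predU1P [->|/mapP [q q1 ->]]; apply/mapP => -[q' q2];
  move/setP/(_ q'); rewrite !inE eqxx /= => /orP [] /eqP E.
- by rewrite -E q2 in pe2.
- by rewrite -E q2 in gpe2.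
- by have := dis _ q2; rewrite E /= q1.
- by have := dis _ q2; rewrite E /= (cl1 _ q1).
Qed.

(** One descends to an innermost arc under the given one: the arc at the next point ends strictly
    inside, and its end is in [l] because [l] contains all points lying between two of its
    members. *)
Lemma inner_return p0 l i j : increasing l -> (i < j < size l)%N ->
  {in l &, forall p q r, (pos p < pos r < pos q)%N -> r \in l} ->
  g (nth p0 l i) = nth p0 l j ->
  exists k, [/\ (i <= k)%N, (k < j)%N & g (nth p0 l k) = nth p0 l k.+1].
Proof.
have [gK gN] := g_matching.
have tr : transitive (fun p q => pos p < pos q)%N by move=> q p r; apply: ltn_trans.
move=> inc lt_ij conv; have [N] := ubnP (j - i); elim: N i j lt_ij => // N IH i j.
move=> /andP [lt_ij lt_j] lt_N Eg.
have lt_nth a b : (a < b)%N -> (b < size l)%N -> (pos (nth p0 l a) < pos (nth p0 l b))%N.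
  by move=> ab bl; apply: (sorted_ltn_nth tr p0 inc); rewrite ?inE //; lia.
have [Ej|ne] := eqVneq i.+1 j; first by exists i; rewrite Ej.
have lt1 : (i.+1 < j)%N by lia.
set p := nth p0 l i in Eg; set x := nth p0 l i.+1.
have px : (pos p < pos x)%N by apply: lt_nth => //; lia.
have xq : (pos x < pos (g p))%N by rewrite Eg; apply: lt_nth => //; lia.
have gxq : (pos (g x) < pos (g p))%N.
  rewrite ltn_neqAle (inj_eq pos_inj) (inj_eq (can_inj gK)).
  rewrite (_ : x != p) /=; last by apply: contraTneq px => ->; rewrite ltnn.
  by rewrite leqNgt; apply/negP => ?; apply: (noncrossing (p := p) (q := x)).
have pgx : (pos p < pos (g x))%N.
  rewrite ltn_neqAle (inj_eq pos_inj).
  rewrite (_ : p != g x) /=; last first.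
    by apply: contraTneq xq => ->; rewrite gK ltnn.
  rewrite leqNgt; apply/negP => ?.
  by apply: (noncrossing (p := g x) (q := p)); rewrite gK.
have pl : p \in l by apply/mem_nth/(ltn_trans lt_ij lt_j).
have ql : g p \in l by rewrite Eg; apply: mem_nth.
have gxl : g x \in l by apply: (conv p (g p) pl ql); rewrite pgx.
have lt_k : (index (g x) l < size l)%N by rewrite index_mem.
have Ek : nth p0 l (index (g x) l) = g x by rewrite nth_index.
have kj : (index (g x) l < j)%N.
  rewrite ltnNge; apply/negP; rewrite leq_eqVlt => /predU1P [E|lt].
    by move: gxq; rewrite -Ek -E Eg ltnn.
  have := lt_nth _ _ lt lt_k; rewrite Ek -Eg => lt'.
  by move: (ltn_trans gxq lt'); rewrite ltnn.
have ik : (i.+1 < index (g x) l)%N.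
  rewrite ltn_neqAle; apply/andP; split.
    apply/eqP => E; have := gN x; by rewrite -Ek -E eqxx.
  rewrite ltnNge leq_eqVlt negb_or; apply/andP; split.
    apply/eqP => E; by move: pgx; rewrite -Ek E ltnn.
  apply/negP => lt; have := lt_nth _ _ lt (ltn_trans lt_ij lt_j).
  rewrite Ek => lt'; by move: (ltn_trans pgx lt'); rewrite ltnn.
have [|||k [k1 k2 k3]] := IH i.+1 (index (g x) l).
- by rewrite ik.
- by lia.
- by rewrite Ek.
by exists k; split=> //; lia.
Qed.

End NonCrossing.

(** The order in which the bottom points of the tree state meet the left side, read upwards, and
    then the right side, read downwards. *)
Lemma bottom_ordinals l : enum 'I_(l + l) =
  [seq lshift l (rev_ord a) | a <- rev (enum 'I_l)] ++
  [seq rshift l a | a <- enum 'I_l].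
Proof.
apply: (inj_map val_inj); rewrite val_enum_ord map_cat iotaD add0n.
congr (_ ++ _).
  rewrite -map_comp map_rev -[LHS]revK; congr rev.
  transitivity [seq (l - a.+1)%N | a <- map val (enum 'I_l)]; last first.
    by rewrite -map_comp; apply: eq_map.
  rewrite val_enum_ord.
  apply: (@eq_from_nth _ 0) => [|i]; first by rewrite size_rev size_map size_iota.
  rewrite size_rev size_iota => lt_i.
  by rewrite nth_rev size_iota // (nth_map 0) ?size_iota // !nth_iota //; lia.
rewrite -map_comp.
transitivity [seq (l + a)%N | a <- map val (enum 'I_l)]; last first.
  by rewrite -map_comp; apply: eq_map.
by rewrite val_enum_ord -iotaDl addn0.
Qed.

Lemma sorted_all (T : Type) (e : rel T) (s : seq T) :
  (forall i j, e i j) -> sorted e s.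
Proof. by move=> H; case: s => //= x s; elim: s x => //= y s IH x; rewrite H IH. Qed.

(** * The tree state *)

Section Tree.
Variables (R : comNzRingType) (al be de : R).
Hypothesis al_be : al * be = 1.
Hypothesis deE : de = - al ^+ 2 - be ^+ 2.
Variables (l : nat) (T : catState l (l + l)).
Hypothesis T_lft : forall a, T (Lft a) = Bot (lshift l (rev_ord a)).
Hypothesis T_rgt : forall a, T (Rgt a) = Bot (rshift l a).
Hypothesis T_top : forall i, exists j, T (Top i) = Top j.
Local Notation P := (bpoint l (l + l)).
Local Notation tops := [seq Top i | i <- enum 'I_(l + l)].
Local Notation lefts := [seq Lft a | a <- enum 'I_l].

Lemma mate_matching m n (C : catState m n) : matching (mate C).
Proof. by split; [apply: mateK|apply: mate_neq]. Qed.

(** No two bottom points are joined, so the plucking expansion applies to all rows at once. The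
    window contains every return of the top word, and the parallel word that remains has weight
    1. *)
Lemma tree_ssum : ssum al be de (cells (rights l (l + l)) (bottoms l (l + l)))
    (fun f => (f == mate T)%:R) (straight l (l + l)) =
  pluck al be l (map (chord T) tops).
Proof.
have Tm := mate_matching T; have [TK TN] := Tm.
have T_bot i : (exists a, T (Bot i) = Lft a) \/ (exists a, T (Bot i) = Rgt a).
  have : i \in enum 'I_(l + l) by rewrite mem_enum.
  rewrite bottom_ordinals mem_cat => /orP [] /mapP [a _ ->].
    by left; exists a; rewrite -T_lft TK.
  by right; exists a; rewrite -T_rgt TK.
set us := rights l (l + l); set ds := bottoms l (l + l).
have un : uniq (us ++ ds).
  have i1 : injective (@Rgt l (l + l)) by move=> ? ? [].
  have i2 : injective (@Bot l (l + l)) by move=> ? ? [].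
  rewrite cat_uniq (map_inj_uniq i1) (map_inj_uniq i2) !enum_uniq andbT /=.
  by apply/hasPn => p /mapP [i _ ->]; apply/mapP => -[].
have out : outward (straight l (l + l)) (us ++ ds).
  move=> p; rewrite mem_cat => /orP [] /mapP [i _ ->]; rewrite ffunE mem_cat;
  by apply/norP; split; apply/mapP => -[].
have ag : agree (straight l (l + l)) T (us ++ ds).
  have ru j : Rgt j \in us by apply: map_f; rewrite mem_enum.
  have bd i : Bot i \in ds by apply: map_f; rewrite mem_enum.
  by case=> i; rewrite ffunE !mem_cat ?ru ?bd ?orbT.
have up : sorted (fun v w => T v != w) ds.
  rewrite /ds /bottoms sorted_map; apply: sorted_all => i j /=.
  by case: (T_bot i) => -[a ->].
rewrite (ssum_plucks al_be deE Tm (straight_matching _ _) un out ag up).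
have -> : map (straight l (l + l)) us = lefts.
  by rewrite -map_comp; apply: eq_map => a /=; rewrite ffunE.
have -> : map (straight l (l + l)) ds = tops.
  by rewrite -map_comp; apply: eq_map => a /=; rewrite ffunE.
rewrite !map_cat size_map size_enum_ord.
set A := map _ ds; set e := map _ tops; set u := map _ (rev lefts).
set t := map _ us.
have chordT p : chord T (T p) = chord T p by rewrite /chord TK setUC.
have utA : u ++ t = A.
  rewrite /u /t -map_cat /A; have -> : ds = map T (rev lefts ++ us).
    rewrite /ds /bottoms bottom_ordinals !map_cat -!map_rev -!map_comp.
    by congr (_ ++ _); apply: eq_map => a /=; rewrite ?T_lft ?T_rgt.
  by rewrite -map_comp; apply: eq_map => p /=; rewrite chordT.
(* Any distinct letters different from the arcs on the other sides can serve for the parallel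
   family; singletons are never arcs. *)
pose s := [seq [set (Top (lshift l i) : P)] | i <- enum 'I_l].
have uniq_s : uniq s.
  rewrite map_inj_uniq ?enum_uniq // => i j /setP/(_ (Top (lshift l i))).
  by rewrite !inE eqxx => /esym/eqP [E]; apply: val_inj.
have apart_tops x : {in x, forall B, exists i, B = chord T (Top i) \/ B = [set (Top i : P)]} ->
    apart_words x (u ++ t ++ A).
  move=> xT B /xT [i EB]; rewrite -utA /u /t -!map_cat; apply/mapP => -[p pin E].
  have : p \in B by case: EB => _; rewrite E !inE eqxx.
  have pT k : p != Top k.
    apply: contraTneq pin => ->; rewrite !(mem_cat, mem_rev); apply/negP.
    by repeat case/orP; case/mapP.
  have [k Ek] := T_top i.
  by case: EB => ->; rewrite !inE ?(negbTE (pT _)) // Ek (negbTE (pT _)).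
have size_s : size s = l by rewrite size_map size_enum_ord.
have size_A : size A = (l + l)%N.
  by rewrite /A size_map /ds /bottoms size_map size_enum_ord.
have size_e : size e = (l + l)%N by rewrite /e size_map size_map size_enum_ord.
have size_u : size u = l by rewrite /u size_map size_rev size_map size_enum_ord.
have size_t : size t = l by rewrite /t size_map /us /rights size_map size_enum_ord.
have ap_s : apart_words s (u ++ t ++ A).
  by apply: apart_tops => B /mapP [i _ ->]; exists (lshift l i); right.
have ap_e : apart_words e (u ++ t ++ A).
  by apply: apart_tops => B /mapP [p /mapP [i _ ->] ->]; exists i; left.
rewrite (plucks_factor al_be (r := l) (s := s)) //.
- have -> : plucks al be A l (u ++ (s ++ rev s) ++ t) = 1; last by rewrite mulr1.
  have := @plucks_par _ _ _ _ al_be A u s t; rewrite size_s; apply => //.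
  + rewrite utA /A map_inj_in_uniq; first by move: un; rewrite cat_uniq => /and3P [].
    move=> p q /mapP [i _ ->] /mapP [j _ ->] /setP/(_ (Bot i)).
    by rewrite !inE eqxx /=; case: (T_bot j) => -[a ->]; rewrite orbF => /esym/eqP ->.
  + by case/apart_words_cat: ap_s => _ /apart_words_cat [].
  + by rewrite size_u size_t.
- by rewrite size_e addnn.
- by move=> k /ret_size; rewrite size_e size_u size_A; lia.
- by rewrite size_u size_A; lia.
Qed.

End Tree.

Lemma sorted_index (T : eqType) (s : seq T) : uniq s ->
  sorted (fun x y => index x s < index y s)%N s.
Proof.
case: s => // x0 s0; set s := x0 :: s0 => un.
by apply/(sortedP x0) => i lt_i; rewrite !index_uniq // ltnW.
Qed.

Lemma ends_inhabited m n (C : catState m n) L : local_family C L ->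
  exists p, p \in ends_cw L.
Proof.
move=> hL; case/and4P: (hL) => /set0Pn [A AL] _ _ _; have [p EA] := local_arc hL AL.
exists p; rewrite (mem_ends_cw hL); apply/bigcupP; exists A => //.
by rewrite EA !inE eqxx.
Qed.

(** * Factorization in a framed rectangle *)

Section Frame.
Variables (R : comNzRingType) (al be de : R).
Hypothesis al_be : al * be = 1.
Hypothesis deE : de = - al ^+ 2 - be ^+ 2.
Variables (m n : nat) (C : catState m n) (L : {set {set bpoint m n}}).
Hypothesis hL : local_family C L.
Local Notation P := (bpoint m n).
Local Notation ps := (ends_cw L).
Local Notation straight := (straight m n).

(** The rectangle is held so that the family avoids the side [a]. In the upright position [a] and
    [c] are the left and right sides read downwards, [b] and [d] the top and bottom read to the
    right; after a half turn, [a] is the right side read upwards, and so on. [k0] is the place where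
    the clockwise order is cut. *)
Variables (a b c d u t : seq P) (k0 j1 j2 : nat).
Hypothesis (le_k0 : (k0 <= (m + n).*2)%N).
Hypothesis around : rev a ++ b ++ c ++ rev d = rot k0 (clockwise m n).
Hypotheses (c_a : map straight c = a) (d_b : map straight d = b).
Hypotheses (size_c : size c = m) (size_d : size d = n).
Hypothesis split_ps : b ++ c ++ rev d = u ++ ps ++ t.
Hypotheses (j12 : (j1 <= j2)%N) (j2m : (j2 <= m)%N).
Let M := b ++ c ++ rev d.
Hypothesis returns : forall p0 i, (i.+1 < size M)%N -> nth p0 M i \in ps ->
  C (nth p0 M i) = nth p0 M i.+1 -> (n + j1 <= i.+1 <= n + j2)%N.
Hypothesis other_returns : forall p0 i, (i.+1 < m)%N ->
  C (nth p0 a i) = nth p0 a i.+1 -> (i.+1 <= j1)%N || (j2 <= i.+1)%N.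

Let Y := rev a ++ M.
Let pos p := index p Y.
Let Cm := mate_matching C.

Let uniq_Y : uniq Y.
Proof. by rewrite /Y /M around rot_uniq clockwise_uniq. Qed.

Let mem_Y p : p \in Y.
Proof. by rewrite /Y /M around mem_rot mem_clockwise. Qed.

Let uniq_M : uniq M.
Proof. by move: uniq_Y; rewrite cat_uniq => /and3P []. Qed.

Let size_a : size a = m. Proof. by rewrite -c_a size_map. Qed.
Let size_b : size b = n. Proof. by rewrite -d_b size_map. Qed.
Let ps_M p : p \in ps -> p \in M.
Proof. by rewrite /M split_ps !mem_cat => ->; rewrite orbT. Qed.

Let a_M p : p \in a -> p \notin M.
Proof.
move: uniq_Y; rewrite cat_uniq => /and3P [_ /hasPn H _] pa.
by apply/negP => /H; rewrite /= mem_rev pa.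
Qed.

Let pos_M p : p \in M -> pos p = (m + index p M)%N.
Proof.
move=> pM; rewrite /pos index_cat mem_rev size_rev size_a ifN //.
by apply: contraL pM; apply: a_M.
Qed.

Let pos_inj : injective pos.
Proof. by move=> p q; apply: index_inj. Qed.

Let noncrossing p q :
  ~ (pos p < pos q /\ pos q < pos (C p) /\ pos (C p) < pos (C q))%N.
Proof.
case/catalanP: (mateP C) => CK _ nc.
by rewrite /pos /Y /M around; apply: (noncrossing_rot CK le_k0).1.
Qed.

Let ps_closed : {in ps, forall p, C p \in ps}.
Proof. by move=> p; rewrite !(mem_ends_cw hL) => /(ends_mate hL). Qed.

Let uniq_ps := ends_cw_uniq hL.
Let size_ps := size_ends_cw hL.

Let incM : sorted (fun p q => pos p < pos q)%N M.
Proof.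
have := sorted_index uniq_Y; rewrite {3}/Y => /(drop_sorted (size (rev a))).
by rewrite drop_size_cat.
Qed.

Lemma ends_dyck : exists r, dyck r (map (chord C) ps).
Proof.
apply: (noncrossing_dyck Cm noncrossing) => //.
have := drop_sorted (size u) incM; rewrite /M split_ps drop_size_cat //.
by move/(take_sorted (size ps)); rewrite take_size_cat.
Qed.

Let above := rev (take j1 a) ++ b ++ take j1 c.
Let below := drop j2 c ++ rev d ++ rev (drop j2 a).
Let same p q := [&& p \in above & q \in above] || [&& p \in below & q \in below].

Let idx_ps p0 i : (i < #|L| + #|L|)%N -> nth p0 M (size u + i) = nth p0 ps i.
Proof.
move=> lt_i; rewrite /M split_ps nth_cat ltnNge leq_addr /= addKn nth_cat.
by rewrite size_ps lt_i.
Qed.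

Let index_ps p : p \in ps -> index p M = (size u + index p ps)%N.
Proof.
move=> pp; have pM := ps_M pp.
have lt_i : (index p ps < #|L| + #|L|)%N by rewrite -size_ps index_mem.
have lt_j : (size u + index p ps < size M)%N.
  by rewrite /M split_ps !size_cat size_ps; lia.
by rewrite -(index_uniq p lt_j uniq_M) idx_ps // nth_index.
Qed.

Let aboveP p : p \in M -> (p \in above) = (index p M < n + j1)%N.
Proof.
move=> pM; have pa : p \notin a by apply: contraL pM; apply: a_M.
have pa1 : p \notin take j1 a by apply: contra pa; apply: mem_take.
rewrite /above mem_cat mem_rev (negbTE pa1) /=.
have -> : M = (b ++ take j1 c) ++ (drop j1 c ++ rev d).
  by rewrite /M -catA [take _ _ ++ _]catA cat_take_drop.
have -> : (n + j1 = size (b ++ take j1 c))%N.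
  by rewrite size_cat size_b size_takel // size_c; lia.
rewrite index_cat; case: ifP => [pb|_]; first by rewrite index_mem pb.
by rewrite ltnNge leq_addr.
Qed.

Let belowP p : p \in M -> (p \in below) = (n + j2 <= index p M)%N.
Proof.
move=> pM; have pa : p \notin a by apply: contraL pM; apply: a_M.
have pa3 : p \notin drop j2 a by apply: contra pa; apply: mem_drop.
rewrite /below catA mem_cat mem_rev (negbTE pa3) orbF.
have EM : M = (b ++ take j2 c) ++ (drop j2 c ++ rev d).
  by rewrite /M -catA [take _ _ ++ _]catA cat_take_drop.
have -> : (n + j2 = size (b ++ take j2 c))%N.
  by rewrite size_cat size_b size_takel // size_c.
move: uniq_M pM; rewrite EM cat_uniq => /and3P [_ /hasPn H _] pM.
rewrite index_cat; case: ifP => [pb|npb]; last first.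
  by rewrite leq_addr; move: pM; rewrite mem_cat npb.
rewrite leqNgt index_mem pb; apply/negbTE/negP => /H.
by rewrite /= pb.
Qed.

(** Under an arc of the family lies one joining neighbours of [M], again in the family. By [returns]
    it sits between the levels j1 and j2, so the outer arc cannot have both ends above or both
    below. *)
Let not_same p : p \in ps -> ~~ same p (C p).
Proof.
have [CK CN] := Cm.
have main q : q \in ps -> (index q M < index (C q) M)%N -> ~~ same q (C q).
  move=> qs lt_q; have cqs := ps_closed qs.
  have lt2 : (index (C q) M < size M)%N by rewrite index_mem ps_M.
  have [k [k1 k2 k3]] : exists k, [/\ (index q M <= k)%N, (k < index (C q) M)%N &
      C (nth q M k) = nth q M k.+1].
    apply: (inner_return Cm noncrossing pos_inj incM).
    - by rewrite lt_q.
    - move=> x y xM yM z /andP [xz _]; have := mem_Y z; rewrite mem_cat mem_rev.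
      case/orP => // za; have : (pos z < m)%N.
        have : (index z (rev a) < size (rev a))%N by rewrite index_mem mem_rev.
        by rewrite /pos /Y index_cat mem_rev za size_rev size_a.
      by move: xz; rewrite (pos_M xM); move: (index x M) (pos z) => ? ?; clear; lia.
    - by rewrite !nth_index ?ps_M.
  have kps : nth q M k \in ps.
    have := index_ps qs; have := index_ps cqs => E1 E2.
    have : (index (C q) ps < size ps)%N by rewrite index_mem.
    rewrite size_ps => lt3.
    have -> : k = (size u + (k - size u))%N by lia.
    by rewrite idx_ps ?mem_nth ?size_ps; lia.
  have lt_k : (k.+1 < size M)%N by lia.
  have := returns lt_k kps k3; rewrite /same !aboveP ?belowP ?ps_M //.
  by lia.
move=> pp; case: (ltngtP (index p M) (index (C p) M)) => [lt|gt|eq].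
- exact: main.
- have := main (C p) (ps_closed pp); rewrite CK => /(_ gt).
  by rewrite /same ![(C p \in _) && _]andbC.
- have := congr1 (nth p M) eq; rewrite !nth_index ?ps_M ?ps_closed // => E.
  by have := CN p; rewrite -E eqxx.
Qed.

Let CL := parallel_state hL.
Local Notation l := #|L|.

Let CL_ps p0 i : (i < l + l)%N -> CL (nth p0 ps i) = nth p0 ps (l + l - i.+1).
Proof.
move=> lt_i; have ip : nth p0 ps i \in ps by rewrite mem_nth ?size_ps.
rewrite ffunE /= ip index_uniq ?size_ps // nth_rev size_ps //.
by apply: set_nth_default; rewrite size_ps; lia.
Qed.

Let CL_out p : p \notin ps -> CL p = C p.
Proof. by rewrite ffunE /= => /negbTE ->. Qed.

Let CL_closed : {in ps, forall p, CL p \in ps}.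
Proof.
move=> p pp; have := nth_index p pp; have := pp; rewrite -index_mem size_ps => lt_i <-.
by rewrite CL_ps // mem_nth // size_ps; lia.
Qed.

Let index_nth p0 i : (i < l + l)%N -> index (nth p0 ps i) M = (size u + i)%N.
Proof.
by move=> lt_i; rewrite index_ps ?mem_nth ?size_ps // index_uniq ?size_ps.
Qed.

Let pigeon (x y : seq P) : uniq x -> {subset x <= ps} ->
  (forall p, p \in x -> C p \in y) -> (size x <= size y)%N.
Proof.
move=> unx _ H; rewrite -(size_map C x); apply: uniq_leq_size.
  by rewrite map_inj_uniq //; apply: can_inj Cm.1.
by move=> _ /mapP [p px ->]; apply: H.
Qed.

(** If a parallel arc had both ends above, the first l + 1 ends of the family would lie above; by
    [not_same] their mates in [C] would be among the last l - 1 ends, against injectivity. The case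
    below is symmetric. *)
Let not_same_par p : p \in ps -> ~~ same p (CL p).
Proof.
move=> pp; have := nth_index p pp; have := pp; rewrite -index_mem size_ps.
move: (index p ps) => i lt_i <-; rewrite CL_ps //.
have lt_j : (l + l - i.+1 < l + l)%N by lia.
have ip := mem_nth p (n := i) (s := ps); rewrite size_ps in ip.
have jp := mem_nth p (n := (l + l - i.+1)%N) (s := ps); rewrite size_ps in jp.
rewrite /same !aboveP ?belowP ?ps_M ?ip ?jp // !index_nth //.
apply/negP => /orP [] /andP [h1 h2].
  have lt_l : (size u + l < n + j1)%N by clear -h1 h2 lt_i; lia.
  have H q : q \in take l.+1 ps -> C q \in drop l.+1 ps.
    move=> qt; have qp := mem_take qt.
    have := ps_closed qp; rewrite -{1}(cat_take_drop l.+1 ps) mem_cat => /orP [cqt|//].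
    have lo q' : q' \in take l.+1 ps -> q' \in above.
      move=> q't; rewrite aboveP ?ps_M ?(mem_take q't) // index_ps ?(mem_take q't) //.
      move: q't; rewrite in_take_leq ?size_ps => [lt|]; last by clear -lt_i; lia.
      by apply: leq_ltn_trans lt_l; rewrite leq_add2l -ltnS.
    by have := not_same qp; rewrite /same !lo.
  have := pigeon (take_uniq _ uniq_ps) (fun q => @mem_take _ _ _ q) H.
  rewrite size_takel ?size_drop ?size_ps; last by clear -lt_i; lia.
  by clear -lt_i; lia.
have lt_l : (n + j2 <= size u + l.-1)%N by clear -h1 h2 lt_i; lia.
have H q : q \in drop l.-1 ps -> C q \in take l.-1 ps.
  move=> qt; have qp := mem_drop qt.
  have := ps_closed qp; rewrite -{1}(cat_take_drop l.-1 ps) mem_cat => /orP [//|cqt].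
  have lo q' : q' \in drop l.-1 ps -> q' \in below.
    move=> q't; have q'p := mem_drop q't.
    rewrite belowP ?ps_M // index_ps //; apply: leq_trans lt_l _; rewrite leq_add2l.
    rewrite leqNgt -in_take_leq ?size_ps; last by clear; lia.
    move: uniq_ps; rewrite -{1}(cat_take_drop l.-1 ps) cat_uniq => /and3P [_ /hasPn K _].
    exact: K.
  by have := not_same qp; rewrite /same !lo ?orbT.
have := pigeon (drop_uniq _ uniq_ps) (fun q => @mem_drop _ _ _ q) H.
rewrite size_takel ?size_drop ?size_ps; last by clear -lt_i; lia.
by clear -lt_i; lia.
Qed.

Let par : exists s, [/\ map (chord CL) (rev ps) = s ++ rev s, uniq s & size s = l].
Proof.
have [p0 _] := ends_inhabited hL; have [CLK _] := mate_matching CL.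
have chordCL p : chord CL (CL p) = chord CL p by rewrite /chord CLK setUC.
set e := map (chord CL) (rev ps).
have size_e : size e = (l + l)%N by rewrite size_map size_rev size_ps.
have e_i i : (i < l + l)%N -> nth (chord CL p0) e i = chord CL (nth p0 ps (l + l - i.+1)).
  by move=> lt_i; rewrite (nth_map p0) ?size_rev ?size_ps // nth_rev size_ps.
exists (take l e); split; last by rewrite size_takel // size_e leq_addr.
  rewrite -{1}(cat_take_drop l e); congr (_ ++ _).
  have sz : size (drop l e) = l by rewrite size_drop size_e addnK.
  apply: (@eq_from_nth _ (chord CL p0)); rewrite sz.
    by rewrite size_rev size_takel // size_e leq_addr.
  move=> i lt_i; rewrite nth_rev size_takel ?size_e ?leq_addr //.
  have [lt1 lt2] : (l + i < l + l)%N /\ (l - i.+1 < l)%N by clear -lt_i; lia.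
  rewrite nth_drop nth_take // !e_i //; last by rewrite (leq_trans lt2) // leq_addr.
  rewrite -chordCL CL_ps; last by clear -lt_i; lia.
  by congr (chord CL (nth p0 ps _)); clear -lt_i; lia.
rewrite -map_take map_inj_in_uniq; first by rewrite take_uniq // rev_uniq.
have lo p : p \in take l (rev ps) -> exists2 i, (l <= i < l + l)%N & p = nth p0 ps i.
  case/(nthP p0) => i; rewrite size_takel ?size_rev ?size_ps ?leq_addr // => lt_i <-.
  rewrite nth_take // nth_rev size_ps; last by clear -lt_i; lia.
  by exists (l + l - i.+1)%N => //; clear -lt_i; lia.
move=> p q /lo [i le_i Ep] /lo [j le_j Eq] /setP/(_ q); rewrite !inE eqxx /= => /orP [] /eqP //.
rewrite Ep Eq CL_ps => [/eqP|]; last by clear -le_i; lia.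
rewrite nth_uniq ?size_ps // => [/eqP||]; by clear -le_i le_j; lia.
Qed.

Lemma frame_factor : ssum al be de (cells c d)
    (fun f => (f == mate C)%:R) straight =
  pluck al be #|L| (map (chord C) ps) *
  ssum al be de (cells c d) (fun f => (f == mate CL)%:R) straight.
Proof.
have [s [par_s uniq_s size_s]] := par.
have l_gt0 : (0 < l)%N by case/and4P: hL; rewrite card_gt0.
have sm := straight_matching m n.
have [CK _] := Cm.
have Em : a = take j1 a ++ take (j2 - j1) (drop j1 a) ++ drop j2 a.
  by rewrite -{1}(cat_take_drop j1 a) -{1}(cat_take_drop (j2 - j1) (drop j1 a)) drop_drop subnK.
have Ec : c = take j1 c ++ take (j2 - j1) (drop j1 c) ++ drop j2 c.
  by rewrite -{1}(cat_take_drop j1 c) -{1}(cat_take_drop (j2 - j1) (drop j1 c)) drop_drop subnK.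
have cd_Y : perm_eq (a ++ b ++ c ++ d) Y.
  rewrite /Y /M; apply: perm_cat; first by rewrite perm_sym perm_rev.
  by rewrite !perm_cat2l perm_sym perm_rev.
have un0 : uniq (a ++ b ++ c ++ d) by rewrite (perm_uniq cd_Y).
have mem0 p : p \in a ++ b ++ c ++ d by rewrite (perm_mem cd_Y).
(* The columns of the middle part read the ends counterclockwise. *)
have -> : pluck al be l (map (chord C) ps) = pluck al be l (map (chord C) (rev ps)).
  have [r dy] := ends_dyck; rewrite map_rev.
  have -> : l = r; last by rewrite (pluck_rev al_be).
  by have := dyck_size dy; rewrite size_map size_ps; clear; lia.
have c_out p : (p \in c ++ d) = (straight p \in a ++ b).
  rewrite -c_a -d_b -map_cat; apply/idP/mapP => [pc|[q qc E]]; first by exists p.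
  by rewrite (can_inj sm.1 E).
have out_cd p : p \in c ++ d -> p \notin a ++ b.
  move: un0; rewrite catA cat_uniq => /and3P [_ /hasPn H _] pc.
  exact: H.
have tot p : (p \in a ++ b) || (p \in c ++ d) by rewrite -mem_cat -catA.
rewrite {1 2}Ec.
apply: (factor_ssum al_be deE (a1 := take j1 a)
  (a2 := take (j2 - j1) (drop j1 a)) (a3 := drop j2 a) (b := b) (s := s)
  (u0 := rev (take j1 a) ++ u) (t0 := t ++ rev (drop j2 a))) => //.
- rewrite -!catA; congr (_ ++ _).
  rewrite [RHS](_ : _ = (u ++ ps ++ t) ++ rev (drop j2 a)); last by rewrite -!catA.
  by rewrite -split_ps {4}Ec -!catA.
- have perm (a1 a2 a3 b' c1 c2 c3 d' : seq P) :
    perm_eq ((a1 ++ a2 ++ a3) ++ b' ++ (c1 ++ c2 ++ c3) ++ d')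
      (a2 ++ (rev a1 ++ b' ++ c1) ++ c2 ++ c3 ++ rev d' ++ rev a3).
    by apply/seq.permP => x; rewrite !count_cat !count_rev; clear; lia.
  by rewrite -(perm_uniq (perm _ _ _ _ _ _ _ _)) -Em -Ec.
- exact: mate_matching.
- have [p0 _] := ends_inhabited hL; rewrite rev_sorted; apply/(sortedP p0) => i.
  have sz : size (take (j2 - j1) (drop j1 a)) = (j2 - j1)%N.
    by rewrite size_takel // size_drop size_a; clear -j2m; lia.
  rewrite sz => lt_i; rewrite !nth_take // ?(ltnW lt_i) // !nth_drop.
  apply/eqP => E.
  have lt_m : ((j1 + i).+1 < m)%N by clear -lt_i j2m; lia.
  have := other_returns (p0 := p0) lt_m; rewrite -addnS -E CK => /(_ erefl).
  by clear -lt_i; lia.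
- by rewrite size_ps addnn.
- by rewrite -c_a map_take.
- by rewrite -c_a -map_drop map_take.
- by rewrite -c_a map_drop.
- by rewrite -Ec; move: un0; rewrite catA cat_uniq => /and3P [].
- by rewrite -Ec => p; rewrite c_out => pa; apply: contraL pa; apply: out_cd.
- by rewrite -Ec => p; rewrite orbC c_out (sm.1) tot.
Qed.
End Frame.

(** * The position of the family on the boundary *)

Lemma infix_run (T : Type) (Y : seq T) k s : (k + s <= size Y)%N ->
  Y = take k Y ++ take s (rot k Y) ++ drop (k + s) Y.
Proof.
move=> le_ks; rewrite /rot takel_cat; last by rewrite size_drop; lia.
by rewrite addnC -drop_drop cat_take_drop cat_take_drop.
Qed.

(** A cyclic run that avoids the non-empty word [X] cannot wrap around, as it would contain the
    first letter of [X]. *)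
Lemma split_run (T : eqType) (X M : seq T) k s :
  (k <= size (X ++ M))%N -> X != [::] -> (0 < s)%N ->
  {in X, forall x, x \notin take s (rot k (X ++ M))} ->
  exists u t, M = u ++ take s (rot k (X ++ M)) ++ t.
Proof.
case: X => [//|x X]; set Y := (x :: X) ++ M => le_k _ s_gt0 avoid.
have xY : x \notin take s (rot k Y) by rewrite avoid ?mem_head.
have lt_k : (k < size Y)%N.
  rewrite ltn_neqAle le_k andbT; apply: contraNneq xY => ->.
  by rewrite rot_size /Y /=; case: (s) s_gt0 => // s' _; rewrite mem_head.
have le_X : (size (x :: X) <= k)%N.
  rewrite leqNgt; apply/negP => lt_X.
  have /avoid/negP[] : nth x Y k \in x :: X by rewrite /Y nth_cat lt_X mem_nth.
  rewrite /rot (drop_nth x) //.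
  by case: (s) s_gt0 => // s' _; rewrite mem_head.
have le_ks : (k + s <= size Y)%N.
  rewrite leqNgt; apply: contra xY => lt_N; rewrite /rot take_cat size_drop.
  rewrite ifF; last by clear -lt_N; lia.
  rewrite mem_cat; apply/orP; right.
  have : (0 < k)%N by apply: leq_trans le_X.
  have : (0 < s - (size Y - k))%N by clear -lt_N lt_k; lia.
  by case: (s - _)%N => // s' _; case: (k) => // k' _; rewrite mem_head.
have := congr1 (drop (size (x :: X))) (infix_run le_ks).
rewrite {1}/Y drop_size_cat // => EM.
exists (drop (size (x :: X)) (take k Y)), (drop (k + s) Y).
rewrite EM drop_cat size_takel ?(ltnW lt_k) //; case: ltnP => // le_k2.
have -> : (size (x :: X) - k = 0)%N by apply/eqP; rewrite subn_eq0.
rewrite drop0 [drop _ (take _ _)]drop_oversize //. by rewrite size_takel // ltnW.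
Qed.

Section Labels.
Variables m n : nat.
Implicit Types p : bpoint m n.

Lemma cw_nth p0 i : (i < (m + n).*2)%N -> cw (nth p0 (clockwise m n) i) = i.
Proof. by move=> lt_i; rewrite /cw index_uniq ?clockwise_uniq // size_clockwise. Qed.

Lemma y'label_cw p : (m <= cw p)%N -> y'label p = Some ((cw p).+1%:Z - m%:Z - n%:Z).
Proof. by rewrite cwE; case: p => i /= lt_i; have := ltn_ord i => lti; [congr Some; lia..| lia| congr Some; lia]. Qed.

Lemma ylabel_cw p : (cw p < m + n)%N -> ylabel p = Some (m%:Z - (cw p)%:Z).
Proof. by rewrite cwE; case: p => i /= lt_i; have := ltn_ord i => lti; try (congr Some); lia. Qed.

(** The bottom points close the clockwise list but come just before the left side; lowering their
    index by 2(m + n) continues the formula of [ylabel_cw]. *)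
Lemma ylabel_cw_wrap p : (m + n + m <= cw p)%N ->
  ylabel p = Some (m%:Z + (m + n).*2%:Z - (cw p)%:Z).
Proof. by rewrite cwE; case: p => i /= lt_i; have := ltn_ord i => lti; try (congr Some); lia. Qed.

End Labels.

Lemma mem_arc m n (C : catState m n) L : local_family C L ->
  forall p, ([set p; C p] \in L) = (p \in ends L).
Proof.
move=> hL p; apply/idP/idP => [cL|].
  by apply/bigcupP; exists [set p; C p]; rewrite // !inE eqxx.
case/bigcupP => A AL; have [q Eq] := local_arc hL AL.
rewrite Eq !inE => /orP [] /eqP ->; first by rewrite -Eq.
by rewrite mateK setUC -Eq.
Qed.

Section Lattice.
Variables (R : comNzRingType) (al be de : R).
Hypothesis al_be : al * be = 1.
Hypothesis deE : de = - al ^+ 2 - be ^+ 2.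
Variables (m n : nat) (C : catState m n) (L : {set {set bpoint m n}}).
Hypothesis hL : local_family C L.
Local Notation P := (bpoint m n).
Local Notation ps := (ends_cw L).
Local Notation straight := (straight m n).
Local Notation cl := (clockwise m n).
Local Notation lefts := [seq (Lft j : P) | j <- enum 'I_m].
Local Notation tops := [seq (Top i : P) | i <- enum 'I_n].
Local Notation rights := (rights m n).
Local Notation bottoms := (bottoms m n).
Variables j1 j2 : nat.
Hypotheses (j12 : (j1 <= j2)%N) (j2m : (j2 <= m)%N).
Hypothesis returns : forall (c : {set P}) (j : int), c \in arcs C ->
  ends_at (@ylabel m n) c j \/ ends_at (@y'label m n) c j ->
  if c \in L then j1%:Z <= j <= j2%:Z else (j <= j1%:Z) || (j2%:Z <= j).
Local Notation delta g := (fun f : {ffun P -> P} => (f == g)%:R : R).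
Local Notation factors := (ssum al be de (cells rights bottoms) (delta (mate C)) straight =
  pluck al be #|L| (map (chord C) ps) *
  ssum al be de (cells rights bottoms) (delta (mate (parallel_state hL))) straight).

Let straightT : map straight tops = bottoms.
Proof. by rewrite -map_comp; apply: eq_map => i /=; rewrite ffunE. Qed.
Let straightB : map straight bottoms = tops.
Proof. by rewrite -map_comp; apply: eq_map => i /=; rewrite ffunE. Qed.
Let straightL : map straight lefts = rights.
Proof. by rewrite -map_comp; apply: eq_map => i /=; rewrite ffunE. Qed.
Let straightR : map straight rights = lefts.
Proof. by rewrite -map_comp; apply: eq_map => i /=; rewrite ffunE. Qed.

Let size_tops : size tops = n. Proof. by rewrite size_map size_enum_ord. Qed.
Let size_bots : size bottoms = n. Proof. by rewrite size_map size_enum_ord. Qed.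
Let size_lefts : size lefts = m. Proof. by rewrite size_map size_enum_ord. Qed.
Let size_rights : size rights = m. Proof. by rewrite size_map size_enum_ord. Qed.

Let in_arc p : p \in ends L -> forall j,
  (ylabel p = Some j /\ ylabel (C p) = Some (j + 1)) \/
  (ylabel p = Some (j + 1) /\ ylabel (C p) = Some j) \/
  (y'label p = Some j /\ y'label (C p) = Some (j + 1)) \/
  (y'label p = Some (j + 1) /\ y'label (C p) = Some j) ->
  j1%:Z <= j <= j2%:Z.
Proof.
move=> pL j H; have := @returns [set p; C p] j; rewrite (mem_arc hL) pL.
apply; first by apply: imset_f.
case: H => [[? ?]|[[? ?]|[[? ?]|[? ?]]]]; [left|left|right|right].
- by exists p, (C p).
- by exists (C p), p; rewrite setUC.
- by exists p, (C p).
- by exists (C p), p; rewrite setUC.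
Qed.

Let out_arc p : p \notin ends L -> forall j,
  (ylabel p = Some j /\ ylabel (C p) = Some (j + 1)) \/
  (ylabel p = Some (j + 1) /\ ylabel (C p) = Some j) \/
  (y'label p = Some j /\ y'label (C p) = Some (j + 1)) \/
  (y'label p = Some (j + 1) /\ y'label (C p) = Some j) ->
  (j <= j1%:Z) || (j2%:Z <= j).
Proof.
move=> pL j H; have := @returns [set p; C p] j; rewrite (mem_arc hL) (negbTE pL).
apply; first by apply: imset_f.
case: H => [[? ?]|[[? ?]|[[? ?]|[? ?]]]]; [left|left|right|right].
- by exists p, (C p).
- by exists (C p), p; rewrite setUC.
- by exists p, (C p).
- by exists (C p), p; rewrite setUC.
Qed.

Let clE : cl = rev lefts ++ tops ++ rights ++ rev bottoms. Proof. by []. Qed.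

Let nth_M p0 i : nth p0 (tops ++ rights ++ rev bottoms) i = nth p0 cl (m + i).
Proof. by rewrite clE [RHS]nth_cat size_rev size_lefts ltnNge leq_addr addKn. Qed.

Let nth_lefts p0 i : (i < m)%N -> nth p0 lefts i = nth p0 cl (m - i.+1).
Proof.
move=> lt_i; rewrite clE [RHS]nth_cat size_rev size_lefts ifT; last by clear -lt_i; lia.
rewrite nth_rev size_lefts; last by clear -lt_i; lia.
by congr nth; clear -lt_i; lia.
Qed.

Lemma factors_left u t : (forall j, Lft j \notin ends L) ->
  tops ++ rights ++ rev bottoms = u ++ ps ++ t -> factors.
Proof.
move=> avoid split_ps.
apply: (frame_factor al_be deE hL (k0 := 0) (a := lefts) (b := tops) (u := u) (t := t)
  (j1 := j1) (j2 := j2)) => //; first by rewrite rot0.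
- move=> p0 i; rewrite !size_cat size_rev size_tops size_rights size_bots => lt_i.
  rewrite !nth_M (mem_ends_cw hL) => iL Ci.
  have H k : (k < n + m + n)%N -> y'label (nth p0 cl (m + k)) = Some (k.+1%:Z - n%:Z).
    move=> lt_k; rewrite y'label_cw cw_nth; [congr Some; clear; lia|clear -lt_k; lia|clear; lia|clear -lt_k; lia].
  (* The entry of index i in [M] has extended label y'_{i + 1 - n}; hence the shift by n in the
     bounds of the frame. *)
  have := in_arc iL (j := i.+1%:Z - n%:Z); rewrite Ci !H; [|clear -lt_i; lia..].
  case/(_ _)/andP; last by clear; lia.
  by right; right; left; split => //; congr Some; clear; lia.
- move=> p0 i lt_i Ci.
  have iL : nth p0 lefts i \notin ends L.
    have : nth p0 lefts i \in lefts by rewrite mem_nth ?size_lefts // ltnW.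
    by case/mapP => j _ ->.
  have := out_arc iL (j := i.+1%:Z); rewrite Ci !nth_lefts ?(ltnW lt_i) //.
  have H k : (k < m)%N -> ylabel (nth p0 cl (m - k.+1)) = Some k.+1%:Z.
    move=> lt_k; rewrite ylabel_cw cw_nth; [congr Some; clear -lt_k; lia|clear -lt_k; lia..].
  rewrite !H ?(ltnW lt_i) // => /(_ _) E; apply: E.
  by left; split=> //; congr Some; clear; lia.
Qed.

Let Y' := rights ++ rev bottoms ++ rev lefts ++ tops.

Let rotY : rot (m + n) cl = Y'.
Proof.
have -> : (m + n = size (rev lefts ++ tops))%N by rewrite size_cat size_rev size_lefts size_tops.
by rewrite clE catA rot_size_cat -catA.
Qed.

(** After a half turn the rows are counted from below, so j1 and j2 become m - j2 and m - j1. *)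
Lemma factors_right u t : (forall j, Rgt j \notin ends L) ->
  rev bottoms ++ rev lefts ++ tops = u ++ ps ++ t -> factors.
Proof.
move=> avoid split_ps.
have sm := straight_matching m n.
have flip phi : ssum al be de (cells rights bottoms) phi straight =
    ssum al be de (cells (rev lefts) (rev tops)) phi straight.
  rewrite ssum_flip // ?straightR ?straightB //.
  - have i1 : injective (@Rgt m n) by move=> ? ? [].
    have i2 : injective (@Bot m n) by move=> ? ? [].
    rewrite cat_uniq (map_inj_uniq i1) (map_inj_uniq i2) !enum_uniq andbT /=.
    by apply/hasPn => p /mapP [i _ ->]; apply/mapP => -[].
  - move=> p; rewrite mem_cat => /orP [] /mapP [i _ ->]; rewrite ffunE mem_cat;
    by apply/norP; split; apply/mapP => -[].
have nth_Y p0 i : nth p0 (rev bottoms ++ rev lefts ++ tops) i = nth p0 Y' (m + i).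
  by rewrite /Y' [RHS]nth_cat size_rights ltnNge leq_addr addKn.
have label_Y p0 i : (i < n + m + n)%N ->
    ylabel (nth p0 (rev bottoms ++ rev lefts ++ tops) i) = Some (m%:Z + n%:Z - i%:Z).
  move=> lt_i; rewrite nth_Y -rotY /rot nth_cat size_drop size_clockwise.
  case: ltnP => [lt|le].
    rewrite nth_drop ylabel_cw_wrap cw_nth; [congr Some; clear; lia|clear -lt; lia..].
  rewrite nth_take; last by clear -le lt_i; lia.
  by rewrite ylabel_cw cw_nth; [congr Some; clear -le; lia|clear -lt_i le; lia..].
have label_a p0 i : (i < m)%N -> y'label (nth p0 (rev rights) i) = Some (m%:Z - i%:Z).
  move=> lt_i; rewrite nth_rev size_rights //.
  rewrite (nth_map (Ordinal lt_i)) ?size_enum_ord; last by clear -lt_i; lia.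
  rewrite /= nth_enum_ord; last by clear -lt_i; lia.
  by congr Some; clear -lt_i; lia.
rewrite !flip.
apply: (frame_factor al_be deE hL (k0 := (m + n)%N) (a := rev rights) (b := rev bottoms)
  (u := u) (t := t)
  (j1 := (m - j2)%N) (j2 := (m - j1)%N)) => //.
- by clear; lia.
- by rewrite rotY !revK.
- by rewrite map_rev straightL.
- by rewrite map_rev straightT.
- by rewrite size_rev.
- by rewrite size_rev.
- by rewrite revK.
- by clear -j12 j2m; lia.
- by clear -j12 j2m; lia.
- move=> p0 i; rewrite revK !size_cat !size_rev size_tops size_lefts size_bots => lt_i.
  rewrite (mem_ends_cw hL) => iL Ci.
  have := in_arc iL (j := m%:Z + n%:Z - i.+1%:Z); rewrite Ci !label_Y; [|clear -lt_i; lia..].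
  case/(_ _)/andP; last by clear -lt_i j12 j2m; lia.
  by right; left; split => //; congr Some; clear; lia.
- move=> p0 i lt_i Ci.
  have iL : nth p0 (rev rights) i \notin ends L.
    have : nth p0 (rev rights) i \in rev rights by rewrite mem_nth ?size_rev ?size_rights // ltnW.
    by rewrite mem_rev => /mapP [j _ ->].
  have := out_arc iL (j := m%:Z - i.+1%:Z); rewrite Ci !label_a ?(ltnW lt_i) // => /(_ _) H.
  have := H _; clear H; move=> H.
  have {}H : (m%:Z - i.+1%:Z <= j1%:Z) || (j2%:Z <= m%:Z - i.+1%:Z).
    by apply: H; right; right; right; split=> //; congr Some; clear; lia.
  by clear -H lt_i j12 j2m; lia.
Qed.

(* Without rows, an arc of [straight] leaving the ends of [L] kills both sides. *)
Let factors_no_row p : m = 0 -> p \notin ends L -> straight p \in ends L -> factors.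
Proof.
move=> m0 pL spL.
have ne (D : catState m n) : D p = C p -> (straight == mate D) = false.
  by move=> DE; apply: contraTF spL => /eqP ->; rewrite DE (ends_mateE hL).
have no_cells : cells rights bottoms = [::].
  by rewrite /rights (size0nil (_ : size (enum 'I_m) = 0)) // size_enum_ord.
have neP : (straight == mate (parallel_state hL)) = false.
  by apply: ne; rewrite ffunE /= (mem_ends_cw hL) (negbTE pL).
by rewrite /= in neP; rewrite no_cells /= ne ?neP ?mulr0.
Qed.

(** For m > 0 the boundary is cut at the avoided side, which is not empty. For m = 0 no side
    separates top and bottom, and the run of ends may pass one or both of the corners where the two
    orders [cl] and [Y'] are cut. *)
Lemma lattice_factors :
  (forall j, Lft j \notin ends L) \/ (forall j, Rgt j \notin ends L) -> factors.
Proof.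
have [k le_k [Eps _]] := ends_cwP hL; set s := (#|L| + #|L|)%N in Eps.
have size_ps : size ps = s := size_ends_cw hL.
have Cs : (s < (m + n).*2)%N.
  have : ends L != setT by case/and4P: hL.
  rewrite -subTset => /subsetPn [p _ pL].
  rewrite -size_clockwise -size_ps; apply: (@uniq_leq_size _ (p :: ps)).
    by rewrite /= (mem_ends_cw hL) pL (ends_cw_uniq hL).
  by move=> q _; apply: mem_clockwise.
have s_gt0 : (0 < s)%N by case/and4P: hL; rewrite -card_gt0 /s addn_gt0 => ->.
have szY : size Y' = (m + n).*2 by rewrite -rotY size_rot size_clockwise.
have clY : cl = rot (m + n) Y'.
  rewrite -rotY rot_add_mod ?size_clockwise -?addnn ?leqnn ?leq_addr //.
  by rewrite addnn -size_clockwise rot_size.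
case: (posnP m) => [m0 _|m_gt0].
  have no_lft j : Lft j \notin ends L by have := ltn_ord j; rewrite {2}m0.
  have no_rgt j : Rgt j \notin ends L by have := ltn_ord j; rewrite {2}m0.
  have lefts0 : lefts = [::] by apply: size0nil; rewrite size_lefts.
  have rights0 : rights = [::] by apply: size0nil; rewrite size_rights.
  have n_gt0 : (0 < n)%N by clear -m0 Cs; lia.
  have left_run k1 : (k1 + s <= (m + n).*2)%N -> ps = take s (rot k1 cl) -> factors.
    rewrite -size_clockwise => /infix_run E Ek1; apply: (factors_left no_lft).
    by have := E; rewrite -Ek1 {1}clE lefts0; apply.
  have [k_eq|k_neq] := eqVneq k (m + n).*2.
    by apply: (left_run 0) (ltnW Cs) _; rewrite rot0 Eps k_eq /run -size_clockwise rot_size.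
  have lt_k : (k < (m + n).*2)%N by rewrite ltn_neqAle k_neq.
  case: (leqP (k + s) (m + n).*2) => [/left_run|lt_s]; first exact.
  (* The run passes the cut of [cl]; it may still be contiguous in [Y']. *)
  case: (boolP ((n <= k)%N && (k + s <= n + (m + n).*2)%N)) => [/andP [le1 le2]|bad].
    have le3 : (k - n + s <= size Y')%N by rewrite szY; clear -le1 le2; lia.
    apply: (factors_right no_rgt); have := infix_run le3.
    have -> : rot (k - n) Y' = rot k cl.
      rewrite -rotY -rotD ?size_clockwise; first by congr rot; clear -m0 le1; lia.
      by clear -m0 le1 le_k; lia.
    by rewrite -/(run m n k s) -Eps {1}/Y' rights0 lefts0; apply.
  (* Now the run passes both cuts. The point just before it is joined by a vertical line to the
     point of index 2n - k, which lies in the run; so [straight] is neither of the two states and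
     both sums vanish. *)
  set p0 := nth (Top (Ordinal n_gt0)) cl k.-1.
  have cw_p : cw p0 = k.-1 by apply: cw_nth; clear -lt_k; lia.
  have cw_sp : cw (straight p0) = ((m + n).*2 - k)%N.
    have cw_s q : cw (straight q) = ((m + n).*2 - (cw q).+1)%N.
      rewrite ffunE; case: q => q; have := ltn_ord q; rewrite !cwE; clear -m0; lia.
    by rewrite cw_s cw_p; clear -lt_s Cs; lia.
  have in_ps p : (p \in ends L) = (index p (rot k cl) < s)%N.
    rewrite -(mem_ends_cw hL) Eps in_take_leq // size_rot size_clockwise ltnW //.
  apply: (factors_no_row (p := p0)) => //.
    have k_gt0 : (0 < k)%N by clear -lt_s Cs; lia.
    by rewrite in_ps index_rot // cw_p ltn_predL k_gt0 -leqNgt; clear -Cs lt_k k_gt0; lia.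
  rewrite in_ps index_rot // cw_sp; case: ifP => H; clear -bad lt_s Cs lt_k m0 H; lia.
have ne (x : seq P) : size x = m -> x != [::] by case: x => //=; move: m_gt0 => /[swap] <-.
case=> avoid.
  have avoid' : {in rev lefts, forall p, p \notin ps}.
    by move=> p; rewrite mem_rev (mem_ends_cw hL) => /mapP [j _ ->].
  have [] := @split_run _ (rev lefts) (tops ++ rights ++ rev bottoms) k s.
  - by rewrite -clE size_clockwise.
  - by apply: ne; rewrite size_rev.
  - by [].
  - by rewrite -clE -/(run m n k s) -Eps.
  - by move=> u [t]; rewrite -clE -/(run m n k s) -Eps; apply: factors_left.
have avoid' : {in rights, forall p, p \notin ps}.
  by move=> p; rewrite (mem_ends_cw hL) => /mapP [j _ ->].
pose k' := if (k + (m + n) <= size Y')%N then (k + (m + n))%N else (k + (m + n) - size Y')%N.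
have Eps' : ps = take s (rot k' Y').
  by rewrite Eps /run {1}clY rot_add_mod // ?szY // -addnn leq_addr.
have [] := @split_run _ rights (rev bottoms ++ rev lefts ++ tops) k' s.
- rewrite -/Y' /k' szY. by case: ifP => // _; clear -le_k; lia.
- exact: ne.
- by [].
- by rewrite -/Y' -Eps'.
- by move=> u [t]; rewrite -/Y' -Eps'; apply: factors_right.
Qed.
End Lattice.

Section TreeState.
Variables (m n : nat) (C : catState m n) (L : {set {set bpoint m n}}).
Hypothesis hL : local_family C L.
Local Notation ps := (ends_cw L).
Local Notation T := (tree_state hL).

Lemma tree_lft a : T (Lft a) = Bot (lshift #|L| (rev_ord a)).
Proof. by rewrite ffunE. Qed.

Lemma tree_rgt a : T (Rgt a) = Bot (rshift #|L| a).
Proof. by rewrite ffunE. Qed.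

Lemma tree_top i : exists j, T (Top i) = Top j.
Proof. by rewrite ffunE /=; eexists. Qed.

Lemma tree_topE p0 (i j : 'I_(#|L| + #|L|)) :
  (T (Top i) == Top j) = (C (nth p0 ps i) == nth p0 ps j).
Proof.
have size_ps := size_ends_cw hL; have un := ends_cw_uniq hL.
have in_ps k : (k < #|L| + #|L|)%N -> nth p0 ps k \in ps by move=> ?; rewrite mem_nth ?size_ps.
have Cp : C (nth p0 ps i) \in ps.
  by rewrite (mem_ends_cw hL) (ends_mateE hL) -(mem_ends_cw hL) in_ps.
have lt_C : (index (C (nth p0 ps i)) ps < #|L| + #|L|)%N by have := Cp; rewrite -index_mem size_ps.
have -> : T (Top i) = Top (Ordinal lt_C).
  rewrite ffunE /=; congr Top; apply: val_inj.
  by rewrite (nth_map p0) ?size_ps // val_insubd lt_C.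
apply/eqP/eqP => [[/(congr1 val) /= <-]|E]; first by rewrite nth_index.
by congr Top; apply: val_inj; rewrite /= E index_uniq ?size_ps.
Qed.

(** The top points of the tree state copy the arcs of the family, so the two words have equal
    letters in the same positions. *)
Lemma pluck_tree (R : comNzRingType) (al be : R) r :
  pluck al be r (map (chord T) [seq Top i | i <- enum 'I_(#|L| + #|L|)]) =
  pluck al be r (map (chord C) ps).
Proof.
have size_ps := size_ends_cw hL; have un := ends_cw_uniq hL.
have [p0 _] := ends_inhabited hL.
pose z := [seq (chord C (nth p0 ps i), chord T (Top i)) | i : 'I_(#|L| + #|L|) <- enum 'I_(#|L| + #|L|)].
have -> : map (chord C) ps = unzip1 z.
  rewrite /unzip1 -map_comp -{1}(mkseq_nth p0 ps) -map_comp size_ps.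
  by rewrite -val_enum_ord -map_comp.
have -> : map (chord T) [seq Top i | i <- enum 'I_(#|L| + #|L|)] = unzip2 z.
  by rewrite /unzip2 -!map_comp.
apply/esym/eq_pluck => _ _ /mapP [i _ ->] /mapP [j _ ->] /=.
have [-> |ij] := eqVneq i j; first by rewrite !eqxx.
rewrite (eq_chord (mate_matching C)) ?(eq_chord (mate_matching T)).
- by rewrite (tree_topE p0).
- by apply: contra ij => /eqP [->].
- by rewrite nth_uniq ?size_ps.
Qed.

End TreeState.

Theorem theorem5p2 (m n : nat) (C : catState m n)
    (L : {set {set bpoint m n}}) (hL : local_family C L) :
  vertically_factorizes C L ->
  coefficient C =
    (coefficient (tree_state hL) * coefficient (parallel_state hL))%R /\
  (realizable C <-> realizable (parallel_state hL)).
Proof.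
case=> avoid [j1 [j2 [j1_ge0 j12 j2m returns]]].
case: j1 j1_ge0 j12 returns => // j1 _; case: j2 j2m => // j2; rewrite !lez_nat => j2m j12 returns.
have factors R al be de al_be deE :=
  @lattice_factors R al be de al_be deE m n C L hL _ _ j12 j2m returns avoid.
split.
  rewrite !coefficientE (factors _ _ _ _ varA_inv erefl).
  rewrite (tree_ssum varA_inv erefl); [|exact: tree_lft|exact: tree_rgt|exact: tree_top].
  by rewrite pluck_tree.
rewrite !realizableE (factors int 1 1 _ (mulr1 _) erefl) mulf_eq0 negb_or.
have [k le_k [E _]] := ends_cwP hL.
have [r dy] : exists r, dyck r (map (chord C) (ends_cw L)).
  (* A degenerate frame is enough to see a Dyck word: the whole boundary, cut at p_1, is taken as
     one side. *)
  apply: (ends_dyck hL (k0 := k) (a := [::]) (b := rot k (clockwise m n))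
    (c := [::]) (d := [::]) (u := [::]) (t := drop (#|L| + #|L|) (rot k (clockwise m n)))) => //.
    by rewrite /= cats0.
  by rewrite /= cats0 E cat_take_drop.
have -> : #|L| = r.
  by have := dyck_size dy; rewrite size_map (size_ends_cw hL); clear; lia.
by rewrite (gt_eqF (pluck_gt0 dy)).
Qed.
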